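(* There exist real constants $A_0,B_0$ such that for every fixed $\varepsilon>0$, as $x\to\infty$ ($x$ real), $$\sum_{m,n\le x}s(m,n)=x^2\left(\sum_{r=0}^3A_r(\log x)^r\right)+O\left(x^{\frac{1117}{701}+\varepsilon}\right),$$ $$\sum_{m,n\le x}c(m,n)=x^2\left(\sum_{r=0}^3B_r(\log x)^r\right)+O\left(x^{\frac{1117}{701}+\varepsilon}\right),$$ where the sums run over pairs of positive integers $m,n\le x$, the implied constants depend only on $\varepsilon$, and $$A_3=\frac1{3\zeta(2)}=\frac{2}{\pi^2},\qquad A_2=\frac1{\zeta(2)}\left(3\gamma-1-\frac{\zeta'(2)}{\zeta(2)}\right),$$ $$A_1=\frac1{\zeta(2)}\left(8\gamma^2-6\gamma-2\gamma_1+1-2(3\gamma-1)\frac{\zeta'(2)}{\zeta(2)}+2\left(\frac{\zeta'(2)}{\zeta(2)}\right)^2-\frac{\zeta''(2)}{\zeta(2)}\right),$$ $$B_3=\frac1{3\zeta^2(2)}=\frac{12}{\pi^4},\qquad B_2=\frac1{\zeta^2(2)}\left(3\gamma-1-2\frac{\zeta'(2)}{\zeta(2)}\right),$$ $$B_1=\frac1{\zeta^2(2)}\left(8\gamma^2-6\gamma-2\gamma_1+1-4(3\gamma-1)\frac{\zeta'(2)}{\zeta(2)}+6\left(\frac{\zeta'(2)}{\zeta(2)}\right)^2-2\frac{\zeta''(2)}{\zeta(2)}\right).$$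
   Context: For positive integers $m,n$, $s(m,n)$ denotes the total number of subgroups of the group $\mathbb{Z}_m\times\mathbb{Z}_n$, and $c(m,n)$ denotes the number of its cyclic subgroups, where $\mathbb{Z}_m$ is the additive group of residue classes modulo $m$. $\zeta$ is the Riemann zeta function. The Stieltjes constants are $\gamma_k=\lim_{x\to\infty}\left(\sum_{n\le x}\frac{(\log n)^k}{n}-\frac{(\log x)^{k+1}}{k+1}\right)$ for $k=0,1,2,\ldots$, and $\gamma=\gamma_0$ is the Euler–Mascheroni constant. *)

(* Defs.v *)
From mathcomp Require Import all_boot all_order all_algebra.
From mathcomp Require Import all_fingroup all_solvable.
From mathcomp Require Import all_classical all_reals all_analysis.

Set Implicit Arguments.
Unset Strict Implicit.
Unset Printing Implicit Defensive.

Import Order.TTheory GRing.Theory Num.Theory.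
Import numFieldNormedType.Exports.

Local Open Scope ring_scope.
Local Open Scope classical_set_scope.

(* [Zp m] is the additive group of residues modulo [m] for every [m > 0]; in
   particular [Zp 1] is the trivial group although ['Z_1] has two elements. *)
Definition ZmxZn (m n : nat) : {group 'Z_m * 'Z_n} :=
  [group of finset.setX (Zp m) (Zp n)].

Definition nb_subgroups (m n : nat) : nat := #|subgroups (ZmxZn m n)|.

Definition nb_cyclic_subgroups (m n : nat) : nat :=
  #|[set G in subgroups (ZmxZn m n) | cyclic G]%SET|.

(* The indices run over the positive integers up to [x], since for [x >= 0]
   [Num.truncn x] is the integer part of [x]. *)
Definition sum_le2 (R : realType) (f : nat -> nat -> nat) (x : R) : R :=
  \sum_(1 <= m < (Num.truncn x).+1) \sum_(1 <= n < (Num.truncn x).+1)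
    (f m n)%:R.

(* The Riemann zeta function on the real half-line [s > 1]; the values
   for [s <= 1] are meaningless. *)
Definition zeta (R : realType) (s : R) : R :=
  limn (series (fun k : nat => k.+1%:R `^ (- s))).

Definition stieltjes (R : realType) (k : nat) : R :=
  lim ((fun x : R =>
          \sum_(1 <= n < (Num.truncn x).+1) ln n%:R ^+ k / n%:R
          - ln x ^+ k.+1 / k.+1%:R) x @[x --> +oo]).

(* Main.v *)
(* Hermite normal forms of the lattices containing mZ x nZ give
   s(m, n) = sum of gcd(a, b) over a | m and b | n, and counting the elements of
   each order gives c(m, n) = the same sum with phi(gcd(a, b)).  The summatory
   functions are therefore S_f(N) = sum_{a, b <= N} f(gcd(a, b)) [N/a] [N/b] for
   f = id and f = phi.  As 1 * phi = id and 1 * id = sigma, Moebius inversion in N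
   reduces both to S_sigma(N) = sum_d d D(N/d)^2, where D(y) = sum_{k <= y} tau(k).

   Write D(y) = y (ln y + 2 gamma - 1) + Delta(y).  For d <= N^(5/12) the square is
   expanded; the cross term sum_d (ln(N/d) + 2 gamma - 1) Delta(N/d) is a sum of
   sawtooth functions of N/(a d), and Vinogradov's elementary method (a Dirichlet
   approximation b/q of the slope, on blocks of length q) bounds it by
   N^(5/9 + eps).  The d > N^(5/12) are grouped by the value of [N/d].  The total
   error is O(N^(19/12 + eps)), and 19/12 < 1117/701.

   The coefficients come from sum_k mu(k) (ln k)^j / k^2, expressed through the
   derivatives of zeta at 2 by sum_{d | n} mu(d) = 0, and zeta(2) = pi^2/6 follows
   from 1/sin^2 y + 1/cos^2 y = 4/sin^2 2y. *)

Require Import Defs.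
From mathcomp Require Import all_boot all_order all_algebra.
From mathcomp Require Import all_fingroup all_solvable.
From mathcomp Require Import zify ring lra.

Set Implicit Arguments.
Unset Strict Implicit.
Unset Printing Implicit Defensive.

(** * Subgroups of Z_m x Z_n *)

Section Hermite.
Local Open Scope group_scope.

(** The exponent 19/12 comes from a cut at [N^t] between small and large [d]. Replacing the
    truncated logarithmic sums by their limits in the head, and counting the [d] with a given
    quotient in the tail, each cost about [N^(2 - t)], so [t] must exceed 285/701, about 0.4066. The
    obstacle is the cross term. Estimated one [d] at a time it costs [N^(3/2 + t/2)] with
    Dirichlet's bound [Delta(y) << y^(1/2)], and [N^(4/3 + 2t/3)] even with [y^(1/3)]; balanced
    against [N^(2 - t)] the latter gives at best 8/5, which is larger than 1117/701. Hence for [d]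
    beyond [N^(1/3)] the order of summation is exchanged and cancellation is sought in the sum over
    [d], for each fixed [a]. There the sawtooth estimate asks for [d] of order at most [N^(4/9)],
    and [t = 5/12] lies between the two constraints. The squares of [Delta] then need no more than
    Dirichlet's bound, [N^(1 + t)] in total. Logarithms are absorbed throughout into small powers
    [n^d]. *)

Lemma mem_Zp_lt k (x : 'Z_k) : (0 < k)%N -> (x \in Zp k) = (x < k)%N.
Proof.
case: k x => // -[|k] x _; rewrite /Zp /=.
  by rewrite inE -val_eqE /=; case: x => -[|].
by rewrite inE; case: x => x /= ->.
Qed.

(** ['Z_1] has two elements, so the reduction modulo [k] before [inZp] is what makes [red 1] land in
    the trivial group [Zp 1]. *)
Definition red k (u : nat) : 'Z_k := inZp (u %% k).

Lemma val_red k u : (0 < k)%N -> (red k u : nat) = (u %% k)%N.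
Proof.
move=> k0; rewrite /red /= modn_small //.
by have := ltn_pmod u k0; rewrite /Zp_trunc; lia.
Qed.

Lemma redD k u v : (0 < k)%N -> red k (u + v) = red k u * red k v.
Proof.
move=> k0; apply: val_inj; rewrite [LHS]val_red //.
have -> : val (red k u * red k v) = ((u %% k) + (v %% k)) %% (Zp_trunc k).+2.
  by rewrite /= !modnDml !modnDmr.
case: k k0 => // -[|k] _; first by rewrite !modn1.
by rewrite modnDml modnDmr.
Qed.

Lemma red_val k (x : 'Z_k) : x \in Zp k -> (0 < k)%N -> red k x = x.
Proof.
move=> xk k0; apply: val_inj; rewrite [LHS]val_red // modn_small //.
by rewrite -mem_Zp_lt.
Qed.

Section Lattice.
Variables m n : nat.
Hypotheses (m_gt0 : 0 < m) (n_gt0 : 0 < n).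

Definition red2 (w : nat * nat) : 'Z_m * 'Z_n := (red m w.1, red n w.2).

Lemma red2D u v u' v' : red2 (u + u', v + v')%N = red2 (u, v) * red2 (u', v').
Proof. by rewrite /red2 !redD. Qed.

Lemma red2_in w : red2 w \in ZmxZn m n.
Proof. by rewrite !inE !mem_Zp_lt // !val_red ?ltn_pmod. Qed.

Lemma red2_val (p : 'Z_m * 'Z_n) : p \in ZmxZn m n ->
  red2 (p.1 : nat, p.2 : nat) = p.
Proof. by case: p => p1 p2; rewrite !inE => /andP[? ?]; rewrite /red2 !red_val. Qed.

Lemma red2_0 u v : m %| u -> n %| v -> red2 (u, v) = 1.
Proof.
move=> mu nv; have e k w : (0 < k)%N -> k %| w -> red k w = 1.
  by move=> k0 kw; apply: val_inj; rewrite /= (eqP kw) mod0n.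
by rewrite /red2 !e.
Qed.

End Lattice.

End Hermite.

(* [hnf a b t] is the lattice spanned by [(a, t)] and [(0, b)]: every lattice
   containing [mZ x nZ] has a unique such Hermite normal form with [t < b]. *)
Definition hnf (a b t u v : nat) : bool := (a %| u) && (v == u %/ a * t %[mod b]).

(** The last condition says that [(m, 0)] lies in the lattice, and [b %| n] says the same of
    [(0, n)]. *)
Definition hnf_index m n (w : nat * nat * nat) : bool :=
  let: (a, b, t) := w in
  [&& a %| m, b %| n, t < b & b %| m %/ a * t].

Lemma hnfD m n a b t u v u' v' : 0 < m -> hnf_index m n (a, b, t) ->
  hnf a b t u' v' -> hnf a b t (u + u') (v + v') = hnf a b t u v.
Proof.
move=> m0 /and4P[am bn tb _]; have a0 := dvdn_gt0 m0 am.
move=> /andP[/dvdnP[k ->] /eqP e]; rewrite /hnf dvdn_addl ?dvdn_mull //.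
case: (boolP (a %| u)) => //= /dvdnP[l ->].
rewrite mulnK // in e; rewrite -mulnDl !mulnK // mulnDl.
rewrite -(eqn_modDr (k * t) v).
apply/idP/idP => /eqP h; apply/eqP; rewrite -h.
  by rewrite -(modnDmr _ (k * t)) -e modnDmr.
by rewrite -(modnDmr _ v') e modnDmr.
Qed.

Lemma hnf_m0 m n a b t : 0 < m -> hnf_index m n (a, b, t) -> hnf a b t m 0.
Proof. by move=> m0 /and4P[am bn tb e]; rewrite /hnf am eq_sym mod0n. Qed.

Lemma hnf_0n m n a b t : 0 < m -> hnf_index m n (a, b, t) -> hnf a b t 0 n.
Proof. by move=> m0 /and4P[am bn tb e]; rewrite /hnf dvdn0 div0n mul0n mod0n. Qed.

(** The entries can be read off the lattice: [(a, t)] and [(a', t')] belong to both, so [a] and [a']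
    divide each other; likewise [b] and [b'], through [(0, b)] and [(0, b')]; then [t] and [t'] are
    congruent modulo [b] and both below [b]. *)
Lemma hnf_inj m n a b t a' b' t' : 0 < m ->
  hnf_index m n (a, b, t) -> hnf_index m n (a', b', t') ->
  (forall u v, hnf a b t u v = hnf a' b' t' u v) -> (a, b, t) = (a', b', t').
Proof.
move=> m0 /and4P[am bn tb e] /and4P[am' bn' tb' e'] h.
have a0 := dvdn_gt0 m0 am; have a0' := dvdn_gt0 m0 am'.
have /andP[d1 _] : hnf a' b' t' a t by rewrite -h /hnf dvdnn divnn a0 mul1n /=.
have /andP[d2 _] : hnf a b t a' t' by rewrite h /hnf dvdnn divnn a0' mul1n /=.
have E : a = a' by apply/eqP; rewrite eqn_dvd d1 d2.
have d3 : b' %| b.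
  by have := h 0 b; rewrite /hnf !dvdn0 !div0n !mul0n !mod0n modnn eqxx /= => /esym.
have d4 : b %| b'.
  by have := h 0 b'; rewrite /hnf !dvdn0 !div0n !mul0n !mod0n modnn eqxx /= => e0; rewrite /dvdn e0.
have E' : b = b' by apply/eqP; rewrite eqn_dvd d3 d4.
have := h a t; rewrite -E -E' /hnf dvdnn divnn a0 !mul1n eqxx /= !modn_small //.
  by move/esym/eqP => <-.
by rewrite E'.
Qed.

Section HermiteNormalForm.
Variables (m n : nat) (L : nat -> nat -> bool).
Hypotheses (m_gt0 : 0 < m) (n_gt0 : 0 < n).
Hypothesis LD : forall u v u' v', L u' v' -> L (u + u') (v + v') = L u v.
Hypotheses (Lm0 : L m 0) (L0n : L 0 n).

(** [LD] lets elements of [L] be added and cancelled, which expresses a subgroup of Z^2 without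
    negative coordinates. Here [a] is the least positive first coordinate in [L], [b] the least
    positive number with [(0, b)] in [L], and [t] a second coordinate over [a], reduced modulo
    [b]. *)
Lemma lattice_hnf : exists a b t, hnf_index m n (a, b, t) /\ L =2 hnf a b t.
Proof.
have L00 : L 0 0 by rewrite -(LD 0 0 Lm0) /= !add0n.
have LM k u v : L u v -> L (k * u) (k * v).
  by move=> Luv; elim: k => // k IH; rewrite !mulSn LD.
pose A := [pred a | (0 < a) && [exists v : 'I_n, L a v]].
have Aof u v : 0 < u -> L u v -> A u.
  move=> u0 Lu; rewrite /= u0; apply/existsP.
  exists (Ordinal (ltn_pmod v n_gt0)) => /=.
  have := LM (v %/ n) _ _ L0n; rewrite muln0 => e.
  by rewrite -(LD u (v %% n) e) addn0 addnC -divn_eq.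
have exA : exists a, A a by exists m; apply: (Aof _ 0).
have [a /andP[a0 /existsP[t0 Lat0]] amin] := ex_minnP exA.
pose B := [pred b | (0 < b) && L 0 b].
have exB : exists b, B b by exists n; rewrite /= n_gt0.
have [b /andP[b0 Lb] bmin] := ex_minnP exB.
have L0M k : L 0 (k * b) by have := LM k _ _ Lb; rewrite muln0.
have L0 w : L 0 w = (b %| w).
  apply/idP/idP=> [Lw|/dvdnP[k ->]//].
  have : L 0 (w %% b) by rewrite -(LD 0 (w %% b) (L0M (w %/ b))) addnC -divn_eq.
  rewrite /dvdn; case: posnP => // r0 Lr.
  by have := bmin (w %% b); rewrite /= r0 Lr leqNgt ltn_pmod // => /(_ isT).
pose t := t0 %% b.
have Lat : L a t by rewrite -(LD a t (L0M (t0 %/ b))) addn0 addnC -divn_eq.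
have LE u v : L u v = hnf a b t u v.
  have Lk k := LM k _ _ Lat.
  (* Subtraction of [k] times [(a, t)]: the second coordinate is first raised by [k * t * b], a
     multiple of [b] not below [k * t], to stay within the naturals. *)
  have key k r w : L (k * a + r) w -> L r (w + k * t * b - k * t).
    move=> h; rewrite -(LD _ _ (Lk k)) subnK; last by nia.
    by rewrite addnC -[(k * a + r)%N]addn0 LD.
  apply/idP/idP => [|/andP[/dvdnP[k ->]]].
    move=> Luv.
    have au : a %| u.
      have := Luv; rewrite {1}(divn_eq u a) => /key Lr; rewrite /dvdn.
      case: posnP => // r0.
      by have := amin _ (Aof _ _ r0 Lr); rewrite leqNgt ltn_pmod.
    rewrite /hnf au; move: au Luv => /dvdnP[k ->] h; rewrite mulnK //=.
    rewrite -[(k * a)%N]addn0 in h; move/key: h; rewrite L0 => h.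
    rewrite -(modnMDl (k * t) v) addnC eqn_mod_dvd //.
    by nia.
  rewrite mulnK // => e; have := Lk k.
  case: (leqP (k * t) v) => kv h.
    have L0d : L 0 (v - k * t) by rewrite L0 -eqn_mod_dvd.
    by rewrite -(subnK kv) -[(k * a)%N]add0n LD.
  have L0d : L 0 (k * t - v) by rewrite L0 -eqn_mod_dvd 1?eq_sym // ltnW.
  by rewrite -(LD _ _ L0d) addn0 subnKC // ltnW.
exists a, b, t; split=> //.
have am : a %| m by have := Lm0; rewrite LE => /andP[].
rewrite /= am -L0 L0n /= ltn_pmod //=.
by have := Lm0; rewrite LE /hnf am mod0n /= eq_sym.
Qed.

End HermiteNormalForm.

Lemma sum_dvd_ord g b : 0 < b -> \sum_(t < g * b) (b %| t : nat) = g.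
Proof.
move=> b0; rewrite -(big_mkord xpredT (fun t => (b %| t) : nat)).
elim: g => [|g IH]; first by rewrite mul0n big_nil.
rewrite mulSnr (@big_cat_nat _ _ _ (g * b)) ?leq_addr //= IH -[RHS]addn1; congr addn.
rewrite -{1}[(g * b)%N]add0n big_addn addKn big_mkord.
case: b b0 {IH} => // b _; rewrite big_ord_recl /= add0n dvdn_mull //.
rewrite big1 ?addn0 // => i _; rewrite dvdn_addl ?dvdn_mull //.
case: (boolP (_ %| _)) => // /dvdn_leq; rewrite /bump /= => /(_ isT).
by have := ltn_ord i; lia.
Qed.

(** With [g] the gcd, [b / g] is prime to [k / g], so the condition only says that [b / g] divides
    [t]. *)
Lemma sum_dvd_mul_ord k b : 0 < b -> \sum_(t < b) (b %| k * t : nat) = gcdn k b.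
Proof.
move=> b0; set g := gcdn k b.
have g0 : 0 < g by rewrite gcdn_gt0 b0 orbT.
have [gk gb] : g %| k /\ g %| b by rewrite dvdn_gcdl dvdn_gcdr.
have bg0 : 0 < b %/ g by rewrite divn_gt0 // dvdn_leq.
have e (t : nat) : (b %| k * t) = (b %/ g %| t).
  rewrite -{1}(divnK gb) -{1}(divnK gk) mulnAC dvdn_pmul2r // Gauss_dvdr //.
  by rewrite coprime_sym /coprime -(eqn_pmul2r g0) muln_gcdl !divnK // mul1n.
rewrite -[RHS](sum_dvd_ord g bg0) mulnC divnK //.
by apply: eq_bigr => t _; rewrite e.
Qed.

Lemma sum_divn_divisors m (F : nat -> nat) : 0 < m ->
  \sum_(1 <= a < m.+1 | a %| m) F (m %/ a) = \sum_(1 <= a < m.+1 | a %| m) F a.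
Proof.
move=> m0.
have toord (H : nat -> nat) : \sum_(1 <= a < m.+1 | a %| m) H a =
    \sum_(a < m.+1 | a %| m) H a.
  rewrite -(big_mkord (fun a => a %| m)) [RHS]big_ltn_cond // dvd0n.
  by rewrite gtn_eqF.
rewrite !toord.
pose h (a : 'I_m.+1) : 'I_m.+1 := inord (m %/ a).
have hE (a : 'I_m.+1) : h a = m %/ a :> nat by rewrite inordK // ltnS leq_div.
rewrite [RHS](reindex_onto h h).
  apply: eq_big => a; last by rewrite hE.
  rewrite hE; apply/idP/andP => [am|[am /eqP <-]].
    by split; [rewrite dvdn_div | apply/eqP/val_inj; rewrite /= !hE divnA // mulKn].
  by rewrite hE dvdn_div // hE.
by move=> a am; apply: val_inj; rewrite /= !hE divnA // mulKn.
Qed.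

Section CountSubgroups.
Variables m n : nat.
Hypotheses (m_gt0 : 0 < m) (n_gt0 : 0 < n).
Local Open Scope group_scope.

Definition hnf_set (w : nat * nat * nat) : {set 'Z_m * 'Z_n} :=
  [set p in ZmxZn m n | hnf w.1.1 w.1.2 w.2 p.1 p.2].

Lemma hnf_mod a b t u v : hnf_index m n (a, b, t) ->
  hnf a b t (u %% m) (v %% n) = hnf a b t u v.
Proof.
move=> wP; have hD u' v' u1 v1 := @hnfD m n a b t u1 v1 u' v' m_gt0 wP.
have hM k u' v' : hnf a b t u' v' -> hnf a b t (k * u') (k * v').
  move=> h; elim: k => [|k IH]; first by rewrite !mul0n /hnf dvdn0 div0n mul0n mod0n.
  by rewrite !mulSn hD.
have hm := hM (u %/ m) _ _ (hnf_m0 m_gt0 wP).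
have hn := hM (v %/ n) _ _ (hnf_0n m_gt0 wP).
rewrite -(hD _ _ (u %% m) (v %% n) hm) -(hD _ _ _ _ hn) !muln0 addn0.
by rewrite addn0 [(u %% m + _)%N]addnC [(v %% n + _)%N]addnC -!divn_eq.
Qed.

Lemma red2_hnf_set w u v : hnf_index m n w ->
  (red2 m n (u, v) \in hnf_set w) = hnf w.1.1 w.1.2 w.2 u v.
Proof.
case: w => -[a b] t wP; rewrite [LHS]inE red2_in // andTb.
by rewrite -[RHS](hnf_mod u v wP) -(val_red u m_gt0) -(val_red v n_gt0).
Qed.

Lemma group_set_hnf w : hnf_index m n w -> group_set (hnf_set w).
Proof.
case: w => -[a b] t wP; apply/group_setP; split.
  by rewrite -(@red2_0 m n m_gt0 n_gt0 0 0) // red2_hnf_set // /hnf dvdn0 div0n mul0n mod0n.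
move=> x y xH yH.
have [xG yG] : x \in ZmxZn m n /\ y \in ZmxZn m n.
  by move: xH yH; rewrite inE [y \in hnf_set _]inE => /andP[-> _] /andP[-> _].
rewrite -(red2_val m_gt0 n_gt0 xG) -(red2_val m_gt0 n_gt0 yG) in xH yH *.
rewrite -red2D //; move: xH yH; rewrite !red2_hnf_set // => xH yH.
by rewrite (@hnfD m n).
Qed.

Definition hnf_group (w : nat * nat * nat) : {group 'Z_m * 'Z_n} := <<hnf_set w>>%G.

Lemma hnf_groupE w : hnf_index m n w -> hnf_group w = hnf_set w :> {set _}.
Proof. by move=> wP; rewrite /= (gen_set_id (group_set_hnf wP)). Qed.

Local Notation index := ('I_m.+1 * 'I_n.+1 * 'I_n.+1)%type.
Definition natw (w : index) : nat * nat * nat := (w.1.1 : nat, w.1.2 : nat, w.2 : nat).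

(** A subgroup [H] pulls back along [red2] to a lattice containing [(m, 0)] and [(0, n)], and the
    Hermite normal form of that lattice recovers [H]. *)
Lemma subgroups_hnf : subgroups (ZmxZn m n) =
  [set hnf_group (natw w) | w : index in [set w | hnf_index m n (natw w)]].
Proof.
apply/setP => H; apply/idP/imsetP => [|[w]]; last first.
  rewrite inE => wP ->; rewrite inE hnf_groupE //.
  by apply/subsetP => p; rewrite inE => /andP[].
rewrite inE => HG.
pose L u v := red2 m n (u, v) \in H.
have LD u v u' v' : L u' v' -> L (u + u')%N (v + v')%N = L u v.
  by rewrite /L red2D // => h; rewrite groupMr.
have [||a [b [t [wP LE]]]] := lattice_hnf m_gt0 n_gt0 LD.
- by rewrite /L red2_0 // group1.
- by rewrite /L red2_0 // group1.
have /and4P[am bn tb e] := wP.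
have am' : a < m.+1 by rewrite ltnS dvdn_leq.
have bn' : b < n.+1 by rewrite ltnS dvdn_leq.
have tn' : t < n.+1 by apply: ltn_trans bn'.
exists (Ordinal am', Ordinal bn', Ordinal tn'); first by rewrite inE.
apply: val_inj => /=; rewrite -[RHS]/(hnf_group (natw _) : {set _}) hnf_groupE //.
apply/setP => p.
have [pG|pG] := boolP (p \in ZmxZn m n); last first.
  by rewrite inE (negPf pG); apply: contraNF pG; apply: subsetP.
by rewrite -(red2_val m_gt0 n_gt0 pG) red2_hnf_set // -LE.
Qed.

(** For given [a] and [b] the admissible [t < b] are those with [b %| m %/ a * t], and there are
    [gcdn (m %/ a) b] of them; then [a] is exchanged with [m %/ a]. *)
Lemma nb_subgroupsE : nb_subgroups m n =
  (\sum_(1 <= a < m.+1 | a %| m) \sum_(1 <= b < n.+1 | b %| n) gcdn a b)%N.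
Proof.
rewrite /nb_subgroups subgroups_hnf card_in_imset; last first.
  move=> w w'; rewrite !inE => wP wP' /(congr1 (fun G : {group _} => (G : {set _}))).
  rewrite !hnf_groupE // => /setP e.
  have : natw w = natw w'.
    move: wP wP' e; rewrite /natw => wP wP' e.
    apply: (hnf_inj m_gt0 wP wP') => u v.
    by have := e (red2 m n (u, v)); rewrite !red2_hnf_set.
  case: w w' {wP wP' e} => -[a b] t [[a' b'] t'] [] /val_inj -> /val_inj ->.
  by move=> /val_inj ->.
rewrite -sum1_card big_mkcond /=.
rewrite -(sum_divn_divisors (fun a => \sum_(1 <= b < n.+1 | b %| n) gcdn a b)%N) //.
have toord k (H : nat -> nat) : (\sum_(1 <= a < k.+1 | a %| k) H a =
    \sum_(a < k.+1) if (0 < a) && (a %| k) then H a else 0)%N.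
  rewrite big_mkcond -(big_mkord xpredT (fun a => if (0 < a) && (a %| k) then H a else 0)%N).
  by rewrite [RHS]big_ltn // add0n; apply: eq_big_nat => i /andP[-> _].
rewrite toord (eq_bigr (fun w : index => (hnf_index m n (natw w)) : nat)); last first.
  move=> w _; rewrite inE -[X in if X then _ else _]/(hnf_index m n (natw w)).
  by case: (hnf_index m n _).
rewrite -(pair_bigA _ (fun ab t => (hnf_index m n (natw (ab, t))) : nat)) /=.
rewrite -(pair_bigA _ (fun a b => \sum_t (hnf_index m n (natw (a, b, t)) : nat))%N) /=.
apply: eq_bigr => a _; rewrite /natw /= toord.
have [am|am] := boolP (a %| m); last by rewrite andbF; do 2!apply: big1 => ? _.
rewrite (dvdn_gt0 _ am) //=; apply: eq_bigr => b _.
have [bn|bn] := boolP (b %| n); last by rewrite andbF; apply: big1 => ? _.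
have b0 := dvdn_gt0 n_gt0 bn; rewrite b0 /= -sum_dvd_mul_ord //.
rewrite [RHS](big_ord_widen _ (fun t => (b %| m %/ a * t) : nat) (ltnW (ltn_ord b))) [RHS]big_mkcond.
by apply: eq_bigr => t _; case: (t < b)%N.
Qed.

End CountSubgroups.

(** * Cyclic subgroups of Z_m x Z_n *)

Import GRing.Theory Num.Theory.

(** Induction on [a], splitting off the [p]-parts for a prime [p] dividing [a]: on them the gcd and
    the lcm are the two prime powers themselves, in some order. *)
Lemma totient_gcd_lcm a b : 0 < a -> 0 < b ->
  totient (gcdn a b) * totient (lcmn a b) = totient a * totient b.
Proof.
elim/ltn_ind: a b => a IH b a0 b0.
have [a1|a1] := leqP a 1.
  have -> : a = 1 by lia.
  by rewrite gcd1n lcm1n.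
pose p := pdiv a; have p_pr : prime p := pdiv_prime a1.
have split_ k : 0 < k -> totient k = totient k`_p * totient k`_p^'.
  by move=> k0; rewrite -totient_coprime ?coprime_partC // partnC.
have g0 : 0 < gcdn a b by rewrite gcdn_gt0 a0.
have l0 : 0 < lcmn a b by rewrite lcmn_gt0 a0.
rewrite !(split_ _ a0, split_ _ b0, split_ _ g0, split_ _ l0).
rewrite !partn_gcd // !partn_lcm // mulnACA [RHS]mulnACA; congr (_ * _); last first.
  apply: IH; rewrite ?part_gt0 //.
  rewrite -{2}(partnC p a0) ltn_Pmull ?part_gt0 // p_part.
  by rewrite -[X in X < _](expn0 p) ltn_exp2l ?prime_gt1 // logn_gt0 mem_primes p_pr a0 pdiv_dvd.
rewrite !p_part; have [le|/ltnW le] := leqP (logn p a) (logn p b).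
  have d : p ^ logn p a %| p ^ logn p b by rewrite dvdn_exp2l.
  by rewrite (gcdn_idPl d) (lcmn_idPr d).
have d : p ^ logn p b %| p ^ logn p a by rewrite dvdn_exp2l.
by rewrite (gcdn_idPr d) (lcmn_idPl d) mulnC.
Qed.

Section OrderCount.
Variables (gT : finGroupType) (G : {group gT}).
Hypothesis cycG : cyclic G.
Local Open Scope group_scope.

(** A cyclic group has a single subgroup of order [a], and the elements of order [a] are its
    generators. *)
Lemma card_order_cyclic a : a %| #|G| -> #|[set x in G | #[x] == a]| = totient a.
Proof.
move=> aG; have [g defG] := cyclicP cycG.
have oG : #|G| = #[g] by rewrite defG.
pose y := g ^+ (#|G| %/ a).
have a0 : (0 < a)%N := dvdn_gt0 (cardG_gt0 G) aG.
have oy : #[y] = a.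
  by rewrite /y orderXdiv -oG ?dvdn_div // divnA // mulKn.
have yG : <[y]> \subset G by rewrite defG cycleX.
rewrite -{2}oy totient_gen; congr #|pred_of_set _|; apply/setP => x; rewrite !inE /generator.
apply/andP/eqP => [[xG /eqP ox]|e].
  by apply/eqP; rewrite (eq_subG_cyclic cycG yG) ?cycle_subG // -!orderE oy ox.
have xy : x \in <[y]> by rewrite e cycle_id.
by rewrite (subsetP yG) //; split=> //; rewrite -oy orderE -e.
Qed.

Local Open Scope ring_scope.
Lemma sum_order_cyclic (F : nat -> rat) :
  \sum_(x in G) F #[x]%g = \sum_(1 <= a < #|G|.+1 | (a %| #|G|)%N) (totient a)%:R * F a.
Proof.
have cG := cardG_gt0 G.
rewrite (eq_bigr (fun x => \sum_(1 <= a < #|G|.+1 | (a %| #|G|)%N)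
    (if #[x]%g == a then F a else 0))); last first.
  move=> x xG; have xd := order_dvdG xG.
  rewrite big_mkcond (bigD1_seq #[x]%g) ?iota_uniq //=; last first.
    by rewrite mem_index_iota order_gt0 ltnS dvdn_leq.
  by rewrite xd eqxx big1 ?addr0 // => a; rewrite eq_sym => /negPf ->; case: ifP.
rewrite exchange_big /=; apply: eq_bigr => a aG.
rewrite -big_mkcondr -card_order_cyclic // -sum1_card natr_sum mulr_suml.
by apply: eq_big => [x|x _]; rewrite ?inE // mul1r.
Qed.

End OrderCount.

Lemma order_pair (gT1 gT2 : finGroupType) (x : gT1) (y : gT2) :
  #[(x, y)]%g = lcmn #[x]%g #[y]%g.
Proof.
have expE k : ((x, y) ^+ k = (x ^+ k, y ^+ k))%g.
  by elim: k => // k IH; rewrite !expgS IH.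
apply/eqP; rewrite eqn_dvd order_dvdn expE dvdn_lcm !order_dvdn.
have /eqP := expg_order (x, y); rewrite expE xpair_eqE => -> /=.
rewrite andbT xpair_eqE -!order_dvdn.
by rewrite dvdn_lcml dvdn_lcmr.
Qed.

Section CountCyclic.
Variables m n : nat.
Hypotheses (m_gt0 : 0 < m) (n_gt0 : 0 < n).
Local Open Scope ring_scope.

Lemma card_Zp_pos k : (0 < k)%N -> #|Zp k| = k.
Proof. by move=> k0; rewrite card_Zp. Qed.

Lemma cyclic_Zp k : cyclic (Zp k).
Proof.
rewrite /Zp; case: ifP => _; last exact: cyclic1.
by rewrite Zp_cycle cycle_cyclic.
Qed.

(* Each cyclic subgroup of order [k] is generated by [totient k] of its elements. *)
Lemma sum_inv_totient_generators (gT : finGroupType) (G : {group gT}) :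
  \sum_(x in G) (totient #[x]%g)%:R^-1 =
  #|[set C in subgroups G | cyclic C]%SET|%:R :> rat.
Proof.
rewrite (partition_big (fun x => <[x]>%G)
  (fun C => C \in [set C in subgroups G | cyclic C]%SET)) /=; last first.
  by move=> x xG; rewrite !inE cycle_subG xG cycle_cyclic.
rewrite -sum1_card natr_sum; apply: eq_bigr => C.
rewrite !inE => /andP[CG /cyclicP[y Cy]].
rewrite (eq_bigr (fun=> (totient #[y]%g)%:R^-1)); last first.
  move=> x /andP[_ /eqP e]; rewrite !orderE -Cy.
  by move: e => /(congr1 (fun H : {group _} => (H : {set _}))) /= ->.
rewrite sumr_const (_ : #|_| = totient #[y]%g).
  by rewrite -[LHS]mulr_natl mulfV // pnatr_eq0 -lt0n totient_gt0 order_gt0.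
rewrite totient_gen -[RHS]cardsE; apply: eq_card => x; rewrite !inE /generator.
rewrite -Cy -val_eqE /= [RHS]eq_sym -[LHS]/((x \in G) && (<[x]>%g == C)).
by rewrite andb_idl // => /eqP e; rewrite (subsetP CG) // -e cycle_id.
Qed.

(* There are phi(a) phi(b) pairs of elements of orders a and b; the pair has order
   lcm(a, b), and phi(a) phi(b) / phi(lcm(a, b)) = phi(gcd(a, b)). *)
Lemma nb_cyclic_subgroupsE : nb_cyclic_subgroups m n =
  (\sum_(1 <= a < m.+1 | a %| m) \sum_(1 <= b < n.+1 | b %| n) totient (gcdn a b))%N.
Proof.
apply/eqP; rewrite -(eqr_nat rat) /nb_cyclic_subgroups -sum_inv_totient_generators.
have inG p : (p \in ZmxZn m n) = (p.1 \in Zp m) && (p.2 \in Zp n) by rewrite !inE.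
have -> : \sum_(p in ZmxZn m n) (totient #[p]%g)%:R^-1 =
    \sum_(x in Zp m) \sum_(y in Zp n) (totient (lcmn #[x]%g #[y]%g))%:R^-1 :> rat.
  rewrite pair_big; apply: eq_big => -[x y]; rewrite ?inG // => _.
  by rewrite (order_pair x y).
pose S a := \sum_(1 <= b < #|Zp n|.+1 | (b %| #|Zp n|)%N)
  (totient b)%:R * (totient (lcmn a b))%:R^-1 : rat.
rewrite (eq_bigr (fun x : 'Z_m => S #[x]%g)); last first.
  move=> x _; exact: (sum_order_cyclic (cyclic_Zp n)
    (fun b => (totient (lcmn #[x]%g b))%:R^-1)).
rewrite (sum_order_cyclic (cyclic_Zp m) S) /S !card_Zp_pos //.
apply/eqP; rewrite natr_sum; apply: eq_bigr => a am.
rewrite natr_sum mulr_sumr; apply: eq_bigr => b bn.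
have a0 := dvdn_gt0 m_gt0 am; have b0 := dvdn_gt0 n_gt0 bn.
rewrite mulrA -natrM -totient_gcd_lcm // natrM mulfK // pnatr_eq0 -lt0n.
by rewrite totient_gt0 lcmn_gt0 a0.
Qed.

End CountCyclic.

Import Order.TTheory.

(** * Gcd sums and Moebius inversion *)

Section BigMultiples.
Variables (T : Type) (idx : T) (op : Monoid.com_law idx).

Lemma big_multiples k N (F : nat -> T) : 0 < k ->
  \big[op/idx]_(1 <= j < (N %/ k).+1) F (k * j) =
  \big[op/idx]_(1 <= n < N.+1 | k %| n) F n.
Proof.
move=> k0; rewrite [RHS]big_mkcond; elim: N => [|N IH]; first by rewrite div0n !big_geq.
rewrite [RHS]big_nat_recr //= -IH divnS //.
case: (boolP (k %| N.+1)) => kN /=; last by rewrite add0n Monoid.mulm1.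
rewrite add1n big_nat_recr //=; congr (op _ (F _)).
by rewrite -[RHS](divnK kN) divnS // kN mulnC.
Qed.

(** Both sides run over the pairs with [k * j <= N], on the right grouped by [n = k * j]. *)
Lemma big_divisors N (F : nat -> nat -> T) :
  \big[op/idx]_(1 <= k < N.+1) \big[op/idx]_(1 <= j < (N %/ k).+1) F k (k * j) =
  \big[op/idx]_(1 <= n < N.+1) \big[op/idx]_(1 <= k < n.+1 | k %| n) F k n.
Proof.
transitivity (\big[op/idx]_(1 <= k < N.+1)
  \big[op/idx]_(1 <= n < N.+1 | k %| n) F k n).
  by apply: eq_big_nat => k /andP[k0 _]; rewrite big_multiples.
rewrite (exchange_big_dep xpredT) //=; apply: eq_big_nat => n /andP[n0 nN].
rewrite [RHS](big_nat_widen _ _ N.+1) //; apply: eq_bigl => k.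
by case: (boolP (k %| n)) => // /(dvdn_leq n0); rewrite -ltnS => ->.
Qed.

(** With [a = d * i] and [b = d * j], a triple [(d, i, j)] is a pair [(a, b)] together with a common
    divisor [d]. *)
Lemma big_common_divisors N (H : nat -> nat -> nat -> T) :
  \big[op/idx]_(1 <= d < N.+1) \big[op/idx]_(1 <= i < (N %/ d).+1)
    \big[op/idx]_(1 <= j < (N %/ d).+1) H d (d * i) (d * j) =
  \big[op/idx]_(1 <= a < N.+1) \big[op/idx]_(1 <= b < N.+1)
    \big[op/idx]_(1 <= d < (gcdn a b).+1 | d %| gcdn a b) H d a b.
Proof.
transitivity (\big[op/idx]_(1 <= d < N.+1) \big[op/idx]_(1 <= a < N.+1 | d %| a)
  \big[op/idx]_(1 <= b < N.+1 | d %| b) H d a b).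
  apply: eq_big_nat => d /andP[d0 _]; rewrite -big_multiples //.
  by apply: eq_bigr => i _; rewrite -big_multiples.
rewrite (exchange_big_dep xpredT) //=; apply: eq_big_nat => a /andP[a0 aN].
rewrite (exchange_big_dep xpredT) //=; apply: eq_big_nat => b /andP[b0 bN].
have g0 : 0 < gcdn a b by rewrite gcdn_gt0 a0.
have gN : gcdn a b < N.+1 by apply: leq_ltn_trans aN; rewrite dvdn_leq ?dvdn_gcdl.
rewrite [RHS](big_nat_widen _ _ N.+1) //; apply: eq_bigl => d; rewrite -dvdn_gcd.
by case: (boolP (d %| gcdn a b)) => // /(dvdn_leq g0); rewrite -ltnS => ->.
Qed.

End BigMultiples.

Definition gcd_sum (f : nat -> nat) (N : nat) : nat :=
  \sum_(1 <= a < N.+1) \sum_(1 <= b < N.+1) f (gcdn a b) * ((N %/ a) * (N %/ b)).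

Definition divisor_sum (N : nat) : nat := \sum_(1 <= a < N.+1) N %/ a.

Definition weighted_square_sum (N : nat) : nat :=
  \sum_(1 <= d < N.+1) d * divisor_sum (N %/ d) ^ 2.

Lemma sum_sum_divisors N (g : nat -> nat) :
  \sum_(1 <= m < N.+1) \sum_(1 <= a < m.+1 | a %| m) g a =
  \sum_(1 <= a < N.+1) g a * (N %/ a).
Proof.
rewrite -(big_divisors _ _ (fun k _ => g k)); apply: eq_bigr => a _.
by rewrite sum_nat_const_nat subSS subn0 mulnC.
Qed.

Lemma sum2_sum2_divisors N (f : nat -> nat) :
  \sum_(1 <= m < N.+1) \sum_(1 <= n < N.+1)
    \sum_(1 <= a < m.+1 | a %| m) \sum_(1 <= b < n.+1 | b %| n) f (gcdn a b)
  = gcd_sum f N.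
Proof.
transitivity (\sum_(1 <= m < N.+1) \sum_(1 <= a < m.+1 | a %| m)
    \sum_(1 <= b < N.+1) f (gcdn a b) * (N %/ b)).
  apply: eq_bigr => m _; rewrite exchange_big /=.
  by apply: eq_bigr => a _; rewrite sum_sum_divisors.
rewrite sum_sum_divisors; apply: eq_bigr => a _; rewrite big_distrl /=.
by apply: eq_bigr => b _; rewrite -mulnA [(_ %/ b * _)%N]mulnC.
Qed.

(** Since [N %/ k %/ i = N %/ (k * i)], passing to the pairs [(k * i, k * j)] turns the sum over [k]
    into a Dirichlet convolution of [f] with 1 under the gcd. *)
Lemma sum_gcd_sum (f : nat -> nat) N :
  \sum_(1 <= k < N.+1) gcd_sum f (N %/ k) =
  gcd_sum (fun g => \sum_(1 <= k < g.+1 | k %| g) f (g %/ k)) N.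
Proof.
transitivity (\sum_(1 <= k < N.+1) \sum_(1 <= i < (N %/ k).+1)
  \sum_(1 <= j < (N %/ k).+1)
   (fun k a b => f (gcdn a b %/ k) * ((N %/ a) * (N %/ b))) k (k * i) (k * j)).
  apply: eq_big_nat => k /andP[k0 _]; apply: eq_bigr => i _; apply: eq_bigr => j _ /=.
  by rewrite -muln_gcdr mulKn // !divnMA.
rewrite (big_common_divisors _ _
  (fun k a b => f (gcdn a b %/ k) * ((N %/ a) * (N %/ b)))).
by do 2!apply: eq_bigr => ? _; rewrite big_distrl.
Qed.

Lemma eq_gcd_sum f f' N : (forall g, 0 < g -> f g = f' g) -> gcd_sum f N = gcd_sum f' N.
Proof.
move=> e; apply: eq_big_nat => a /andP[a0 _]; apply: eq_bigr => b _.
by rewrite e // gcdn_gt0 a0.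
Qed.

Lemma sum_gcd_sum_totient N :
  \sum_(1 <= k < N.+1) gcd_sum totient (N %/ k) = gcd_sum id N.
Proof.
rewrite sum_gcd_sum; apply: eq_gcd_sum => g g0.
rewrite (sum_divn_divisors totient) // -[RHS](sum_totient_dvd g).
rewrite -(big_mkord (fun d => d %| g)) [RHS]big_ltn_cond // dvd0n.
by rewrite gtn_eqF.
Qed.

(** Writing the divisor sum of [gcdn a b] over the common divisors [d] separates [a] from [b], and
    each of them yields one factor [divisor_sum (N %/ d)]. *)
Lemma sum_gcd_sum_id N :
  \sum_(1 <= k < N.+1) gcd_sum id (N %/ k) = weighted_square_sum N.
Proof.
rewrite sum_gcd_sum (@eq_gcd_sum _ (fun g => \sum_(1 <= k < g.+1 | k %| g) k)); last first.
  by move=> g g0; rewrite (sum_divn_divisors id).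
transitivity (\sum_(1 <= d < N.+1) \sum_(1 <= i < (N %/ d).+1)
  \sum_(1 <= j < (N %/ d).+1)
   (fun d a b => d * ((N %/ a) * (N %/ b))) d (d * i) (d * j)).
  rewrite (big_common_divisors _ _ (fun d a b => d * ((N %/ a) * (N %/ b)))).
  by do 2!apply: eq_bigr => ? _; rewrite big_distrl.
apply: eq_bigr => d _; rewrite /divisor_sum expnS expn1 big_distrlr big_distrr /=.
apply: eq_bigr => i _; rewrite big_distrr; apply: eq_bigr => j _ /=.
by rewrite !divnMA.
Qed.

(** * The Moebius function and inversion along the quotients N / k *)

Section Moebius.
Local Open Scope ring_scope.

Definition moebius (n : nat) : int :=
  \prod_(p <- primes n) (if logn p n == 1%N then -1 else 0).

Lemma moebius1 : moebius 1 = 1.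
Proof. by rewrite /moebius big_nil. Qed.

Lemma norm_moebius n : `|moebius n| <= 1.
Proof.
rewrite /moebius; elim/big_rec: _ => [|p x _ hx]; first by rewrite normr1.
by rewrite normrM; case: ifP => _; rewrite ?normrN ?normr1 ?mul1r // normr0 mul0r.
Qed.

Lemma moebius_primeM p d : prime p -> (0 < d)%N -> ~~ (p %| d)%N ->
  moebius (p * d) = - moebius d.
Proof.
move=> pp d0 pd; have p0 := prime_gt0 pp.
have l0 : logn p d = 0%N by apply/eqP; rewrite -leqn0 leqNgt logn_gt0 mem_primes pp d0.
have pm : perm_eq (primes (p * d)) (p :: primes d).
  apply: uniq_perm; rewrite ?primes_uniq //=.
    by rewrite primes_uniq mem_primes (negPf pd) !andbF.
  by move=> q; rewrite primesM // in_cons primes_prime // inE.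
rewrite /moebius (perm_big _ pm) big_cons lognM // l0 logn_prime // eqxx addn0 eqxx.
rewrite /= mulN1r; congr (- _); rewrite !big_seq; apply: eq_bigr => q.
rewrite mem_primes => /and3P[qp _ qd]; rewrite lognM // logn_prime //.
by case: (q =P p) qd pd => [-> -> //|_ _ _]; rewrite add0n.
Qed.

(* With p the least prime factor of n, exchanging d and p d changes the sign of
   mu on the squarefree divisors of n. *)
Lemma sum_moebius n : (1 < n)%N -> \sum_(1 <= d < n.+1 | (d %| n)%N) moebius d = 0.
Proof.
move=> n1; have n0 := ltnW n1.
pose p := pdiv n; have pp : prime p := pdiv_prime n1.
have p0 := prime_gt0 pp; have pn : (p %| n)%N := pdiv_dvd n.
pose P d := (d %| n)%N && (moebius d != 0).
pose h (d : nat) := if (p %| d)%N then (d %/ p)%N else (p * d)%N.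
have logd d : (0 < d)%N -> (p %| d)%N -> moebius d != 0 -> ~~ (p %| d %/ p)%N.
  move=> d0 pd md; apply: contraNN md => pdp; rewrite /moebius.
  rewrite (bigD1_seq p) ?primes_uniq //=; last by rewrite mem_primes pp d0.
  rewrite ifF ?mul0r //; apply/negP => /eqP l1.
  have := pfactor_dvdn 2 pp d0.
  by rewrite l1 -{1}(divnK pd) expnS expn1 dvdn_pmul2r // pdp.
have hP d : P d -> [/\ P (h d), h (h d) = d & moebius (h d) = - moebius d].
  move=> /andP[dn md]; have d0 := dvdn_gt0 n0 dn; rewrite /h.
  case: (boolP (p %| d)%N) => pd.
    have npd := logd _ d0 pd md; have dp0 : (0 < d %/ p)%N by rewrite divn_gt0 // dvdn_leq.
    have e : moebius (d %/ p) = - moebius d.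
      by rewrite -{2}(divnK pd) mulnC moebius_primeM ?opprK.
    split=> //; first by rewrite /P e oppr_eq0 md (dvdn_trans _ dn) // dvdn_div.
    by rewrite (negPf npd) mulnC divnK.
  rewrite dvdn_mulr // mulKn // moebius_primeM //; split=> //.
  by rewrite /P moebius_primeM // oppr_eq0 md Gauss_dvd ?pn ?dn // prime_coprime.
set S := (X in X = 0).
have ES : S = \sum_(d < n.+1 | P d) moebius d.
  rewrite -(big_mkord P) [RHS]big_ltn_cond // {1}/P dvd0n gtn_eqF //= /S.
  rewrite big_mkcond [RHS]big_mkcond; apply: eq_bigr => d _; rewrite /P.
  by case: (d %| n)%N => //=; case: eqP => [->|].
pose g (d : 'I_n.+1) : 'I_n.+1 := inord (h d).
have gE (d : 'I_n.+1) : P d -> g d = h d :> nat.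
  by move=> Pd; have [/andP[hn _] _ _] := hP _ Pd; rewrite inordK // ltnS dvdn_leq.
have gK (d : 'I_n.+1) : P d -> P (g d) /\ g (g d) = d.
  move=> Pd; have [Pd' hh _] := hP _ Pd; have Pg : P (g d) by rewrite gE.
  by split=> //; apply: val_inj; rewrite /= (gE _ Pg) (gE _ Pd).
have Pg (d : 'I_n.+1) : P (g d) && (g (g d) == d) = P d.
  apply/andP/idP => [[Pd /eqP e]|/gK[-> /eqP ->] //].
  by have [+ _] := gK _ Pd; rewrite e.
have : S = - S.
  rewrite {1}ES (reindex_onto g g); last by move=> d /gK[].
  rewrite ES -sumrN; apply: eq_big => d; rewrite Pg // => Pd.
  by rewrite gE //; have [] := hP _ Pd.
lia.
Qed.

(** After substitution [H (N %/ n)] carries the sum of [moebius k] over [k] dividing [n], which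
    vanishes except at [n = 1]. *)
Lemma moebius_inversion (R : pzRingType) (F H : nat -> R) :
  (forall N, F N = \sum_(1 <= k < N.+1) H (N %/ k)%N) ->
  forall N, (0 < N)%N -> H N = \sum_(1 <= k < N.+1) (moebius k)%:~R * F (N %/ k)%N.
Proof.
move=> FH N N0.
transitivity (\sum_(1 <= k < N.+1) \sum_(1 <= j < (N %/ k).+1)
   (fun k n => (moebius k)%:~R * H (N %/ n)%N) k (k * j)%N); last first.
  apply: eq_bigr => k _; rewrite FH mulr_sumr; apply: eq_bigr => j _.
  by rewrite divnMA.
rewrite (big_divisors _ _ (fun k n => (moebius k)%:~R * H (N %/ n)%N)).
rewrite big_ltn //= [X in _ + X]big1_seq /=; last first.
  move=> n; rewrite mem_index_iota => /andP[n1 _].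
  by rewrite -mulr_suml -rmorph_sum /= sum_moebius // mul0r.
by rewrite addr0 big_mkcond big_nat1 /= moebius1 mul1r divn1.
Qed.

End Moebius.

From mathcomp Require Import all_classical all_reals all_analysis.

Import Order.TTheory GRing.Theory Num.Theory.
Import numFieldNormedType.Exports.
Local Open Scope ring_scope.

(** * Rates of convergence and Stieltjes constants *)

Section Powers.
Variable R : realType.
Implicit Types (e x y d : R) (n N : nat).

Lemma ln_le_powR d : 0 < d -> exists2 C, 0 < C & forall x, 1 <= x -> ln x <= C * x `^ d.
Proof.
move=> d0; exists d^-1; rewrite ?invr_gt0 // => x x1.
have x0 : 0 < x by lra.
rewrite ler_pdivlMl // -ln_powR; apply/ltW/ln_sublinear; exact: powR_gt0.
Qed.

Lemma ln_succ_bounds n : (0 < n)%N ->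
  n.+1%:R^-1 <= ln (n.+1%:R : R) - ln n%:R <= n%:R^-1.
Proof.
move=> n0; have n0' : 0 < n%:R :> R by rewrite ltr0n.
have n1 : 0 < n.+1%:R :> R by rewrite ltr0n.
have e : n.+1%:R = n%:R + 1 :> R by rewrite -natr1.
apply/andP; split.
  rewrite -[leLHS]opprK -[leRHS]opprK lerN2 opprB -ln_div ?posrE //.
  have -> : n%:R / n.+1%:R = 1 + - n.+1%:R^-1 :> R by rewrite e; field; lra.
  by apply: le_ln1Dx; rewrite ltrN2 invf_lt1 // ltr1n; lia.
rewrite -ln_div ?posrE //.
have -> : n.+1%:R / n%:R = 1 + n%:R^-1 :> R by rewrite e; field; lra.
by apply: le_ln1Dx; apply: (lt_trans (y := 0)); rewrite ?invr_gt0 //; lra.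
Qed.

(** The exponential of [d * (ln n.+1 - ln n)] is at least 1 plus its argument. This discrete form of
    the derivative of [x^d] takes the place of comparison with integrals in the next sums. *)
Lemma powR_succ_ge d n : 0 < d -> (0 < n)%N ->
  n%:R `^ d * (1 + d / n.+1%:R) <= n.+1%:R `^ d.
Proof.
move=> d0 n0; have n0' : 0 < n%:R :> R by rewrite ltr0n.
have n1 : 0 < n.+1%:R :> R by rewrite ltr0n.
have -> : n.+1%:R `^ d = n%:R `^ d * expR (d * (ln n.+1%:R - ln n%:R)).
  by rewrite /powR !gt_eqF // -expRD; congr expR; ring.
rewrite ler_pM2l ?powR_gt0 //; apply: le_trans (expR_ge1Dx _).
by rewrite lerD2l ler_pM2l //; case/andP: (ln_succ_bounds n0).
Qed.

Lemma succ_le_double n : (0 < n)%N -> n.+1%:R <= 2 * n%:R :> R.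
Proof. rewrite -natr1 => n0; have : 1 <= n%:R :> R by rewrite ler1n.
lra. Qed.

Lemma sum_powR_le d : 0 < d -> exists2 C, 0 < C &
  forall n, \sum_(1 <= a < n) a%:R `^ (d - 1) <= C * n%:R `^ d.
Proof.
move=> d0; exists (2 / d) => [|n]; first by rewrite divr_gt0.
elim: n => [|n IH]; first by rewrite big_geq // mulr_ge0 ?powR_ge0 // divr_ge0 // ltW.
have [->|n0] := posnP n; first by rewrite big_geq // mulr_ge0 ?powR_ge0 // divr_ge0 // ltW.
have n0' : 0 < n%:R :> R by rewrite ltr0n.
rewrite big_nat_recr //=; apply: le_trans (lerD IH (lexx _)) _.
have := powR_succ_ge d0 n0; rewrite -(mulr_powRB1 (ltW n0') d0).
set p := _ `^ (d - 1); set q := _ `^ d; have p0 : 0 < p by apply: powR_gt0.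
have n1 : 0 < n.+1%:R :> R by rewrite ltr0n.
move=> H; rewrite -(ler_pM2l d0); apply: (@le_trans _ _ (2 * (n%:R * p) + d * p)).
  by rewrite le_eqVlt; apply/orP; left; apply/eqP; field; lra.
apply: le_trans (_ : 2 * q <= _); last first.
  by rewrite le_eqVlt; apply/orP; left; apply/eqP; field; lra.
apply: le_trans (_ : 2 * (n%:R * p * (1 + d / n.+1%:R)) <= _); last by rewrite ler_pM2l.
have -> : 2 * (n%:R * p * (1 + d / n.+1%:R)) =
  2 * (n%:R * p) + d * p * (2 * n%:R / n.+1%:R) by field; lra.
rewrite lerD2l ler_peMr ?mulr_ge0 ?(ltW d0) ?(ltW p0) //.
by rewrite ler_pdivlMr // mul1r succ_le_double.
Qed.

Lemma powR_opp_telescope d : 0 < d -> exists2 C, 0 < C & forall n, (0 < n)%N ->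
  n%:R `^ (- (1 + d)) <= C * (n%:R `^ (- d) - n.+1%:R `^ (- d)).
Proof.
move=> d0; exists (2 `^ (1 + d) / d) => [|n n0]; first by rewrite divr_gt0 ?powR_gt0.
have n0' : 0 < n%:R :> R by rewrite ltr0n.
have n1 : 0 < n.+1%:R :> R by rewrite ltr0n.
have H := powR_succ_ge d0 n0.
have h2 : n.+1%:R `^ (1 + d) <= 2 `^ (1 + d) * n%:R `^ (1 + d).
  rewrite -powRM //; apply: ge0_ler_powR; rewrite ?nnegrE ?mulr_ge0 ?succ_le_double //; lra.
have e1 : n.+1%:R `^ (1 + d) = n.+1%:R * n.+1%:R `^ d.
  by rewrite powRD ?powRr1 // (gt_eqF n1) implybT.
rewrite !powRN.
set p := n%:R `^ d in H *; set q := n.+1%:R `^ d in H e1 *.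
have p0 : 0 < p by apply: powR_gt0. have q0 : 0 < q by apply: powR_gt0.
apply: (@le_trans _ _ (2 `^ (1 + d) * (n.+1%:R `^ (1 + d))^-1)).
  rewrite -ler_pdivrMr ?invr_gt0 ?powR_gt0 // invrK mulrC.
  by rewrite ler_pdivrMr ?powR_gt0.
rewrite e1 -mulrA ler_pM2l ?powR_gt0 // -(ler_pM2l d0) mulrA mulfV ?gt_eqF // mul1r.
rewrite -(ler_pM2l (mulr_gt0 p0 q0)).
have -> : p * q * (p^-1 - q^-1) = q - p by field; lra.
have -> : p * q * (d / (n.+1%:R * q)) = p * (d / n.+1%:R) by field; lra.
by move: H; rewrite mulrDr mulr1; move: (p * (d / _)) => r; lra.
Qed.

(** The increments are dominated by those of [b n], a multiple of [n^(-d)]. So the intervals of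
    centre [s n] and radius [b n] are nested, and the supremum of their left ends lies in all of
    them. *)
Lemma rate_limit (s : nat -> R) d K : 0 < d ->
  (forall n, (0 < n)%N -> `|s n.+1 - s n| <= K * n%:R `^ (- (1 + d))) ->
  exists l, exists2 C, 0 < C & forall n, (0 < n)%N -> `|s n - l| <= C * n%:R `^ (- d).
Proof.
move=> d0 sK.
have [C0 C0p tel] := powR_opp_telescope d0.
pose K1 := `|K| + 1; have K1p : 0 < K1 by rewrite /K1; have := normr_ge0 K; lra.
pose C := K1 * C0; have Cp : 0 < C by rewrite mulr_gt0.
pose b n := C * n%:R `^ (- d); have b0 n : 0 <= b n by rewrite mulr_ge0 ?powR_ge0 // ltW.
have step n : (0 < n)%N -> `|s n.+1 - s n| <= b n - b n.+1.
  move=> n0; apply: le_trans (sK n n0) _; rewrite /b -mulrBr -mulrA.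
  apply: le_trans (_ : K1 * n%:R `^ (- (1 + d)) <= _); last by rewrite ler_pM2l // tel.
  by rewrite ler_wpM2r ?powR_ge0 // /K1; have := ler_norm K; lra.
have mono i j : (0 < i)%N -> (i <= j)%N -> s i - b i <= s j - b j /\ s j + b j <= s i + b i.
  move=> i0; elim: j => [|j IH]; first by case: i i0.
  rewrite leq_eqVlt => /predU1P[<-|ij]; first by [].
  have [h1 h2] := IH ij; have := step j (leq_trans i0 ij).
  by rewrite ler_norml => /andP[? ?]; split; lra.
have cross i j : (0 < i)%N -> (0 < j)%N -> s i - b i <= s j + b j.
  move=> i0 j0; have [ij|/ltnW ji] := leqP i j.
    by have [h1 _] := mono _ _ i0 ij; have := b0 j; lra.
  by have [_ h1] := mono _ _ j0 ji; have := b0 i; lra.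
pose A : set R := [set x | exists2 n, (0 < n)%N & x = s n - b n]%classic.
have A0 : (A !=set0)%classic by exists (s 1 - b 1), 1%N.
have ubA j : (0 < j)%N -> ubound A (s j + b j) by move=> j0 _ [i i0 ->]; exact: cross.
have supA : has_sup A by split=> //; exists (s 1 + b 1); exact: ubA.
exists (sup A), C => // n n0; rewrite -/(b n) ler_norml.
have h1 : s n - b n <= sup A by apply: sup_upper_bound => //; exists n.
have h2 : sup A <= s n + b n by apply: ge_sup => //; apply: ubA.
by apply/andP; split; lra.
Qed.

End Powers.

(** * Rate of convergence to the Stieltjes constants *)

Section Stieltjes.
Variable R : realType.
Implicit Types (a b e x y d : R) (k n N : nat).

Lemma log_pow_le k d : 0 < d ->
  exists2 C : R, 0 < C & forall x, 1 <= x -> (1 + ln x) ^+ k <= C * x `^ d.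
Proof.
move=> d0; pose dk := d / k.+1%:R.
have dk0 : 0 < dk by rewrite divr_gt0.
have [C C0 hC] := ln_le_powR dk0.
exists ((1 + C) ^+ k); first by rewrite exprn_gt0 //; lra.
move=> x x1; have x0 : 0 < x by lra.
have l0 := ln_ge0 x1.
have p1 : 1 <= x `^ dk by rewrite -(powRr0 x) ler_powR // ltW.
have h : 1 + ln x <= (1 + C) * x `^ dk by have := hC x x1; lra.
apply: le_trans (_ : ((1 + C) * x `^ dk) ^+ k <= _).
  by rewrite lerXn2r // ?nnegrE; lra.
rewrite exprMn ler_pM2l ?exprn_gt0 //; last by lra.
rewrite -powR_mulrn ?powR_ge0 // -powRrM ler_powR // /dk.
rewrite mulrAC ler_pdivrMr // ler_pM2l // ler_nat.
by [].
Qed.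

Lemma exprS_sub_bounds k a b : 0 <= a -> a <= b ->
  k.+1%:R * (a ^+ k * (b - a)) <= b ^+ k.+1 - a ^+ k.+1 <= k.+1%:R * (b ^+ k * (b - a)).
Proof.
move=> a0 ab; have b0 : 0 <= b by lra.
have c0 : 0 <= b - a by lra.
have H i : (i < k.+1)%N -> a ^+ k <= b ^+ (k.+1.-1 - i) * a ^+ i <= b ^+ k.
  move=> ik; have e (z : R) : z ^+ k = z ^+ (k - i) * z ^+ i by rewrite -exprD subnK.
  rewrite /= (e a) (e b).
  apply/andP; split; first by apply: ler_wpM2r; rewrite ?exprn_ge0 ?lerXn2r ?nnegrE.
  by apply: ler_wpM2l; rewrite ?exprn_ge0 ?lerXn2r ?nnegrE.
have S (z : R) : k.+1%:R * z = \sum_(i < k.+1) z by rewrite sumr_const card_ord mulr_natl.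
rewrite subrXX; apply/andP; split.
  rewrite mulrA mulrC; apply: ler_wpM2l => //; rewrite S.
  by apply: ler_sum => i _; case/andP: (H i (ltn_ord i)).
rewrite mulrA [leRHS]mulrC; apply: ler_wpM2l => //; rewrite S.
by apply: ler_sum => i _; case/andP: (H i (ltn_ord i)).
Qed.

Definition log_sum k (x : R) : R :=
  \sum_(1 <= n < (Num.truncn x).+1) ln n%:R ^+ k / n%:R - ln x ^+ k.+1 / k.+1%:R.

(** The new term and the increment of [ln x ^+ k.+1 / k.+1] both lie near [ln n ^+ k / n]; they
    differ by a power of the logarithm over [n^2]. *)
Lemma log_sum_succ k d : 0 < d -> exists K, forall n, (0 < n)%N ->
  `|log_sum k n.+1%:R - log_sum k n%:R| <= K * n%:R `^ (- (1 + (1 - d))).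
Proof.
move=> d0; have [C C0 hC] := log_pow_le k d0.
exists (k.+1%:R * (C * 2 `^ d)) => n n0.
have n0' : 0 < n%:R :> R by rewrite ltr0n.
have n1 : 0 < n.+1%:R :> R by rewrite ltr0n.
rewrite /log_sum !natrK big_nat_recr //=.
set S := \sum_(_ <= _ < _) _; set a := ln n%:R; set b := ln n.+1%:R.
have a0 : 0 <= a by rewrite ln_ge0 // ler1n.
have ab : a <= b by rewrite ler_ln ?posrE // ler_nat.
have /andP[h1 h2] := ln_succ_bounds R n0; rewrite -/a -/b in h1 h2.
have /andP[e1 e2] := exprS_sub_bounds k a0 ab.
have e3 : b ^+ k - a ^+ k <= k%:R * ((1 + b) ^+ k * (b - a)).
  case: (k) => [|j]; first by rewrite !expr0 subrr mul0r.
  have /andP[_ H] := exprS_sub_bounds j a0 ab; apply: le_trans H _.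
  rewrite ler_wpM2l // ler_wpM2r; [by []|lra|].
  apply: le_trans (_ : (1 + b) ^+ j <= _); first by rewrite lerXn2r ?nnegrE; lra.
  by rewrite exprS ler_peMl ?exprn_ge0; lra.
have L : (1 + b) ^+ k <= C * 2 `^ d * n%:R `^ d.
  have /hC : 1 <= n.+1%:R :> R by rewrite ler1n.
  move/le_trans; apply; rewrite -mulrA ler_pM2l // -powRM //.
  by rewrite ge0_ler_powR ?nnegrE ?mulr_ge0 ?succ_le_double // ltW.
set B := (1 + b) ^+ k in e3 L.
have bB : b ^+ k <= B by rewrite lerXn2r ?nnegrE; lra.
have bk0 : 0 <= b ^+ k by rewrite exprn_ge0; lra.
have B0 : 0 <= B by lra.
set T := (b ^+ k.+1 - a ^+ k.+1) / k.+1%:R.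
have k1 : 0 < k.+1%:R :> R by rewrite ltr0n.
have T1 : a ^+ k * (b - a) <= T by rewrite ler_pdivlMr // mulrC.
have T2 : T <= b ^+ k * (b - a) by rewrite ler_pdivrMr // mulrC.
have -> : S + b ^+ k / n.+1%:R - b ^+ k.+1 / k.+1%:R - (S - a ^+ k.+1 / k.+1%:R)
   = b ^+ k / n.+1%:R - T by rewrite /T; ring.
have n2 : n.+1%:R^-1 <= n%:R^-1 :> R := le_trans h1 h2.
have ni : 0 < n%:R^-1 :> R by rewrite invr_gt0.
have hn : n%:R^-1 - n.+1%:R^-1 <= n%:R^-1 * n%:R^-1 :> R.
  have -> : n%:R^-1 - n.+1%:R^-1 = n%:R^-1 * n.+1%:R^-1 :> R.
    by rewrite -natr1; field; rewrite natr1 !gt_eqF.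
  by rewrite ler_pM2l.
have main : `|b ^+ k / n.+1%:R - T| <= k.+1%:R * (B * (n%:R^-1 * n%:R^-1)).
  rewrite -[k.+1%:R]natr1 mulrDl mul1r.
  move: (n.+1%:R^-1) (n%:R^-1) h1 h2 n2 ni hn => p q h1 h2 n2 ni hn.
  have q2 : 0 <= q * q by rewrite mulr_ge0 // ltW.
  have X0 : 0 <= B * (q * q) by rewrite mulr_ge0.
  have X1 : b ^+ k * (q - p) <= B * (q * q) by apply: ler_pM => //; lra.
  have X2 : b ^+ k * (b - a) <= b ^+ k * q by rewrite ler_wpM2l.
  have X3 : 0 <= k%:R * (B * (q * q)) by rewrite mulr_ge0.
  have X4 : b ^+ k * p <= b ^+ k * (b - a) by rewrite ler_wpM2l.
  have X5 : (b ^+ k - a ^+ k) * (b - a) <= k%:R * (B * (q * q)).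
    apply: le_trans (_ : k%:R * (B * (b - a)) * (b - a) <= _).
      by apply: ler_wpM2r => //; lra.
    by rewrite -!mulrA; do 2!(apply: ler_wpM2l => //); apply: ler_pM => //; lra.
  rewrite ler_norml; apply/andP; split; lra.
have -> : n%:R `^ (- (1 + (1 - d))) = n%:R `^ d * (n%:R^-1 * n%:R^-1) :> R.
  have -> : - (1 + (1 - d)) = d + (- 2) :> R by ring.
  by rewrite powRD ?(gt_eqF n0') ?implybT // powR_invn ?ltW // expr2 invfM.
apply: le_trans main _; rewrite -mulrA ler_pM2l // mulrA.
by apply: ler_wpM2r; rewrite ?mulr_ge0 // ltW.
Qed.

Lemma powR_opp_small d e : 0 < d -> 0 < e -> exists2 M, 1 <= M &
  forall x, M <= x -> x `^ (- d) <= e.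
Proof.
move=> d0 e0; exists (1 + e^-1 `^ d^-1); first by rewrite lerDl powR_ge0.
move=> x hx; have p0 := powR_ge0 e^-1 d^-1.
have x0 : 0 < x by lra.
rewrite powRN -[leRHS]invrK lef_pV2 ?posrE ?powR_gt0 ?invr_gt0 //.
have <- : (e^-1 `^ d^-1) `^ d = e^-1.
  by rewrite -powRrM mulVf ?gt_eqF // powRr1 // invr_ge0 ltW.
by apply: ge0_ler_powR; rewrite ?nnegrE; lra.
Qed.

(** At integers the rate comes from [rate_limit]; between [N] and [N + 1] only [ln x ^+ k.+1 / k.+1]
    moves, by [O(x^(d - 1))]. The estimate over all real [x] then identifies the limit with
    [stieltjes R k]. *)
Lemma stieltjes_rate k d : 0 < d -> d < 1 -> exists2 C, 0 < C &
  forall x, 1 <= x -> `|log_sum k x - stieltjes R k| <= C * x `^ (d - 1).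
Proof.
move=> d0 d1; have [K hK] := log_sum_succ k d0.
have d1' : 0 < 1 - d by lra.
have [l [C1 C10 hl]] := rate_limit d1' hK.
have [C2 C20 hC2] := log_pow_le k d0.
pose C := 2 * C1 + 2 * C2.
have hx x : 1 <= x -> `|log_sum k x - l| <= C * x `^ (d - 1).
  move=> x1; have x0 : 0 < x by lra.
  have [N N0 [Nx Nx1 xN xN2]] : exists2 N, (0 < N)%N &
      [/\ N%:R <= x, x < N.+1%:R, log_sum k x = log_sum k N%:R + ln N%:R ^+ k.+1 / k.+1%:R
            - ln x ^+ k.+1 / k.+1%:R & x <= 2 * N%:R].
    have /andP[h1 h2] := truncn_itv (ltW x0).
    have h3 : (0 < Num.truncn x)%N.
      by move: h2; case: (Num.truncn x) => // h2; lra.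
    exists (Num.truncn x) => //; split=> //; first by rewrite /log_sum natrK; ring.
    by apply: le_trans (ltW h2) (succ_le_double _ h3).
  have N0' : 0 < N%:R :> R by rewrite ltr0n.
  have a0 : 0 <= ln N%:R :> R by rewrite ln_ge0 // ler1n.
  have ab : ln N%:R <= ln x by rewrite ler_ln ?posrE.
  have /andP[e1 e2] := exprS_sub_bounds k a0 ab.
  set T := (ln x ^+ k.+1 - ln N%:R ^+ k.+1) / k.+1%:R.
  have k1 : 0 < k.+1%:R :> R by rewrite ltr0n.
  have T0 : 0 <= T.
    apply: divr_ge0 => //; apply: le_trans e1.
    by rewrite !mulr_ge0 ?exprn_ge0 ?subr_ge0.
  have Ni : N%:R^-1 <= 2 / x by rewrite ler_pdivlMr // ler_pdivrMl // mulrC.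
  have T2 : T <= C2 * x `^ d * (2 / x).
    rewrite ler_pdivrMr // [leRHS]mulrC; apply: le_trans e2 _; rewrite ler_pM2l //.
    apply: ler_pM; [by apply: exprn_ge0; lra|lra| |].
      by apply: le_trans (hC2 x x1); rewrite lerXn2r ?nnegrE; lra.
    apply: le_trans Ni; rewrite -ln_div ?posrE //.
    have -> : x / N%:R = 1 + (x / N%:R - 1) by ring.
    have xN1 : x / N%:R - 1 <= N%:R^-1.
      rewrite lerBlDr -(ler_pM2r N0') mulrDl divfK ?gt_eqF // mulVf ?gt_eqF // mul1r.
      by rewrite addrC natr1 ltW.
    apply: le_trans xN1; apply: le_ln1Dx.
    have : 0 < x / N%:R by rewrite divr_gt0.
    lra.
  have Np : N%:R `^ (- (1 - d)) <= 2 * x `^ (d - 1).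
    have -> : d - 1 = - (1 - d) by ring.
    rewrite !powRN ler_pdivlMr ?powR_gt0 // ler_pdivrMl ?powR_gt0 //.
    apply: le_trans (_ : (2 * N%:R) `^ (1 - d) <= _).
      by rewrite ge0_ler_powR ?nnegrE //; lra.
    rewrite powRM // mulrC ler_wpM2l ?powR_ge0 //.
    by rewrite -[leRHS]powRr1 // ler_powR; lra.
  have -> : log_sum k x - l = (log_sum k N%:R - l) - T by rewrite xN /T; ring.
  apply: le_trans (ler_normB _ _) _; rewrite (ger0_norm T0) /C mulrDl.
  apply: lerD.
    by apply: le_trans (hl N N0) _; rewrite mulrAC [leLHS]mulrC ler_pM2r.
  apply: le_trans T2 _; rewrite (_ : x `^ (d - 1) = x `^ d / x); first by lra.
  by rewrite powRD ?(gt_eqF x0) ?implybT // powR_inv1 // ltW.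
have -> : stieltjes R k = l.
  rewrite /stieltjes -/(log_sum k); apply: cvg_lim => //.
  apply/cvgrPdist_le => e e0.
  have C0 : 0 < C by rewrite /C; lra.
  have [M M1 hM] := powR_opp_small d1' (divr_gt0 e0 C0).
  near=> x; have Mx : M <= x by near: x; apply: nbhs_pinfty_ge; exact: num_real.
  rewrite distrC; apply: le_trans (hx x _) _; first by lra.
  rewrite mulrC -ler_pdivlMr //; apply: le_trans (hM x Mx).
  by rewrite opprB.
by exists C => //; rewrite /C; lra.
Unshelve. all: by end_near.
Qed.

End Stieltjes.

(** * Harmonic sums to second order *)

Section Harmonic.
Variable R : realType.
Implicit Types (a b e x y d : R) (k n N : nat).

Lemma mean_value (f df : R -> R) a b : a <= b ->
  (forall x, a <= x <= b -> is_derive x 1 f (df x)) ->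
  exists2 c, a <= c <= b & f b - f a = df c * (b - a).
Proof.
move=> ab fd; have [| |c] := @MVT_segment R f df a b ab.
- by move=> x; rewrite in_itv /= => /andP[h1 h2]; apply: fd; rewrite !ltW.
- apply: derivable_within_continuous => x; rewrite in_itv /= => xab.
  by case: (fd x xab).
by rewrite in_itv /=; exists c.
Qed.

(** The derivative of the middle expression is [y^2 / (1 + y)], which lies between 0 and [x^2]. *)
Lemma ln1D_third_order x : 0 <= x -> 0 <= ln (1 + x) - x + x ^+ 2 / 2 <= x ^+ 3.
Proof.
move=> x0; pose f (y : R) := ln (1 + y) - y + y ^+ 2 / 2.
have [y yx|c /andP[c0 cx]] := @mean_value f (fun y => y ^+ 2 / (1 + y)) 0 x x0.
  have y1 : 0 < 1 + y by lra.
  have H : is_derive y 1 (@ln R \o (fun y : R => 1 + y)) ((1 + y)^-1 * 1).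
    apply: is_derive1_comp; first exact: is_derive1_ln.
    by have := is_deriveD (is_derive_cst (1 : R) y 1) (is_derive_id y 1); rewrite add0r.
  have H2 : is_derive y 1 f _ := is_deriveD (is_deriveB H (is_derive_id y 1))
    (is_deriveM (is_deriveX 2 (is_derive_id y 1)) (is_derive_cst (2^-1 : R) y 1)).
  apply: (is_derive_eq H2); rewrite /= !scaler0 ?add0r /GRing.scale /=; field; lra.
rewrite /f addr0 ln1 !subr0 expr0n /= mul0r addr0 subr0 => ->.
have c1 : 0 < 1 + c by lra.
have q0 : 0 <= c ^+ 2 / (1 + c) by rewrite divr_ge0 ?sqr_ge0 // ltW.
have q1 : c ^+ 2 / (1 + c) <= x ^+ 2.
  rewrite ler_pdivrMr //; apply: le_trans (_ : x ^+ 2 * 1 <= _).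
    by rewrite mulr1 lerXn2r ?nnegrE.
  by rewrite ler_wpM2l ?sqr_ge0; lra.
by rewrite mulr_ge0 //= (exprSr x) ler_wpM2r.
Qed.

Lemma limit_unique (s : nat -> R) l l' C C' d : 0 < d ->
  (forall n, (0 < n)%N -> `|s n - l| <= C * n%:R `^ (- d)) ->
  (forall n, (0 < n)%N -> `|s n - l'| <= C' * n%:R `^ (- d)) -> l = l'.
Proof.
move=> d0 h h'; apply/eqP; rewrite -subr_eq0 -normr_le0; apply/ler_addgt0Pr => e e0.
pose K := `|C| + `|C'| + 1.
have K0 : 0 < K by rewrite /K; have := normr_ge0 C; have := normr_ge0 C'; lra.
have [M M1 hM] := powR_opp_small d0 (divr_gt0 e0 K0).
have [n n0 Mn] : exists2 n, (0 < n)%N & M <= n%:R.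
  exists (Num.truncn M).+1 => //; have M0 : 0 <= M by lra.
  by have /andP[_ /ltW] := truncn_itv M0.
have := hM _ Mn; rewrite ler_pdivlMr // add0r; apply: le_trans.
have -> : l - l' = (s n - l') - (s n - l) by ring.
apply: le_trans (ler_normB _ _) _; have := h n n0; have := h' n n0.
set p := _ `^ _; have p0 : 0 <= p by apply: powR_ge0.
have h1 : C * p <= `|C| * p by rewrite ler_wpM2r ?ler_norm.
have h2 : C' * p <= `|C'| * p by rewrite ler_wpM2r ?ler_norm.
by rewrite /K !mulrDr mulr1 ![p * _]mulrC; lra.
Qed.

Lemma log_sum0 n : log_sum 0 (n%:R : R) = \sum_(1 <= a < n.+1) a%:R^-1 - ln n%:R.
Proof.
rewrite /log_sum natrK expr1 divr1; congr (_ - _).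
by apply: eq_bigr => a _; rewrite expr0 mul1r.
Qed.

(** The term [1 / (2 n)] is kept because the hyperbola method multiplies the harmonic sum up to [u]
    by about [2 u^2]: only an error [O(u^(-2))] leaves a bounded remainder there. *)
Lemma harmonic_rate : exists2 C : R, 0 < C & forall n, (0 < n)%N ->
  `|\sum_(1 <= a < n.+1) a%:R^-1 - ln n%:R - stieltjes R 0 - (2 * n%:R)^-1|
    <= C * n%:R `^ (- 2).
Proof.
pose s n := log_sum 0 (n%:R : R) - (2 * n%:R)^-1.
have step n : (0 < n)%N -> `|s n.+1 - s n| <= 1 * n%:R `^ (- (1 + 2)).
  move=> n0; have n0' : 0 < n%:R :> R by rewrite ltr0n.
  have n1 : 0 < n.+1%:R :> R by rewrite ltr0n.
  pose x := n%:R^-1 : R; have x0 : 0 < x by rewrite invr_gt0.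
  have h : ln n.+1%:R - ln n%:R = ln (1 + x).
    by rewrite -ln_div ?posrE // /x -natr1 mulrDl mulfV ?gt_eqF // mul1r.
  have /andP[h1 h2] := ln1D_third_order (ltW x0).
  rewrite /s !log_sum0 big_nat_recr //=.
  set S := \sum_(_ <= _ < _) _.
  have -> : S + n.+1%:R^-1 - ln n.+1%:R - (2 * n.+1%:R)^-1 - (S - ln n%:R - (2 * n%:R)^-1)
    = 2^-1 * (x ^+ 3 / (1 + x)) - (ln (1 + x) - x + x ^+ 2 / 2).
    have -> : ln n.+1%:R = ln n%:R + ln (1 + x) by rewrite -h; ring.
    by rewrite -natr1 /x; field; rewrite natr1 !gt_eqF.
  have -> : - (1 + 2) = - 3%:R :> R by ring.
  rewrite powR_invn ?ler0n // mul1r -exprVn -/x.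
  have x3 : 0 <= x ^+ 3 by rewrite exprn_ge0 // ltW.
  have q : 0 <= x ^+ 3 / (1 + x) <= x ^+ 3.
    rewrite divr_ge0 //=; last by lra.
    by rewrite ler_pdivrMr ?ler_peMr //; lra.
  case/andP: q => q1 q2. rewrite ler_norml; apply/andP; split; lra.
have d2 : 0 < 2 :> R by [].
have [l [C C0 hl]] := rate_limit d2 step.
have e0 : 0 < 2^-1 :> R by rewrite invr_gt0.
have e1 : 2^-1 < 1 :> R by rewrite invf_lt1 ?ltr1n.
have [C1 C10 h1] := stieltjes_rate 0 e0 e1.
have -> : stieltjes R 0 = l.
  apply: (limit_unique (s := fun n => log_sum 0 n%:R) (C := C1) (C' := C + 2) e0) => n n0.
    by have := h1 n%:R; rewrite ler1n n0 (_ : 2^-1 - 1 = - 2^-1); [apply|field].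
  have n1 : 1 <= n%:R :> R by rewrite ler1n.
  have -> : log_sum 0 n%:R - l = (s n - l) + (2 * n%:R)^-1 by rewrite /s; ring.
  apply: le_trans (ler_normD _ _) _; rewrite [leRHS]mulrDl; apply: lerD.
    by apply: le_trans (hl n n0) _; rewrite ler_pM2l // ler_powR //; lra.
  rewrite ger0_norm ?invr_ge0 ?mulr_ge0 // invfM.
  apply: ler_pM; rewrite ?invr_ge0 //; first by lra.
  by rewrite -(powR_inv1 (ler0n R n)) ler_powR //; lra.
exists C => // n n0; have := hl n n0; rewrite /s log_sum0.
by rewrite [in leRHS]/= -!addrA [- l - _]addrC !addrA.
Qed.

End Harmonic.

(** * The divisor problem *)

Section HyperbolaNat.
Local Open Scope nat_scope.

Lemma sum_leq_mul a k N : 0 < a -> k %/ a < N ->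
  \sum_(1 <= b < N) (a * b <= k : nat) = k %/ a.
Proof.
move=> a0 kN; rewrite -[RHS]subn0 -subSS -[RHS]muln1 -sum_nat_const_nat.
rewrite [RHS](big_nat_widen _ _ N) // [RHS]big_mkcond /=.
by apply: eq_bigr => b _; rewrite ltnS leq_divRL // mulnC; case: leq.
Qed.

Lemma sqrt_exists k : exists u, u * u <= k < u.+1 * u.+1.
Proof.
elim: k => [|k [u /andP[h1 h2]]]; first by exists 0.
have [h|h] := leqP (u.+1 * u.+1) k.+1; last by exists u; lia.
by exists u.+1; nia.
Qed.

Lemma leq_sqr_sqrt k u a : u * u <= k < u.+1 * u.+1 -> (a * a <= k) = (a <= u).
Proof.
case/andP=> h1 h2; apply/idP/idP => [h|h]; last exact: leq_trans (leq_mul h h) h1.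
by rewrite leqNgt; apply/negP => ua; have := leq_trans h2 (leq_mul ua ua); rewrite ltnNge h.
Qed.

(** A cut written [a * a * d <= n] allows the sums over [a] and [d] to be exchanged; the integer
    root [u] serves inside a single sum. *)
Lemma big_sqrt_range (T : Type) (idx : T) (op : Monoid.law idx) (F : nat -> T) n d u :
  0 < d -> u * u <= n %/ d < u.+1 * u.+1 ->
  \big[op/idx]_(1 <= a < n.+1 | a * a * d <= n) F a = \big[op/idx]_(1 <= a < u.+1) F a.
Proof.
move=> d0 hu; have un : u < n.+1.
  rewrite ltnS; apply: leq_trans (leq_div n d).
  by case/andP: hu => h _; case: u h => // u h; apply: leq_trans h; rewrite leq_pmulr.
rewrite [RHS](big_nat_widen _ _ n.+1) //; apply: eq_bigl => a /=.
by rewrite -leq_divRL // ltnS (leq_sqr_sqrt _ hu).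
Qed.

(** Of the pairs with [a * b <= k] none has both entries above [u], and all those with both entries
    at most [u] count: they are the [u * u] pairs counted twice on the right. *)
Lemma divisor_sum_hyperbola k u : u * u <= k < u.+1 * u.+1 ->
  divisor_sum k + u * u = 2 * \sum_(1 <= a < u.+1) k %/ a.
Proof.
move=> /andP[h1 h2].
have uk : u <= k by nia.
have -> : divisor_sum k = \sum_(1 <= a < k.+1) \sum_(1 <= b < k.+1) (a * b <= k : nat).
  by apply: eq_big_nat => a /andP[a0 _]; rewrite sum_leq_mul // ltnS leq_div.
rewrite (@big_cat_nat _ _ _ u.+1) ?ltnS //= mul2n -addnn -addnA; congr (_ + _).
  apply: eq_big_nat => a /andP[a0 _]; rewrite sum_leq_mul // ltnS leq_div //.
rewrite exchange_big /= (@big_cat_nat _ _ _ u.+1) ?ltnS //=.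
rewrite [X in _ + X + _]big_nat_cond [X in _ + X + _]big1 ?addn0; last first.
  move=> b /andP[/andP[ub _] _]; rewrite big_nat_cond big1 // => a /andP[/andP[ua _] _].
  by apply/eqP; rewrite eqb0 -ltnNge; nia.
have -> : u * u = \sum_(1 <= b < u.+1) u by rewrite sum_nat_const_nat subn1.
rewrite -big_split /=; apply: eq_big_nat => b /andP[b0 bu].
rewrite -(@sum_leq_mul b k k.+1) // ?ltnS ?leq_div //.
rewrite [RHS](@big_cat_nat _ _ _ u.+1) ?ltnS //= addnC; congr (_ + _).
  rewrite (eq_big_nat _ _ (F2 := fun=> 1)); first by rewrite sum_nat_const_nat subn1 muln1.
  by move=> a /andP[a0 au]; rewrite (_ : b * a <= k) //; nia.
by apply: eq_bigr => a _; rewrite mulnC.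
Qed.

End HyperbolaNat.

Section DivisorSum.
Variable R : realType.
Implicit Types (a b d k n q N : nat).

(** The function {x} - 1/2 at rational points, so that the floor is the natural quotient
    [n %/ q]. *)
Definition sawtooth n q : R := n%:R / q%:R - (n %/ q)%:R - 2^-1.

Local Notation cD := (2 * stieltjes R 0 - 1).

Lemma natr_div_bounds n d : (0 < d)%N ->
  (n %/ d)%:R <= n%:R / d%:R :> R /\ n%:R / d%:R < (n %/ d).+1%:R :> R.
Proof.
move=> d0; have d0' : 0 < d%:R :> R by rewrite ltr0n.
rewrite ler_pdivlMr // ltr_pdivrMr // -!natrM ler_nat ltr_nat.
by rewrite leq_divM ltn_ceil.
Qed.

Lemma sawtooth_le n q : (0 < q)%N -> `|sawtooth n q| <= 2^-1.
Proof.
move=> q0; have [h1 h2] := natr_div_bounds n q0; rewrite -natr1 in h2.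
by rewrite /sawtooth ler_norml; apply/andP; split; lra.
Qed.

Lemma ln1D_bounds (t : R) : 0 <= t -> t / (1 + t) <= ln (1 + t) <= t.
Proof.
move=> t0; have t1 : 0 < 1 + t by lra.
apply/andP; split; last by apply: le_ln1Dx; lra.
have /le_ln1Dx : -1 < - (t / (1 + t)) by rewrite ltrN2 ltr_pdivrMr //; lra.
have -> : 1 + - (t / (1 + t)) = (1 + t)^-1 by field; lra.
by rewrite lnV ?posrE // lerN2.
Qed.

(** Write [Y = u^2 * (1 + t)], where [u * t <= 3]. The logarithms cancel and leave [u^2 * t - u^2 *
    (1 + t) * ln (1 + t) + u * t], bounded because [(1 + t) * ln (1 + t)] lies between [t] and
    [t + t^2]; the error [C] is multiplied by [2 * Y <= 8 * u^2]. *)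
Lemma harmonic_main_term (u Y H g C : R) : 1 <= u -> u * u <= Y < (u + 1) * (u + 1) ->
  `|H - ln u - g - (2 * u)^-1| <= C * (u * u)^-1 ->
  `|2 * Y * H - u * u - u - Y * (ln Y + (2 * g - 1))| <= 12 + 8 * C.
Proof.
move=> u1 /andP[uY Yu] he.
have u0 : 0 < u by lra.
have uu0 : 0 < u * u by rewrite mulr_gt0.
have [t t0 YE] : exists2 t, 0 <= t & Y = u * u * (1 + t).
  exists ((Y - u * u) / (u * u)); first by rewrite divr_ge0 ?subr_ge0 // ltW.
  by field; lra.
subst Y; have t1 : 0 < 1 + t by lra.
have ut3 : u * t <= 3.
  have : u * (u * t) <= u * 3 by lra.
  by rewrite ler_pM2l.
have ut0 : 0 <= u * t by rewrite mulr_ge0 // ltW.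
have lnY : ln (u * u * (1 + t)) = 2 * ln u + ln (1 + t).
  by rewrite !lnM ?posrE //; ring.
have /andP[g2 g1] := ln1D_bounds t0.
move: g2 g1; rewrite lnY; move: (ln (1 + t)) (ln u) he {lnY} => G L he.
rewrite ler_pdivrMr // => g2 g1.
have Yg1 : u * u * ((1 + t) * G) <= u * u * ((1 + t) * t) by rewrite !ler_pM2l.
have Yg2 : u * u * t <= u * u * ((1 + t) * G) by rewrite ler_pM2l // [leRHS]mulrC.
have utt : (u * t) * (u * t) <= 3 * 3 by apply: ler_pM.
pose e := H - L - g - (2 * u)^-1; rewrite -/e in he.
have HE : H = L + g + (2 * u)^-1 + e by rewrite /e; ring.
have Ye : `|2 * (u * u * (1 + t)) * e| <= 8 * C.
  rewrite normrM ger0_norm; last by rewrite !mulr_ge0 // ltW.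
  have h4 : 2 * (u * u * (1 + t)) <= 8 * (u * u).
    have h5 : u * (u * t) <= u * (3 * u) by rewrite ler_pM2l //; lra.
    lra.
  apply: le_trans (_ : 8 * (u * u) * (C * (u * u)^-1) <= _).
    by apply: ler_pM => //; rewrite !mulr_ge0 // ltW.
  by rewrite mulrACA mulfV ?gt_eqF // mulr1.
move: (e) Ye HE => {he e} e Ye HE; subst H.
have -> : 2 * (u * u * (1 + t)) * (L + g + (2 * u)^-1 + e) - u * u - u -
   u * u * (1 + t) * (2 * L + G + (2 * g - 1)) =
   u * u * t - u * u * ((1 + t) * G) + u * t + 2 * (u * u * (1 + t)) * e.
  by field; lra.
move: Ye; rewrite !ler_norml; move: (2 * _ * e) => E /andP[? ?].
by apply/andP; split; lra.
Qed.

(** In the hyperbola identity each quotient is [Y / a - 1/2] minus a sawtooth. The main term is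
    taken at the real number [n / d], although [divisor_sum] only sees its integer part. *)
Lemma divisor_sum_sawtooth : exists2 C : R, 0 < C & forall n d, (0 < d <= n)%N ->
  `|(divisor_sum (n %/ d))%:R - n%:R / d%:R * (ln (n%:R / d%:R) + cD)
    + 2 * \sum_(1 <= a < n.+1 | (a * a * d <= n)%N) sawtooth n (d * a)| <= C.
Proof.
have [C C0 hC] := harmonic_rate R; exists (12 + 8 * C); first by lra.
move=> n d /andP[d0 dn]; set k := (n %/ d)%N; set Y := n%:R / d%:R.
have [u hu] := sqrt_exists k.
have k0 : (0 < k)%N by rewrite divn_gt0.
have u0 : (0 < u)%N by nia.
have [kY Yk] : k%:R <= Y /\ Y < k.+1%:R := natr_div_bounds n d0.
have d0' : 0 < d%:R :> R by rewrite ltr0n.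
have u1 : 1 <= u%:R :> R by rewrite ler1n.
have uY : u%:R * u%:R <= Y by apply: le_trans kY; rewrite -natrM ler_nat; lia.
have Yu : Y < (u%:R + 1) * (u%:R + 1).
  by apply: lt_le_trans Yk _; rewrite natr1 -natrM ler_nat; lia.
rewrite (big_sqrt_range _ _ d0 hu).
set S := \sum_(_ <= _ < _) _.
have SE : 2 * S = 2 * Y * \sum_(1 <= a < u.+1) a%:R^-1
    - (divisor_sum k)%:R - u%:R * u%:R - u%:R.
  have := divisor_sum_hyperbola hu; move/(congr1 (fun x => x%:R : R)).
  rewrite natrD natrM (natrM _ 2) => /(canRL (addrK _)) ->.
  have -> : S = Y * (\sum_(1 <= a < u.+1) a%:R^-1)
      - (\sum_(1 <= a < u.+1) k %/ a)%N%:R - u%:R * 2^-1.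
    have uE : u%:R * 2^-1 = \sum_(1 <= a < u.+1) 2^-1 :> R.
      by rewrite sumr_const_nat subn1 mulr_natl.
    rewrite uE natr_sum mulr_sumr -!sumrB; apply: eq_big_nat => a /andP[a0 _].
    by rewrite /sawtooth natrM invfM divnMA /Y mulrA.
  by field.
rewrite SE.
set H := \sum_(_ <= _ < _) _.
have -> : (divisor_sum k)%:R - Y * (ln Y + cD) +
    (2 * Y * H - (divisor_sum k)%:R - u%:R * u%:R - u%:R) =
    2 * Y * H - u%:R * u%:R - u%:R - Y * (ln Y + cD) by ring.
have := hC u u0; rewrite powR_invn ?ler0n // expr2 -/H.
by apply: harmonic_main_term => //; apply/andP.
Qed.

End DivisorSum.

(** * Vinogradov's bound for sawtooth sums *)

Section Blocks.
Variable R : realType.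

(** The fractional parts of [j * x] for [j <= Q] are [Q + 1] points in [Q] boxes. The least
    admissible [q] is prime to [b], since a common factor could be divided out. *)
Lemma dirichlet_approximation (x : R) (Q : nat) : 0 <= x -> (0 < Q)%N ->
  exists q b : nat, [/\ (0 < q <= Q)%N, coprime b q & `|q%:R * x - b%:R| <= Q%:R^-1].
Proof.
move=> x0 Q0; have Q0' : 0 < Q%:R :> R by rewrite ltr0n.
pose P q := (0 < q <= Q)%N && `[< exists b : nat, `|q%:R * x - b%:R| <= Q%:R^-1 >].
have exP : exists q, P q.
  pose fl (j : nat) := Num.truncn (j%:R * x); pose fr (j : nat) : R := j%:R * x - (fl j)%:R.
  have frP j : 0 <= fr j < 1.
    have /andP[h1 h2] := truncn_itv (mulr_ge0 (ler0n R j) x0).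
    by rewrite /fr subr_ge0 h1 ltrBlDr addrC natr1.
  have gP j : (Num.truncn (Q%:R * fr j) < Q)%N.
    have /andP[h1 h2] := frP j.
    by rewrite truncn_lt_nat ?mulr_ge0 ?ler0n // -[ltRHS]mulr1 ltr_pM2l.
  pose g (j : 'I_Q.+1) : 'I_Q := Ordinal (gP j).
  have /injectivePn[i [j ij gij]] : ~~ injectiveb g.
    apply/negP => /injectiveP/leq_card; rewrite !card_ord ltnn.
    by [].
  wlog lt : i j ij gij / (i < j)%N.
    move=> H; have [h|h|/val_inj h] := ltngtP i j; first exact: (H i j).
      by apply: (H j i) => //; rewrite eq_sym.
    by rewrite h eqxx in ij.
  have flij : (fl i <= fl j)%N.
    by rewrite le_truncn // ler_wpM2r // ler_nat ltnW.
  exists (j - i)%N; rewrite /P subn_gt0 lt /= (leq_trans (leq_subr _ _)) /=; last first.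
    by rewrite -ltnS.
  apply/asboolP; exists (fl j - fl i)%N.
  have -> : (j - i)%:R * x - (fl j - fl i)%:R = fr j - fr i.
    by rewrite !natrB ?(ltnW lt) // /fr; ring.
  have /(congr1 (@nat_of_ord Q)) /= gij' := gij.
  have /andP[a1 a2] := truncn_itv (mulr_ge0 (ler0n R Q) (proj1 (andP (frP i)))).
  have /andP[b1 b2] := truncn_itv (mulr_ge0 (ler0n R Q) (proj1 (andP (frP j)))).
  rewrite gij' in a1 a2.
  rewrite -(ler_pM2l Q0') mulfV ?gt_eqF // -{1}(gtr0_norm Q0') -normrM mulrBr.
  move: a1 a2 b1 b2; rewrite -!natr1; move: (Num.truncn _)%:R => z a1 a2 b1 b2.
  by rewrite ler_norml; apply/andP; split; lra.
have [q /andP[/andP[q0 qQ] /asboolP[b hb]] qmin] := ex_minnP exP.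
exists q, b; split=> //; first by rewrite q0.
set g := gcdn b q; have g0 : (0 < g)%N by rewrite gcdn_gt0 q0 orbT.
have [gb gq] : (g %| b)%N /\ (g %| q)%N by rewrite dvdn_gcdl dvdn_gcdr.
have g0' : 0 < g%:R :> R by rewrite ltr0n.
have : P (q %/ g)%N.
  rewrite /P divn_gt0 // dvdn_leq // (leq_trans (leq_div _ _)) //=.
  apply/asboolP; exists (b %/ g)%N; apply: le_trans hb.
  have -> : q%:R * x - b%:R = g%:R * ((q %/ g)%:R * x - (b %/ g)%:R).
    by rewrite -{1}(divnK gq) -{1}(divnK gb) !natrM; ring.
  by rewrite normrM gtr0_norm // ler_peMl // ler1n.
move/qmin; rewrite /coprime -/g => h; apply/eqP/anti_leq; rewrite g0 andbT leqNgt.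
by apply/negP => g1; have := ltn_Pdiv g1 q0; rewrite ltnNge h.
Qed.

Lemma dvdz_small (d q : int) : (q %| d)%Z -> - q < d < q -> d = 0.
Proof.
move=> /dvdzP[k ->] /andP[h1 h2].
have [k0|k0|->] := ltrgtP k 0; last by rewrite mul0r.
  have k1 : k <= -1 by lia.
  by nia.
have k1 : 1 <= k by lia.
by nia.
Qed.

(** As [b] is prime to [q], the numbers [A - b * j] form a complete system of residues. *)
Lemma sum_modz_complete (A : int) (b q : nat) : (0 < q)%N -> coprime b q ->
  2 * \sum_(j < q) ((A - b%:Z * j%:Z) %% q%:Z)%Z = q%:Z * (q%:Z - 1).
Proof.
move=> q0 bq; have q0' : q%:Z != 0 by lia.
have rP (j : nat) : (absz ((A - b%:Z * j%:Z) %% q%:Z)%Z < q)%N.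
  by rewrite -ltz_nat gez0_abs ?modz_ge0 // ltz_pmod // ltz_nat.
pose r (j : 'I_q) := Ordinal (rP j).
have rE (j : 'I_q) : (r j : nat)%:Z = ((A - b%:Z * j%:Z) %% q%:Z)%Z.
  by rewrite /= gez0_abs ?modz_ge0.
have r_inj : injective r.
  move=> i j /(congr1 (fun x : 'I_q => (x : nat)%:Z)); rewrite !rE => /eqP.
  rewrite eqz_mod_dvd (_ : _ - _ = b%:Z * (j%:Z - i%:Z)); last by ring.
  rewrite Gauss_dvdzr; last by rewrite coprimez_sym /coprimez /gcdz !absz_nat (eqP bq).
  move=> /dvdz_small h; apply: val_inj => /=.
  have := ltn_ord i; have := ltn_ord j => hj hi.
  by have := h _; lia.
under eq_bigr do rewrite -rE.
rewrite -(reindex_inj (P := xpredT) (F := fun j : 'I_q => (j : nat)%:Z) r_inj) /=.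
elim: (q) => [|n IH]; first by rewrite big_ord0; lia.
by rewrite big_ord_recr /= mulrDr IH; lia.
Qed.

Lemma sum_divz_complete (A : int) (b q : nat) : (0 < q)%N -> coprime b q ->
  2 * \sum_(j < q) ((A - b%:Z * j%:Z) %/ q%:Z)%Z = 2 * A - (b%:Z + 1) * (q%:Z - 1).
Proof.
move=> q0 bq; have := sum_modz_complete A q0 bq.
have sj : 2 * \sum_(j < q) (j : nat)%:Z = q%:Z * (q%:Z - 1).
  elim: (q) => [|n IH]; first by rewrite big_ord0; lia.
  by rewrite big_ord_recr /= mulrDr IH; lia.
have : \sum_(j < q) (A - b%:Z * j%:Z) =
    (\sum_(j < q) ((A - b%:Z * j%:Z) %/ q%:Z)%Z) * q%:Z +
    \sum_(j < q) ((A - b%:Z * j%:Z) %% q%:Z)%Z.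
  by rewrite mulr_suml -big_split; apply: eq_bigr => j _; exact: divz_eq.
rewrite sumrB sumr_const card_ord -mulr_sumr -mulr_natl natz.
move: (\sum_(j < q) ((_ - _) %/ _)%Z) (\sum_(j < q) ((_ - _) %% _)%Z) => S2 S3.
move: (\sum_(j < q) (j : nat)%:Z) sj => S1 sj h1 h2.
have q0' : q%:Z != 0 by lia.
apply: (mulfI q0').
have h3 : 2 * (q%:Z * A) - b%:Z * (2 * S1) = 2 * (S2 * q%:Z) + 2 * S3 by lia.
by rewrite sj h2 in h3; lia.
Qed.

(** The floors [F j] lie between those of [(A - 2 - b * j) / q] and [(A + 2 - b * j) / q], whose
    sums over a complete block are known exactly. Hence the sawtooth sum over a block is bounded
    independently of its length [q]. *)
Lemma block_sum (u : nat -> R) (F : nat -> nat) (s : R) (b q : nat) :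
  (0 < q)%N -> coprime b q ->
  (forall j, (j < q)%N -> (F j)%:R <= u j < (F j)%:R + 1) ->
  (forall j, (j < q)%N -> `|q%:R * u j - (s - b%:R * j%:R)| <= 2) ->
  `|\sum_(j < q) (u j - (F j)%:R - 2^-1)| <= 5.
Proof.
move=> q0 bq hF hu; have q0' : 0 < q%:R :> R by rewrite ltr0n.
pose A := Num.floor s.
have [A1 A2] : A%:~R <= s /\ s < A%:~R + 1.
  by have /andP[h1] := floor_itv s; rewrite intrD.
have qz : 0 < q%:Z by lia.
have up j : (j < q)%N -> (F j)%:Z <= ((A + 2 - b%:Z * j%:Z) %/ q%:Z)%Z.
  move=> jq; rewrite lez_divRL // -(ltzD1 (_ * _)) -(ltr_int R).
  rewrite !rmorphD /= rmorphN !rmorphM /= -!pmulrn.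
  have /andP[h1 _] := hF j jq; have := hu j jq; rewrite ler_norml => /andP[_ h2].
  have : (F j)%:R * q%:R <= q%:R * u j by rewrite mulrC ler_pM2l.
  by lra.
have lo j : (j < q)%N -> ((A - 2 - b%:Z * j%:Z) %/ q%:Z)%Z <= (F j)%:Z.
  move=> jq; rewrite -ltzD1 ltz_divLR // -(ltr_int R).
  rewrite !rmorphM !rmorphD /= !rmorphN !rmorphM /= -!pmulrn.
  have /andP[_ h1] := hF j jq; have := hu j jq; rewrite ler_norml => /andP[h2 _].
  have : q%:R * u j < ((F j)%:R + 1) * q%:R by rewrite mulrC ltr_pM2r.
  by lra.
have SF1 : 2 * \sum_(j < q) (F j)%:Z <= 2 * (A + 2) - (b%:Z + 1) * (q%:Z - 1).
  rewrite -(sum_divz_complete (A + 2) q0 bq) ler_pM2l //.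
  by apply: ler_sum => j _; exact: up.
have SF2 : 2 * (A - 2) - (b%:Z + 1) * (q%:Z - 1) <= 2 * \sum_(j < q) (F j)%:Z.
  rewrite -(sum_divz_complete (A - 2) q0 bq) ler_pM2l //.
  by apply: ler_sum => j _; exact: lo.
move: SF1 SF2; rewrite -!(ler_int R) !(rmorphB, rmorphD, rmorphM, rmorph_nat, rmorph1, rmorph_sum) /=.
rewrite -!pmulrn; under eq_bigr do rewrite -pmulrn.
have sj : 2 * \sum_(j < q) (j : nat)%:R = q%:R * (q%:R - 1) :> R.
  elim: (q) => [|n IH]; first by rewrite big_ord0 mul0r mulr0.
  by rewrite big_ord_recr /= mulrDr IH -natr1; ring.
have Su : `|q%:R * \sum_(j < q) u j - (q%:R * s - b%:R * \sum_(j < q) (j : nat)%:R)|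
    <= q%:R * 2.
  have -> : q%:R * \sum_(j < q) u j - (q%:R * s - b%:R * \sum_(j < q) (j : nat)%:R)
     = \sum_(j < q) (q%:R * u j - (s - b%:R * j%:R)).
    rewrite !sumrB !mulr_sumr sumr_const card_ord mulr_natl.
    by [].
  apply: le_trans (ler_norm_sum _ _ _) _.
  have -> : q%:R * 2 = \sum_(j < q) 2 :> R by rewrite sumr_const card_ord mulr_natl.
  by apply: ler_sum => j _; exact: hu.
rewrite !sumrB sumr_const card_ord -mulr_natl.
move: (\sum_(j < q) u j) (\sum_(j < q) (j : nat)%:R) (\sum_(j < q) (F j)%:R) sj Su.
move=> U J S sj Su h1 h2.
have {}Su : `|U - (s - b%:R * (q%:R - 1) / 2)| <= 2.
  rewrite -(ler_pM2l q0') -{1}(gtr0_norm q0') -normrM; apply: le_trans Su.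
  rewrite le_eqVlt; apply/orP; left; apply/eqP; congr (`|_|).
  have -> : J = q%:R * (q%:R - 1) / 2 by lra.
  by field.
move: Su; rewrite !ler_norml => /andP[h3 h4]; apply/andP.
rewrite mulrDl mul1r in h1 h2.
by split; lra.
Qed.

(** The length of a block depends on where it starts, so blocks are cut off one after another from
    the left. Complete ones are charged to [g]; a last incomplete one is shorter than [Q] and
    bounded trivially. *)
Lemma greedy_blocks (f g : nat -> R) (Q lo hi : nat) :
  (forall k, (lo <= k)%N -> `|f k| <= 1) -> (forall k, 0 <= g k) ->
  (forall k, (lo <= k < hi)%N -> exists2 q, (0 < q <= Q)%N &
     (k + q <= hi)%N -> `|\sum_(j < q) f (k + j)%N| <= \sum_(j < q) g (k + j)%N) ->
  `|\sum_(lo <= k < hi) f k| <= \sum_(lo <= k < hi) g k + Q%:R.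
Proof.
move=> f1 g0; move: {2}(hi - lo)%N (leqnn (hi - lo)) => m.
elim: m lo f1 => [|m IH] lo f1 hm hq.
  by rewrite big_geq ?normr0 ?addr_ge0 ?sumr_ge0 // -subn_eq0 -leqn0.
have [hl|lh] := leqP hi lo.
  by rewrite big_geq // normr0 addr_ge0 ?sumr_ge0.
have [|q /andP[q0 qQ] hqk] := hq lo; first by rewrite leqnn.
have [kq|kq] := leqP (lo + q) hi; last first.
  apply: le_trans (ler_norm_sum _ _ _) _.
  apply: le_trans (_ : \sum_(lo <= k < hi) 1 <= _).
    by rewrite !big_seq; apply: ler_sum => k; rewrite mem_index_iota => /andP[? _]; apply: f1.
  rewrite sumr_const_nat -[leLHS]add0r lerD ?sumr_ge0 //.
  by rewrite ler_nat; lia.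
have shift (h : nat -> R) : \sum_(lo <= k < hi) h k =
    \sum_(j < q) h (lo + j)%N + \sum_(lo + q <= k < hi) h k.
  rewrite (@big_cat_nat _ _ _ (lo + q)) ?leq_addr //=; congr (_ + _).
  rewrite -{1}[lo]add0n big_addn addKn big_mkord; apply: eq_bigr => j _; by rewrite addnC.
rewrite !shift -addrA; apply: le_trans (ler_normD _ _) _; apply: lerD; first exact: hqk.
apply: IH; first by move=> k hk; apply: f1; lia.
  by lia.
by move=> k hk; apply: hq; lia.
Qed.

Lemma count_clustered (P : pred nat) (D : R) (lo hi : nat) : 0 <= D ->
  (forall i j, (lo <= i)%N -> (i <= j < hi)%N -> P i -> P j -> (j - i)%:R <= D) ->
  \sum_(lo <= k < hi) (P k)%:R <= D + 1.
Proof.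
move=> D0; move: {2}(hi - lo)%N (leqnn (hi - lo)) => m.
elim: m lo => [|m IH] lo hm hP.
  by rewrite big_geq ?addr_ge0 // -subn_eq0 -leqn0.
have [hl|lh] := leqP hi lo; first by rewrite big_geq ?addr_ge0.
case: (boolP (P lo)) => Plo; last first.
  rewrite big_ltn // (negPf Plo) add0r; apply: IH; first by lia.
  by move=> i j h1 h2; apply: hP; lia.
pose t := Num.truncn D; have /andP[t1 t2] := truncn_itv D0.
apply: le_trans (_ : \sum_(lo <= k < hi) ((k < lo + t.+1)%N)%:R <= _).
  rewrite !big_seq; apply: ler_sum => k; rewrite mem_index_iota => /andP[k1 k2].
  rewrite ler_nat; case: (boolP (P k)) => // Pk.
  have := hP lo k (leqnn _) _ Plo Pk; rewrite k1 k2 => /(_ isT) h.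
  have : (k - lo < t.+1)%N by rewrite -(ltr_nat R); apply: le_lt_trans h t2.
  by rewrite ltn_subLR // => ->.
have [hh|hh] := leqP hi (lo + t.+1).
  apply: le_trans (_ : \sum_(lo <= k < hi) 1 <= _).
    by apply: ler_sum => k _; case: (_ < _)%N.
  rewrite sumr_const_nat; apply: le_trans (_ : t.+1%:R <= _).
    by rewrite ler_nat; lia.
  by rewrite -natr1 lerD2r.
rewrite (@big_cat_nat _ _ _ (lo + t.+1)) ?leq_addr ?(ltnW hh) //=.
rewrite [X in _ + X]big_nat_cond [X in _ + X]big1 ?addr0; last first.
  by move=> k /andP[/andP[h _] _]; rewrite ltnNge h.
apply: le_trans (_ : \sum_(lo <= k < lo + t.+1) 1 <= _).
  by apply: ler_sum => k _; case: (_ < _)%N.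
by rewrite sumr_const_nat addKn -natr1 lerD2r.
Qed.

End Blocks.

(** * Sawtooth sums over a dyadic range *)

Section Vinogradov.
Variable R : realType.

(** The function [x / k^2] falls steeply enough between [N] and [2 * N] that the points where it is
    within [e] of [b] lie in a short interval. *)
Lemma close_cluster (x b e p r N : R) : 0 < x -> 0 < N -> N <= p -> p <= r -> r <= 2 * N ->
  `|x / p ^+ 2 - b| <= e -> `|x / r ^+ 2 - b| <= e ->
  r - p <= 8 * e * N ^+ 3 / x.
Proof.
move=> x0 N0 Np pr rN; rewrite !ler_norml => /andP[_ h1] /andP[h2 _].
have p0 : 0 < p by lra. have r0 : 0 < r by lra.
have h : x / p ^+ 2 - x / r ^+ 2 <= 2 * e by lra.
have e0 : 0 <= e.
  have : x / r ^+ 2 <= x / p ^+ 2.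
    by rewrite ler_pM2l // lef_pV2 ?posrE ?exprn_gt0 // lerXn2r ?nnegrE ?(ltW p0) ?(ltW r0).
  lra.
have pp : 0 < p ^+ 2 * r ^+ 2 by rewrite mulr_gt0 ?exprn_gt0.
have hh : x * (r - p) * (p + r) <= 2 * e * (p ^+ 2 * r ^+ 2).
  have -> : x * (r - p) * (p + r) = (x / p ^+ 2 - x / r ^+ 2) * (p ^+ 2 * r ^+ 2).
    by field; rewrite !gt_eqF.
  by rewrite ler_pM2r.
have q1 : p * r <= N * (p + r).
  have : 0 <= (2 * N - r) * (p + r) by rewrite mulr_ge0; lra.
  have : 0 <= r * (r - p) by rewrite mulr_ge0; lra.
  lra.
have q2 : p * r <= 4 * N ^+ 2.
  have : p * r <= (2 * N) * (2 * N) by apply: ler_pM; lra.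
  lra.
have q3 : p ^+ 2 * r ^+ 2 <= 4 * N ^+ 3 * (p + r).
  have -> : p ^+ 2 * r ^+ 2 = (p * r) * (p * r) by ring.
  apply: le_trans (_ : (4 * N ^+ 2) * (N * (p + r)) <= _); last first.
    by rewrite le_eqVlt; apply/orP; left; apply/eqP; ring.
  by apply: ler_pM => //; rewrite mulr_ge0 // ltW.
have s0 : 0 < p + r by lra.
rewrite ler_pdivlMr // -(ler_pM2r s0) mulrC.
have : 2 * e * (p ^+ 2 * r ^+ 2) <= 2 * e * (4 * N ^+ 3 * (p + r)).
  by apply: ler_wpM2l => //; rewrite mulr_ge0.
lra.
Qed.

(** This controls how far the slope of [Y / k] moves along a block. *)
Lemma inv_sqr_drift (p j : R) : 0 < p -> 0 <= j ->
  0 <= (p ^+ 2)^-1 - ((p + j) ^+ 2)^-1 <= 2 * j / p ^+ 3.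
Proof.
move=> p0 j0; have r0 : 0 < p + j by lra.
have E : (p ^+ 2)^-1 - ((p + j) ^+ 2)^-1 = j * (2 * p + j) / (p ^+ 2 * (p + j) ^+ 2).
  by field; rewrite !gt_eqF.
have pp : 0 < p ^+ 2 * (p + j) ^+ 2 by rewrite mulr_gt0 ?exprn_gt0.
rewrite E; apply/andP; split.
  by rewrite divr_ge0 ?mulr_ge0 ?(ltW pp) //; lra.
rewrite ler_pdivrMr //.
have -> : 2 * j / p ^+ 3 * (p ^+ 2 * (p + j) ^+ 2) = j * (2 * (p + j) ^+ 2 / p).
  by field; rewrite gt_eqF.
apply: ler_wpM2l => //; rewrite ler_pdivlMr //.
have := sqr_ge0 j; have : 0 <= p * j by rewrite mulr_ge0 // ltW.
have := sqr_ge0 p; rewrite !expr2; lra.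
Qed.

(** This controls how far [Y / k] departs from its tangent along a block. *)
Lemma inv_linear_drift (p j : R) : 0 < p -> 0 <= j ->
  0 <= (p + j)^-1 - (p^-1 - j / p ^+ 2) <= j ^+ 2 / p ^+ 3.
Proof.
move=> p0 j0; have r0 : 0 < p + j by lra.
have E : (p + j)^-1 - (p^-1 - j / p ^+ 2) = j ^+ 2 / (p ^+ 2 * (p + j)).
  by field; rewrite !gt_eqF.
have pp : 0 < p ^+ 2 * (p + j) by rewrite mulr_gt0 ?exprn_gt0.
rewrite E divr_ge0 ?sqr_ge0 ?(ltW pp) //=.
apply: ler_wpM2l; first exact: sqr_ge0.
rewrite lef_pV2 ?posrE ?exprn_gt0 // exprSr ler_pM2l ?exprn_gt0 //; lra.
Qed.

(** The left side is at most [Y * Q^2 / N^3]; the hypothesis [Q^3 * Y <= N^3] is what bounds this by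
    [1 / Q]. *)
Lemma cube_ratio_le (Y N Q q p : R) : 0 < Y -> 0 < N -> N <= p -> 0 < q -> q <= Q ->
  Q ^+ 3 * Y <= N ^+ 3 -> Y * (q ^+ 2 / p ^+ 3) <= Q^-1.
Proof.
move=> Y0 N0 Np q0 qQ h; have Q0 : 0 < Q by lra. have p0 : 0 < p by lra.
have pn : N ^+ 3 <= p ^+ 3 by rewrite lerXn2r ?nnegrE // ltW.
have qq : q ^+ 2 <= Q ^+ 2 by rewrite lerXn2r ?nnegrE // ltW.
rewrite mulrA ler_pdivrMr ?exprn_gt0 // ler_pdivlMl //.
apply: le_trans pn; apply: le_trans h.
rewrite mulrCA mulrC ler_pM2r // (exprS Q 2) ler_pM2l //.
Qed.

Section Dyadic.
(** [w] is the cube root of [Y] and [Q] the integer part of [N / w]: blocks of length at most [Q]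
    are then short enough for [Y / k] to be nearly linear. The bound [NY] keeps the slopes above
    [1 / Q], so that their approximations have positive numerators. *)
Variables (n a N Q : nat) (w : R).
Let Y : R := n%:R / a%:R.
Hypotheses (n_gt0 : (0 < n)%N) (a_gt0 : (0 < a)%N) (N_gt0 : (0 < N)%N).
Hypotheses (Q6 : (6 <= Q)%N) (w0 : 0 < w) (wY : w ^+ 3 = Y).
Hypotheses (Qw : Q%:R * w <= N%:R) (NQ : N%:R < Q.+1%:R * w).
Hypothesis NY : 32 * N%:R <= w ^+ 2.

(* Near k the sequence Y / k has slope about - b / q for some q <= Q, and a block of
   length q contributes O(1) to the sawtooth sum; [weight] has mass at least 1 on
   such a block, so that its total mass bounds the number of blocks. *)
Let close (q b k : nat) : bool := `|q%:R * Y / k%:R ^+ 2 - b%:R| <= 3 / Q%:R.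
Let bmax (q : nat) : nat := Num.truncn (q%:R * Y / N%:R ^+ 2 + 2^-1).
Let weight (k : nat) : R := \sum_(1 <= q < Q.+1) q%:R^-1 *
  \sum_(1 <= b < (bmax q).+1) (close q b k)%:R.

Let Y_gt0 : 0 < Y. Proof. by rewrite divr_gt0 ?ltr0n. Qed.
Let N0 : 0 < N%:R :> R. Proof. by rewrite ltr0n. Qed.
Let Q0 : 0 < Q%:R :> R. Proof. by rewrite ltr0n (leq_trans _ Q6). Qed.
Let QN : Q%:R ^+ 3 * Y <= N%:R ^+ 3.
Proof. by rewrite -wY -exprMn lerXn2r ?nnegrE ?mulr_ge0 // ltW. Qed.

Let weight_ge0 k : 0 <= weight k.
Proof. by apply: sumr_ge0 => q _; rewrite mulr_ge0 ?invr_ge0 ?sumr_ge0. Qed.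

(** A positive [bmax q] forces [v >= 1/2], so the shift by 1/2 costs a factor 2 and no additive
    constant. *)
Lemma bmax_le q : (bmax q)%:R <= 2 * (q%:R * Y / N%:R ^+ 2).
Proof.
set v := q%:R * Y / N%:R ^+ 2.
have v0 : 0 <= v by rewrite divr_ge0 ?mulr_ge0 ?exprn_ge0 // ltW.
have v1 : 0 <= v + 2^-1 by lra.
have /andP[h1 h2] := truncn_itv v1; rewrite /bmax -/v.
case: (Num.truncn _) h1 => [|m] h1; first by lra.
have : 1 <= m.+1%:R :> R by rewrite ler1n.
lra.
Qed.

(** Along the block [q] times the slope drifts by at most [2 / Q], on top of the [1 / Q] of the
    approximation: hence the [3 / Q] in [close]. Each of the [q] points then receives at least
    [1 / q] from the pair [(q, b)]. *)
Lemma weight_block k q b : (N <= k)%N -> (k + q <= 2 * N)%N -> (0 < q <= Q)%N ->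
  `|q%:R * (Y / k%:R ^+ 2) - b%:R| <= Q%:R^-1 -> 1 <= \sum_(j < q) weight (k + j).
Proof.
move=> Nk kN /andP[q0 qQ] hb.
have q0' : 0 < q%:R :> R by rewrite ltr0n.
have qQ' : q%:R <= Q%:R :> R by rewrite ler_nat.
have Nk' : N%:R <= k%:R :> R by rewrite ler_nat.
have k0 : 0 < k%:R :> R by rewrite ltr0n (leq_trans N_gt0).
have Q6' : 6 <= Q%:R :> R by rewrite (ler_nat _ 6).
have kN' : k%:R <= 2 * N%:R :> R.
  by rewrite -natrM ler_nat (leq_trans (leq_addr q k)).
have b0 : (0 < b)%N.
  rewrite lt0n; apply/negP => /eqP b0; move: hb; rewrite b0 subr0 ger0_norm; last first.
    by rewrite !mulr_ge0 ?invr_ge0 ?exprn_ge0 // ltW.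
  apply/negP; rewrite -ltNge.
  have q1 : 1 <= q%:R :> R by rewrite ler1n.
  apply: lt_le_trans (_ : Y / k%:R ^+ 2 <= _); last by rewrite ler_peMl // divr_ge0 ?exprn_ge0 // ltW.
  rewrite ltr_pdivlMr ?exprn_gt0 // ltr_pdivrMl //.
  have kk : k%:R ^+ 2 <= 4 * (N%:R * N%:R) :> R.
    by apply: le_trans (_ : (2 * N%:R) ^+ 2 <= _); [rewrite lerXn2r ?nnegrE // | ]; lra.
  apply: le_lt_trans kk _; rewrite -wY.
  have h1 : 4 * (N%:R * N%:R) < 4 * (N%:R * (Q.+1%:R * w)) by rewrite !ltr_pM2l.
  have h2 : Q.+1%:R <= 2 * Q%:R :> R by rewrite -natr1; lra.
  have h3 : N%:R * (Q.+1%:R * w) <= N%:R * (2 * Q%:R * w) by rewrite ler_pM2l // ler_pM2r.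
  have h4 : Q%:R * w * (32 * N%:R) <= Q%:R * w * w ^+ 2 by rewrite ler_wpM2l // mulr_ge0 // ltW.
  have h5 : 0 <= N%:R * (Q%:R * w) by rewrite !mulr_ge0 // ltW.
  rewrite exprS; lra.
have bq : (b < (bmax q).+1)%N.
  rewrite ltnS truncn_ge_nat; last by rewrite addr_ge0 ?invr_ge0 // divr_ge0 ?mulr_ge0 ?exprn_ge0 // ltW.
  move: hb; rewrite ler_norml => /andP[h _].
  have Qi : Q%:R^-1 <= 2^-1 :> R by rewrite lef_pV2 ?posrE //; lra.
  have : q%:R * (Y / k%:R ^+ 2) <= q%:R * Y / N%:R ^+ 2.
    rewrite [leLHS]mulrA; apply: ler_wpM2l; first by rewrite mulr_ge0 // ltW.
    by rewrite lef_pV2 ?posrE ?exprn_gt0 // lerXn2r ?nnegrE // ltW.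
  lra.
have closej j : (j < q)%N -> close q b (k + j).
  move=> jq; rewrite /close natrD.
  have j0 : 0 <= j%:R :> R by [].
  have jq' : j%:R <= q%:R :> R by rewrite ler_nat ltnW.
  have /andP[d1 d2] := inv_sqr_drift k0 j0.
  have c := cube_ratio_le Y_gt0 N0 Nk' q0' qQ' QN.
  have -> : q%:R * Y / (k%:R + j%:R) ^+ 2 - b%:R = (q%:R * (Y / k%:R ^+ 2) - b%:R)
     - q%:R * Y * ((k%:R ^+ 2)^-1 - ((k%:R + j%:R) ^+ 2)^-1) by ring.
  have qY : 0 <= q%:R * Y by rewrite mulr_ge0 // ltW.
  apply: le_trans (ler_normB _ _) _; rewrite (ger0_norm (mulr_ge0 qY d1)).
  have d3 : q%:R * Y * ((k%:R ^+ 2)^-1 - ((k%:R + j%:R) ^+ 2)^-1) <=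
      2 * (Y * (q%:R ^+ 2 / k%:R ^+ 3)).
    apply: le_trans (_ : q%:R * Y * (2 * j%:R / k%:R ^+ 3) <= _); first by rewrite ler_wpM2l.
    have -> : 2 * (Y * (q%:R ^+ 2 / k%:R ^+ 3)) = q%:R * Y * (2 * q%:R / k%:R ^+ 3) by ring.
    apply: ler_wpM2l => //; apply: ler_wpM2r; first by rewrite invr_ge0 exprn_ge0 // ltW.
    by rewrite ler_pM2l.
  lra.
have -> : 1 = \sum_(j < q) q%:R^-1 :> R by rewrite sumr_const card_ord -[RHS]mulr_natl mulfV ?gt_eqF.
apply: ler_sum => j _; rewrite /weight (bigD1_seq q) ?iota_uniq //=; last first.
  by rewrite mem_index_iota q0 ltnS.
rewrite -[leLHS]addr0; apply: lerD; last first.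
  by apply: sumr_ge0 => i _; rewrite mulr_ge0 ?invr_ge0 ?sumr_ge0.
rewrite ler_pMr ?invr_gt0 // (bigD1_seq b) ?iota_uniq //=; last first.
  by rewrite mem_index_iota b0.
by rewrite closej // lerDl sumr_ge0.
Qed.

(** Each block comes from a Dirichlet approximation of the slope at its left end. On it
    [q * Y / (k + j)] differs from [q * Y / k - b * j] by at most 1 through curvature and 1 through
    the approximation, as [block_sum] requires. *)
Lemma sawtooth_greedy N' : (N <= N' <= 2 * N)%N ->
  `|\sum_(N <= k < N') sawtooth R n (a * k)| <= 5 * \sum_(N <= k < 2 * N) weight k + Q%:R.
Proof.
move=> /andP[NN' N'N].
apply: (@le_trans _ _ (\sum_(N <= k < N') 5 * weight k + Q%:R)); last first.
  rewrite lerD2r -mulr_sumr ler_pM2l // [leRHS](@big_cat_nat _ _ _ N') //=.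
  by rewrite lerDl sumr_ge0.
apply: greedy_blocks.
- move=> k Nk; apply: le_trans (sawtooth_le R n _) _; last by lra.
  by rewrite muln_gt0 a_gt0 ?addn_gt0 (leq_trans N_gt0).
- by move=> k; rewrite mulr_ge0.
move=> k /andP[Nk kN'].
have k0 : 0 < k%:R :> R by rewrite ltr0n (leq_trans N_gt0).
have Qp : (0 < Q)%N by exact: leq_trans Q6.
have Yk : 0 <= Y / k%:R ^+ 2 by rewrite divr_ge0 ?exprn_ge0 // ltW.
have [q [b [/andP[q0 qQ] bq hb]]] := dirichlet_approximation Yk Qp.
exists q => [|kq]; first by rewrite q0.
rewrite -mulr_sumr; apply: le_trans (_ : 5 * 1 <= _); last first.
  by rewrite ler_pM2l //; apply: (weight_block Nk _ _ hb); [exact: leq_trans kq N'N|rewrite q0].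
rewrite mulr1.
have q0' : 0 < q%:R :> R by rewrite ltr0n.
have qQ' : q%:R <= Q%:R :> R by rewrite ler_nat.
have Nk' : N%:R <= k%:R :> R by rewrite ler_nat.
have a0 : 0 < a%:R :> R by rewrite ltr0n.
pose u (j : nat) : R := Y / (k%:R + j%:R).
pose F (j : nat) : nat := (n %/ (a * (k + j)))%N.
have uE j : u j = n%:R / (a * (k + j))%:R.
  by rewrite /u /Y natrM natrD invfM mulrA.
have -> : \sum_(j < q) sawtooth R n (a * (k + j)) = \sum_(j < q) (u j - (F j)%:R - 2^-1).
  by apply: eq_bigr => j _; rewrite uE.
apply: (@block_sum R u F (q%:R * Y / k%:R) b q) => // j jq.
  have [|h1 h2] := natr_div_bounds R n (_ : 0 < a * (k + j))%N.
    by rewrite muln_gt0 a_gt0 ?addn_gt0 (leq_trans N_gt0).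
  by rewrite uE /F h1 /= natr1 h2.
have j0 : 0 <= j%:R :> R by [].
have jq' : j%:R <= q%:R :> R by rewrite ler_nat ltnW.
have /andP[d1 d2] := inv_linear_drift k0 j0.
have c := cube_ratio_le Y_gt0 N0 Nk' q0' qQ' QN.
have -> : q%:R * u j - (q%:R * Y / k%:R - b%:R * j%:R) =
   q%:R * Y * ((k%:R + j%:R)^-1 - (k%:R^-1 - j%:R / k%:R ^+ 2))
   - j%:R * (q%:R * (Y / k%:R ^+ 2) - b%:R) by rewrite /u; ring.
have qY : 0 <= q%:R * Y by rewrite mulr_ge0 // ltW.
apply: le_trans (ler_normB _ _) _.
rewrite (ger0_norm (mulr_ge0 qY d1)) normrM (ger0_norm j0).
have Qi : Q%:R^-1 * Q%:R = 1 :> R by rewrite mulVf ?gt_eqF.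
have X1 : j%:R * `|q%:R * (Y / k%:R ^+ 2) - b%:R| <= 1.
  rewrite -[leRHS]Qi [leLHS]mulrC; apply: ler_pM => //.
  exact: le_trans jq' qQ'.
have X2 : q%:R * Y * ((k%:R + j%:R)^-1 - (k%:R^-1 - j%:R / k%:R ^+ 2)) <= 1.
  apply: le_trans (_ : q%:R * Y * (q%:R ^+ 2 / k%:R ^+ 3) <= _).
    apply: ler_wpM2l => //; apply: le_trans d2 _; apply: ler_wpM2r.
      by rewrite invr_ge0 exprn_ge0 // ltW.
    by rewrite lerXn2r ?nnegrE.
  rewrite -[leRHS]Qi -[leLHS]mulrA [leLHS]mulrC; apply: ler_pM => //.
  by rewrite mulr_ge0 ?divr_ge0 ?exprn_ge0 // ltW.
lra.
Qed.

(** After exchanging sums, the [k] close to [b / q] form one cluster of length at most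
    [D = 24 * N^3 / (q * Q * Y)], and there are at most [2 * q * Y / N^2] values of [b]. *)
Lemma weight_sum : \sum_(N <= k < 2 * N) weight k <=
  48 * (N%:R / Q%:R) * \sum_(1 <= q < Q.+1) q%:R^-1 + 2 * (Q%:R * Y / N%:R ^+ 2).
Proof.
rewrite exchange_big /= mulr_sumr.
have -> : 2 * (Q%:R * Y / N%:R ^+ 2) = \sum_(1 <= q < Q.+1) 2 * (Y / N%:R ^+ 2).
  by rewrite sumr_const_nat subn1 -mulr_natl /=; ring.
rewrite -big_split /= !big_seq; apply: ler_sum => q.
rewrite mem_index_iota => /andP[q0 _].
have q0' : 0 < q%:R :> R by rewrite ltr0n.
rewrite -mulr_sumr exchange_big /=.
pose D : R := 8 * (3 / Q%:R) * N%:R ^+ 3 / (q%:R * Y).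
have D0 : 0 <= D.
  by rewrite /D divr_ge0 ?mulr_ge0 ?exprn_ge0 ?invr_ge0 // ltW.
apply: (@le_trans _ _ (q%:R^-1 * (2 * (q%:R * Y / N%:R ^+ 2) * (D + 1)))).
  rewrite ler_pM2l ?invr_gt0 //.
  apply: le_trans (_ : \sum_(1 <= b < (bmax q).+1) (D + 1) <= _).
    apply: ler_sum => b _; apply: count_clustered => // i j Ni /andP[ij jN] ci cj.
    have := @close_cluster (q%:R * Y) b%:R (3 / Q%:R) i%:R j%:R N%:R.
    rewrite natrB //; apply => //; rewrite ?(mulr_gt0 q0' Y_gt0) ?ler_nat //.
    by rewrite -natrM ler_nat ltnW.
  rewrite sumr_const_nat subn1 -[leLHS]mulr_natl /=; apply: ler_wpM2r; last exact: bmax_le.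
  by rewrite addr_ge0.
rewrite le_eqVlt; apply/orP; left; apply/eqP; rewrite /D.
by field; rewrite !gt_eqF.
Qed.

End Dyadic.

Lemma sum_inv_le d : 0 < d -> exists2 C : R, 0 < C & forall Q : nat,
  \sum_(1 <= q < Q.+1) q%:R^-1 <= C * Q.+1%:R `^ d.
Proof.
move=> d0; have [C C0 hC] := sum_powR_le d0; exists C => // Q.
apply: le_trans (hC _); rewrite !big_seq; apply: ler_sum => q.
rewrite mem_index_iota => /andP[q0 _].
by rewrite -powR_inv1 // ler_powR ?ler1n //; lra.
Qed.

(** With [Q] close to [N / w], the terms [N / Q], [Q * Y / N^2] and [Q] are all [O(w)]. If [Q < 6]
    then [N < 6 * w], and the trivial bound suffices. *)
Lemma sawtooth_dyadic d : 0 < d -> exists2 C, 0 < C &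
  forall (n a N N' : nat) (w : R), (0 < n)%N -> (0 < a)%N -> (0 < N)%N -> 1 <= w ->
  w ^+ 3 = n%:R / a%:R -> (N <= N' <= 2 * N)%N -> 32 * N%:R <= w ^+ 2 ->
  `|\sum_(N <= k < N') sawtooth R n (a * k)| <= C * w * N%:R `^ d.
Proof.
move=> d0; have [C C0 hC] := sum_inv_le d0.
exists (480 * (C * 2 `^ d) + 11) => [|n a N N' w n0 a0 N0 w1 wY NN' NY].
  by have := powR_gt0 d (ltr0n R 2); have := mulr_gt0 C0 (powR_gt0 d (ltr0n R 2)); lra.
have w0 : 0 < w by lra.
have N0' : 0 < N%:R :> R by rewrite ltr0n.
have N1 : 1 <= N%:R `^ d by rewrite -[leLHS](powRr0 N%:R) ler_powR ?ler1n // ltW.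
have Cd : 0 < C * 2 `^ d by rewrite mulr_gt0 ?powR_gt0.
pose Q := Num.truncn (N%:R / w).
have Nw : 0 <= N%:R / w by rewrite divr_ge0 // ltW.
have /andP[Q1 Q2] := truncn_itv Nw; rewrite -/Q in Q1 Q2.
rewrite ler_pdivlMr // in Q1; rewrite ltr_pdivrMr // in Q2.
have [Q6|Q6] := ltnP Q 6.
  apply: le_trans (ler_norm_sum _ _ _) _.
  apply: le_trans (_ : \sum_(N <= k < N') 2^-1 <= _).
    rewrite !big_seq; apply: ler_sum => k; rewrite mem_index_iota => /andP[Nk _].
    by apply: sawtooth_le; rewrite muln_gt0 a0 (leq_trans N0).
  rewrite sumr_const_nat -[leLHS]mulr_natl.
  have h1 : (N' - N)%:R <= N%:R :> R.
    by rewrite ler_nat leq_subLR addnn -mul2n; case/andP: NN'.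
  have h2 : N%:R <= 6 * w.
    by apply: le_trans (ltW Q2) _; rewrite ler_pM2r // (ler_nat _ _ 6).
  apply: le_trans (_ : 11 * w * 1 <= _); first by lra.
  by apply: ler_pM => //; [lra | rewrite ler_pM2r; lra].
have := sawtooth_greedy n0 a0 N0 Q6 w0 wY Q1 Q2 NY NN'.
move/le_trans; apply.
have H := weight_sum n0 a0 N0 Q6; apply: le_trans (_ : 5 * (48 * (N%:R / Q%:R) * \sum_(1 <= q < Q.+1) q%:R^-1 +
     2 * (Q%:R * (n%:R / a%:R) / N%:R ^+ 2)) + Q%:R <= _).
  by rewrite lerD2r ler_pM2l.
have Qp : (0 < Q)%N by exact: leq_trans Q6.
have Q0 : 0 < Q%:R :> R by rewrite ltr0n.
have QN : (Q.+1 <= 2 * N)%N.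
  have : (Q <= N)%N by rewrite -(ler_nat R); apply: le_trans Q1; rewrite ler_peMr // ltW.
  by move: N0; clear; lia.
have S1 : \sum_(1 <= q < Q.+1) q%:R^-1 <= C * 2 `^ d * N%:R `^ d.
  apply: le_trans (hC Q) _; rewrite -mulrA ler_pM2l // -powRM //.
  by rewrite ge0_ler_powR ?nnegrE ?(ltW d0) ?mulr_ge0 // -natrM ler_nat.
have NQ : N%:R / Q%:R <= 2 * w.
  rewrite ler_pdivrMr //; apply: le_trans (ltW Q2) _.
  rewrite mulrAC ler_pM2r //; exact: succ_le_double.
have wN : w <= N%:R.
  by apply: le_trans Q1; rewrite ler_peMl ?ler1n ?(ltW w0).
have YN : Q%:R * (n%:R / a%:R) / N%:R ^+ 2 <= w.
  rewrite -wY ler_pdivrMr ?exprn_gt0 //.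
  have -> : Q%:R * w ^+ 3 = (Q%:R * w) * w * w by ring.
  have -> : w * N%:R ^+ 2 = N%:R * N%:R * w by ring.
  by rewrite ler_pM2r //; apply: ler_pM; rewrite ?mulr_ge0 // ltW.
have QY : Q%:R <= w.
  have : Q%:R * w <= w * w by apply: le_trans Q1 _; rewrite -expr2; lra.
  by rewrite ler_pM2r.
have Sp : 0 <= \sum_(1 <= q < Q.+1) q%:R^-1 :> R by apply: sumr_ge0 => i _; rewrite invr_ge0.
have X : N%:R / Q%:R * \sum_(1 <= q < Q.+1) q%:R^-1 <= 2 * w * (C * 2 `^ d * N%:R `^ d).
  by apply: ler_pM.
have X2 : w <= w * N%:R `^ d by rewrite ler_peMr // ltW.
rewrite -(mulrA 48); move: X X2 QY YN.
move: (N%:R / Q%:R * _) => t1; move: (Q%:R * _ / _) => t2; move: (C * 2 `^ d) => c.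
by move: (N%:R `^ d) (Q%:R : R); clear; move=> p t3 h1 h2 h3 h4; lra.
Qed.

End Vinogradov.

(** * Sawtooth sums over full ranges *)

Section SawtoothSums.
Variable R : realType.
Implicit Types (n a q N : nat) (w d : R).

Lemma powR_addE (x a b : R) : 0 < x -> x `^ a * x `^ b = x `^ (a + b).
Proof. by move=> x0; rewrite powRD // (gt_eqF x0) implybT. Qed.

Lemma powR_ge1 (x d : R) : 1 <= x -> 0 <= d -> 1 <= x `^ d.
Proof. by move=> x1 d0; rewrite -[leLHS](powRr0 x) ler_powR. Qed.

(** The range is halved repeatedly. The factor [r = 2^(-d)] gained by [N^d] makes the pieces sum
    geometrically, and [K] solves [K = K * r + C + 1], the 1 standing for the single term left over
    when [N] is odd. *)
Lemma sawtooth_sum d : 0 < d -> exists2 C, 0 < C &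
  forall n a N w, (0 < n)%N -> (0 < a)%N -> 1 <= w -> w ^+ 3 = n%:R / a%:R ->
  32 * N%:R <= w ^+ 2 ->
  `|\sum_(1 <= k < N) sawtooth R n (a * k)| <= C * w * N%:R `^ d.
Proof.
move=> d0; have [C C0 hC] := sawtooth_dyadic d0.
have h2 : 2^-1 `^ d < 1 :> R.
  have := @gt0_ltr_powR R d d0 2^-1 1; rewrite powR1; apply.
  - by rewrite nnegrE invr_ge0.
  - by rewrite nnegrE.
  - by rewrite invf_lt1 ?ltr1n.
pose r := 2^-1 `^ d : R; have r0 : 0 < 1 - r by rewrite /r; lra.
pose K := (C + 1) / (1 - r); have K0 : 0 < K by rewrite divr_gt0 //; lra.
exists K => // n a N w n0 a0 w1 wY; have w0 : 0 < w by lra.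
elim/ltn_ind: N => N IH NY.
have [N2|N2] := ltnP N 2.
  rewrite big_geq // normr0; apply: mulr_ge0 (powR_ge0 _ _).
  exact: mulr_ge0 (ltW K0) (ltW w0).
pose M := N./2.
have [M0 MN NM MN1] : [/\ (0 < M)%N, (M < N)%N, (2 * M <= N)%N & (N <= (2 * M).+1)%N].
  rewrite /M; have := odd_double_half N; rewrite -mul2n; move: N2 (N./2).
  by clear; case: (odd N) => N2 m /= e; split; lia.
have MY : 32 * M%:R <= w ^+ 2.
  by apply: le_trans NY; rewrite ler_pM2l // ler_nat ltnW.
have h1 := IH M MN MY.
have h3 := hC n a M (2 * M)%N w n0 a0 M0 w1 wY _ MY.
rewrite (@big_cat_nat _ _ _ M) ?(ltnW MN) //= (@big_cat_nat _ _ _ (2 * M) M) //=; last first.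
  by rewrite mul2n -addnn leq_addr.
have h4 : `|\sum_(2 * M <= k < N) sawtooth R n (a * k)| <= 1.
  apply: le_trans (ler_norm_sum _ _ _) _.
  apply: le_trans (_ : \sum_(2 * M <= k < N) 1 <= _).
    rewrite !big_seq; apply: ler_sum => k; rewrite mem_index_iota => /andP[h _].
    apply: le_trans (sawtooth_le R n _) _; last by lra.
    by rewrite muln_gt0 a0 (leq_trans _ h) // muln_gt0 M0.
  by rewrite sumr_const_nat (ler_nat _ _ 1) leq_subLR addn1.
have N1 : 1 <= N%:R `^ d by rewrite powR_ge1 ?(ltW d0) // ler1n ltnW.
have hM : M%:R `^ d <= r * N%:R `^ d.
  rewrite -powRM ?invr_ge0 // ge0_ler_powR ?nnegrE ?mulr_ge0 ?invr_ge0 ?(ltW d0) //.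
  by rewrite ler_pdivlMl // -natrM ler_nat.
have Mp : 0 <= M%:R `^ d by exact: powR_ge0.
have r1 : r * N%:R `^ d <= N%:R `^ d by rewrite ger_pMl; lra.
apply: le_trans (ler_normD _ _) _; apply: le_trans (lerD h1 (ler_normD _ _)) _.
have {}h3 : `|\sum_(M <= k < 2 * M) sawtooth R n (a * k)| <= C * w * M%:R `^ d.
  by apply: h3; rewrite leqnn mul2n -addnn leq_addr.
apply: le_trans (lerD (lexx _) (lerD h3 h4)) _.
have E : K * (1 - r) = C + 1 by rewrite /K divfK // gt_eqF.
have X1 : K * w * M%:R `^ d <= K * w * (r * N%:R `^ d) by rewrite ler_wpM2l // mulr_ge0 // ltW.
have X2 : C * w * M%:R `^ d <= C * w * N%:R `^ d.
  by rewrite ler_wpM2l ?(le_trans hM r1) // mulr_ge0 // ltW.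
have X3 : 1 <= w * N%:R `^ d by rewrite -[leLHS]mulr1 ler_pM.
have E2 : K * w * N%:R `^ d = K * w * (r * N%:R `^ d) + (C + 1) * w * N%:R `^ d.
  by rewrite -E; ring.
rewrite E2; move: X1 X2 X3; move: (N%:R `^ d) (M%:R `^ d) => p m; clear; lra.
Qed.

(** If [32 * N > w^2], then [N^2 <= 4 * w^3] forces [w <= 4096]; hence [N <= 128 * w], and the
    trivial bound suffices. *)
Lemma sawtooth_sum_sqrt d : 0 < d -> exists2 C, 0 < C &
  forall n a N w, (0 < n)%N -> (0 < a)%N -> 1 <= w -> w ^+ 3 = n%:R / a%:R ->
  N%:R * N%:R <= 4 * w ^+ 3 ->
  `|\sum_(1 <= k < N) sawtooth R n (a * k)| <= C * w * N%:R `^ d.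
Proof.
move=> d0; have [C C0 hC] := sawtooth_sum d0.
exists (C + 128) => [|n a N w n0 a0 w1 wY NN]; first by lra.
have w0 : 0 < w by lra.
have [->|N0] := posnP N.
  by rewrite big_geq // normr0 !mulr_ge0 ?powR_ge0 // ltW //; lra.
have N1 : 1 <= N%:R `^ d by rewrite powR_ge1 ?(ltW d0) // ler1n.
have [h|h] := leP (32 * N%:R) (w ^+ 2).
  apply: le_trans (hC n a N w n0 a0 w1 wY h) _.
  by rewrite -!mulrA ler_wpM2r ?mulr_ge0 ?powR_ge0 ?(ltW w0) //; lra.
have Nn : 0 <= N%:R :> R by [].
have N128 : N%:R <= 128 * w.
  move: NN h Nn w0 w1; move: (N%:R : R); clear => x NN h x0 w0 w1.
  have w4096 : w <= 4096.
    have h1 : w ^+ 2 * w ^+ 2 <= (32 * x) * (32 * x).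
      by apply: ler_pM; rewrite ?sqr_ge0 // ltW.
    have h2 : w * w ^+ 3 <= 4096 * w ^+ 3 by rewrite -exprS (exprD w 2 2); lra.
    by rewrite ler_pM2r ?exprn_gt0 // in h2.
  rewrite -(ler_pXn2r (n := 2)) ?nnegrE ?mulr_ge0 ?(ltW w0) //.
  have h3 : w ^+ 3 <= 4096 * w ^+ 2 by rewrite exprS ler_wpM2r ?sqr_ge0.
  by rewrite exprMn [x ^+ 2]expr2; lra.
apply: le_trans (ler_norm_sum _ _ _) _.
apply: le_trans (_ : \sum_(1 <= k < N) 1 <= _).
  rewrite !big_seq; apply: ler_sum => k; rewrite mem_index_iota => /andP[k0 _].
  apply: le_trans (sawtooth_le R n _) _; last by lra.
  by rewrite muln_gt0 a0.
rewrite sumr_const_nat; apply: le_trans (_ : N%:R <= _); first by rewrite ler_nat leq_subr.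
apply: le_trans N128 _; apply: le_trans (_ : (C + 128) * w * 1 <= _).
  by rewrite mulr1 ler_pM2r //; lra.
by rewrite ler_pM2l // mulr_gt0 //; lra.
Qed.

Lemma sum_modn_period a k : (0 < a)%N ->
  \sum_(0 <= v < k) (2 * (v %% a)%:R + 1 - a%:R) = (k %% a)%:R * ((k %% a)%:R - a%:R) :> R.
Proof.
move=> a0; elim: k => [|k IH]; first by rewrite big_geq // mod0n mul0r.
rewrite big_nat_recr //= IH; have [h|h] := ltnP (k %% a).+1 a.
  have -> : (k.+1 %% a)%N = (k %% a).+1 by rewrite -addn1 -modnDml addn1 modn_small.
  by rewrite -natr1; ring.
have ka : (k %% a).+1 = a by apply/eqP; rewrite eqn_leq h ltn_pmod.
have -> : (k.+1 %% a)%N = 0%N by rewrite -addn1 -modnDml addn1 ka modnn.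
have : a%:R = (k %% a)%:R + 1 :> R by rewrite natr1 ka.
by move: ((k %% a)%:R : R) (a%:R : R) => r x ->; ring.
Qed.

(** Over a full period modulo [a] the sum is exactly -1/2, so the range yields [-(k - s) / (2 * a)]
    and boundary terms of size at most [a / 2]. *)
Lemma sawtooth_long_sum a s k : (0 < a)%N -> (s <= k)%N ->
  `|\sum_(s <= v < k) sawtooth R v a| <= a%:R + k%:R / a%:R.
Proof.
move=> a0 sk; have a0' : 0 < a%:R :> R by rewrite ltr0n.
have U0 j : - (a%:R * a%:R) <= ((j %% a)%:R * ((j %% a)%:R - a%:R) : R) <= 0.
  have h1 : 0 <= (j %% a)%:R :> R by [].
  have h2 : (j %% a)%:R <= a%:R :> R by rewrite ler_nat ltnW // ltn_pmod.
  move: h1 h2 a0'; move: ((j %% a)%:R : R) (a%:R : R); clear => r x h1 h2 x0.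
  have : 0 <= r * (x - r) by rewrite mulr_ge0 ?subr_ge0.
  have : r * (x - r) <= x * x by apply: ler_pM; lra.
  by move=> h3 h4; apply/andP; split; lra.
have E : 2 * a%:R * \sum_(s <= v < k) sawtooth R v a =
   (k %% a)%:R * ((k %% a)%:R - a%:R) - (s %% a)%:R * ((s %% a)%:R - a%:R) - (k - s)%:R.
  rewrite -!sum_modn_period // (@big_cat_nat _ _ _ s 0 k) //= (addrC (\sum_(0 <= v < s) _)) addrK.
  have -> : (k - s)%:R = \sum_(s <= v < k) 1 :> R by rewrite sumr_const_nat.
  rewrite -sumrB mulr_sumr; apply: eq_bigr => v _.
  rewrite /sawtooth {1}(divn_eq v a) natrD natrM.
  by field; rewrite gt_eqF.
have /andP[k1 k2] := U0 k; have /andP[s1 s2] := U0 s.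
have k3 : 0 <= (k - s)%:R :> R by [].
have k4 : (k - s)%:R <= k%:R :> R by rewrite ler_nat leq_subr.
have -> : a%:R + k%:R / a%:R = (a%:R * a%:R + k%:R) / a%:R :> R by rewrite mulrDl mulfK ?gt_eqF.
rewrite ler_pdivlMr // -{1}(gtr0_norm a0') -normrM.
have H (S x y z t c : R) : 2 * S = x - y - z -> - t <= x -> x <= 0 -> - t <= y ->
    y <= 0 -> 0 <= z -> z <= c -> `|S| <= t + c.
  by clear => *; rewrite ler_norml; apply/andP; split; lra.
by apply: (H _ _ _ _ _ _ _ k1 k2 s1 s2 k3 k4); rewrite -E; ring.
Qed.

End SawtoothSums.

(** * The sum of d D(n / d)^2 *)

Section DivisorError.
Variable R : realType.
Implicit Types (n a q N v X : nat) (w d : R).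

Local Notation c := (2 * stieltjes R 0 - 1).

(** This is [Delta(n / d)], with the main term at the real quotient. *)
Definition divisor_error (n d : nat) : R :=
  (divisor_sum (n %/ d))%:R - n%:R / d%:R * (ln (n%:R / d%:R) + c).

Lemma divisor_error_sqr : exists2 C : R, 0 < C & forall n d : nat, (0 < d <= n)%N ->
  divisor_error n d ^+ 2 <= C * (n%:R / d%:R).
Proof.
have [C C0 hC] := divisor_sum_sawtooth R.
exists ((C + 1) ^+ 2) => [|n d dn]; first by rewrite exprn_gt0 //; lra.
have /andP[d0 dn'] := dn; have [u hu] := sqrt_exists (n %/ d).
have [nd _] := natr_div_bounds R n d0.
have u0 : (0 < u)%N.
  have k0 : (0 < n %/ d)%N by rewrite divn_gt0.
  rewrite lt0n; apply/negP => /eqP u0; move: hu; rewrite u0 muln1 => /andP[_].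
  by rewrite ltnS leqNgt k0.
have := hC n d dn; rewrite (big_sqrt_range _ _ d0 hu) -/(divisor_error n d).
set S := \sum_(_ <= _ < _) _ => h.
have hS : `|S| <= 2^-1 * u%:R.
  apply: le_trans (ler_norm_sum _ _ _) _.
  apply: le_trans (_ : \sum_(1 <= a < u.+1) 2^-1 <= _).
    rewrite !big_seq; apply: ler_sum => a; rewrite mem_index_iota => /andP[a0 _].
    by apply: sawtooth_le; rewrite muln_gt0 d0.
  by rewrite sumr_const_nat subn1 mulr_natr.
have u1 : 1 <= u%:R :> R by rewrite ler1n.
have uu : u%:R * u%:R <= n%:R / d%:R :> R.
  by apply: le_trans nd; rewrite -natrM ler_nat; case/andP: hu.
have e1 : `|divisor_error n d| <= (C + 1) * u%:R.
  move: h hS u1 C0; move: (divisor_error n d) (u%:R : R); clear => e x.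
  rewrite !ler_norml => /andP[h1 h2] /andP[h3 h4] x1 C0.
  have : C * 1 <= C * x by rewrite ler_pM2l.
  by move=> h5; apply/andP; split; lra.
rewrite -(ger0_norm (sqr_ge0 _)) normrX; apply: le_trans (_ : ((C + 1) * u%:R) ^+ 2 <= _).
  by rewrite lerXn2r ?nnegrE // mulr_ge0 //; lra.
by rewrite exprMn ler_wpM2l ?sqr_ge0.
Qed.

(** For fixed [a], consecutive [v] run through periods modulo [a], so the inner sums are [O(X / a)].
    This improves on the exponent 3/2 that the pointwise bound would give. *)
Lemma divisor_error_sum d : 0 < d -> exists2 C : R, 0 < C & forall X, (0 < X)%N ->
  `|\sum_(1 <= v < X) divisor_error v 1| <= C * X%:R `^ (1 + d).
Proof.
move=> d0; have [C C0 hC] := divisor_sum_sawtooth R.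
have [C1 C10 hC1] := sum_inv_le d0.
exists (C + 4 * (C1 * 2 `^ d)) => [|X X0].
  by rewrite addr_gt0 // !mulr_gt0 ?powR_gt0.
have X1 : 1 <= X%:R :> R by rewrite ler1n.
have X0' : 0 < X%:R :> R by rewrite ltr0n.
pose S v := \sum_(1 <= a < v.+1 | (a * a * 1 <= v)%N) sawtooth R v (1 * a).
have -> : \sum_(1 <= v < X) divisor_error v 1 =
    \sum_(1 <= v < X) (divisor_error v 1 + 2 * S v) - 2 * \sum_(1 <= v < X) S v.
  by rewrite [X in _ = X - _]big_split /= mulr_sumr addrK.
apply: le_trans (ler_normB _ _) _; rewrite [leRHS]mulrDl; apply: lerD.
  apply: le_trans (ler_norm_sum _ _ _) _.
  apply: le_trans (_ : \sum_(1 <= v < X) C <= _).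
    rewrite !big_seq; apply: ler_sum => v; rewrite mem_index_iota => /andP[v0 _].
    by apply: hC; rewrite v0.
  rewrite sumr_const_nat -[leLHS]mulr_natr ler_pM2l //.
  apply: le_trans (_ : X%:R <= _); first by rewrite ler_nat leq_subr.
  by rewrite -[leLHS]powRr1 // ler_powR //; lra.
have ES : \sum_(1 <= v < X) S v =
    \sum_(1 <= a < X) \sum_(1 <= v < X | (a * a <= v)%N) sawtooth R v a.
  transitivity (\sum_(1 <= v < X) \sum_(1 <= a < X | (a * a <= v)%N) sawtooth R v a).
    apply: eq_big_nat => v /andP[v0 vX]; rewrite /S.
    rewrite (big_nat_widen _ _ _ _ _ vX); apply: eq_big => a; last by rewrite mul1n.
    rewrite muln1 ltnS; case: (boolP (a * a <= v)%N) => //= h.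
    have [->//|a0] := posnP a; first exact: leq_trans (leq_pmulr a a0) h.
  by rewrite (exchange_big_dep xpredT).
have hS a : (0 < a)%N -> `|\sum_(1 <= v < X | (a * a <= v)%N) sawtooth R v a| <=
    2 * (X%:R * a%:R^-1).
  move=> a0; have a0' : 0 < a%:R :> R by rewrite ltr0n.
  have aa0 : (0 < a * a)%N by rewrite muln_gt0 a0.
  have -> : \sum_(1 <= v < X | (a * a <= v)%N) sawtooth R v a =
      \sum_(a * a <= v < X) sawtooth R v a.
    by rewrite [RHS](big_nat_widenl _ 1).
  have [h|h] := leqP X (a * a).
    by rewrite big_geq // normr0 mulr_ge0 ?divr_ge0.
  apply: le_trans (sawtooth_long_sum R a0 (ltnW h)) _.
  have : a%:R <= X%:R / a%:R :> R by rewrite ler_pdivlMr // -natrM ler_nat ltnW.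
  by move: (_ / _) => y; lra.
rewrite ES normrM ger0_norm // -mulrA.
have -> : 4 * (C1 * 2 `^ d * X%:R `^ (1 + d)) = 2 * (2 * (C1 * 2 `^ d * X%:R `^ (1 + d))) by ring.
rewrite ler_pM2l //; apply: le_trans (ler_norm_sum _ _ _) _.
apply: le_trans (_ : \sum_(1 <= a < X) 2 * (X%:R * a%:R^-1) <= _).
  by rewrite !big_seq; apply: ler_sum => a; rewrite mem_index_iota => /andP[a0 _]; exact: hS.
rewrite -mulr_sumr ler_pM2l // -mulr_sumr -powR_addE // powRr1 //.
rewrite mulrCA ler_pM2l //; apply: le_trans (_ : \sum_(1 <= a < X.+1) a%:R^-1 <= _).
  by rewrite big_nat_recr // lerDl invr_ge0.
apply: le_trans (hC1 X) _; rewrite -mulrA ler_pM2l // -powRM //.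
by rewrite ge0_ler_powR ?nnegrE ?mulr_ge0 ?(ltW d0) ?succ_le_double.
Qed.

End DivisorError.

(** * The model sum for the tail *)

Section SquareSum.
Variable R : realType.
Implicit Types (n a q N v X : nat) (w d : R).

Local Notation c := (2 * stieltjes R 0 - 1).

Lemma normM_le (x y a b : R) : `|x| <= a -> `|y| <= b -> `|x * y| <= a * b.
Proof. by move=> xa yb; rewrite normrM ler_pM. Qed.

(** Used at an integer [X] with [u = 1 / X], [l = ln X + c], [h] the increment of the logarithm,
    [W = X^2 * inv_sqr_gap X], [e] the divisor error at [X] and [E] its partial sum. As [W] agrees
    with [2 * h] and [2 * u] to first order, every term is [O(u^2)] up to [B] and logarithms. *)
Lemma square_sum_increment (l h u W e E C B : R) : 0 < u -> u <= 1 ->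
  0 <= h <= u -> 0 <= W <= 2 * u -> `|W - 2 * h| <= 3 * u ^+ 2 ->
  `|W - 2 * u| <= 5 * u ^+ 2 -> 0 <= C -> e ^+ 2 <= C / u -> 0 <= B -> `|E| <= B / u ->
  `|l ^+ 2 * W - 2 / 3 * ((l + h) ^+ 3 - l ^+ 3) + 2 * (e * (l * (W * u - 2 * u ^+ 2)))
    + e ^+ 2 * (u ^+ 2 * W) + 2 * (E * (2 * l * u ^+ 2 - 2 * (l + h) * (u ^+ 2 - u ^+ 2 * W)))|
  <= (16 + 12 * C + 12 * B) * ((1 + `|l|) ^+ 2 * u ^+ 2).
Proof.
move=> u0 u1 /andP[h0 hu] /andP[W0 Wu] Wh Wu2 C0 eC B0 EB.
set m := `|l|; have m0 : 0 <= m := normr_ge0 l.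
have hn : `|h| <= u by rewrite ger0_norm.
have Wn : `|W| <= 2 * u by rewrite ger0_norm.
have u2 : 0 <= u ^+ 2 by rewrite exprn_ge0 // ltW.
have T1 : `|l ^+ 2 * W - 2 / 3 * ((l + h) ^+ 3 - l ^+ 3)| <= 6 * ((1 + m) ^+ 2 * u ^+ 2).
  have -> : l ^+ 2 * W - 2 / 3 * ((l + h) ^+ 3 - l ^+ 3) =
     l * l * (W - 2 * h) - 2 * (l * (h * h)) - 2 / 3 * (h * (h * h)) by field.
  have t1 := normM_le (normM_le (lexx m) (lexx m)) Wh.
  have t2 := normM_le (lexx m) (normM_le hn hn).
  have t3 := normM_le hn (normM_le hn hn).
  have t4 : u * (u * u) <= 1 * (u * u) by rewrite ler_wpM2r // -expr2.
  move: t1 t2 t3; rewrite -/m; move: (l * l * (W - 2 * h)) (l * (h * h)) (h * (h * h)) => x y z.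
  rewrite !ler_norml => /andP[? ?] /andP[? ?] /andP[? ?].
  have m2 : 0 <= m * u ^+ 2 by rewrite mulr_ge0.
  have m3 : 0 <= m * m * u ^+ 2 := mulr_ge0 (mulr_ge0 m0 m0) u2.
  by apply/andP; split; lra.
have en : `|e| <= (1 + C) / u.
  have e1 : `|e| <= 1 + e ^+ 2.
    rewrite -(real_normK (num_real e)); have := sqr_ge0 (`|e| - 2^-1).
    by move: (`|e|) => x; lra.
  apply: le_trans e1 _; rewrite mulrDl mul1r lerD //.
  by rewrite -[leLHS]invr1 lef_pV2 ?posrE.
have T2 : `|e * (l * (W * u - 2 * u ^+ 2))| <= 5 * (1 + C) * ((1 + m) ^+ 2 * u ^+ 2).
  have -> : W * u - 2 * u ^+ 2 = (W - 2 * u) * u by ring.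
  have un : `|u| <= u by rewrite gtr0_norm.
  apply: le_trans (normM_le en (normM_le (lexx m) (normM_le Wu2 un))) _.
  have -> : (1 + C) / u * (m * (5 * u ^+ 2 * u)) = 5 * (1 + C) * (m * u ^+ 2).
    by field; rewrite gt_eqF.
  rewrite ler_wpM2l ?mulr_ge0 ?addr_ge0 // ler_wpM2r //.
  by have := sqr_ge0 m; lra.
have T3 : `|e ^+ 2 * (u ^+ 2 * W)| <= 2 * C * ((1 + m) ^+ 2 * u ^+ 2).
  have e2 : `|e ^+ 2| <= C / u by rewrite ger0_norm ?sqr_ge0.
  have un : `|u ^+ 2| <= u ^+ 2 by rewrite ger0_norm.
  apply: le_trans (normM_le e2 (normM_le un Wn)) _.
  have -> : C / u * (u ^+ 2 * (2 * u)) = 2 * C * (1 * u ^+ 2) by field; rewrite gt_eqF.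
  rewrite ler_wpM2l ?mulr_ge0 // ler_wpM2r //.
  by have := sqr_ge0 m; lra.
have T4 : `|E * (2 * l * u ^+ 2 - 2 * (l + h) * (u ^+ 2 - u ^+ 2 * W))| <=
    6 * B * ((1 + m) ^+ 2 * u ^+ 2).
  have -> : 2 * l * u ^+ 2 - 2 * (l + h) * (u ^+ 2 - u ^+ 2 * W) =
    2 * u ^+ 2 * (l * W - h + h * W) by ring.
  have un : `|2 * u ^+ 2| <= 2 * u ^+ 2 by rewrite (ger0_norm (mulr_ge0 (ler0n R 2) u2)).
  have Q : `|l * W - h + h * W| <= (2 * m + 3) * u.
    have q1 := normM_le (lexx m) Wn; have q2 := normM_le hn Wn.
    have q3 : u * u <= u * 1 by rewrite ler_pM2l.
    apply: le_trans (ler_normD _ _) _.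
    by apply: le_trans (lerD (ler_normB _ _) (lexx _)) _; lra.
  apply: le_trans (normM_le EB (normM_le un Q)) _.
  have -> : B / u * (2 * u ^+ 2 * ((2 * m + 3) * u)) = 2 * B * ((2 * m + 3) * u ^+ 2).
    by field; rewrite gt_eqF.
  have -> : 6 * B * ((1 + m) ^+ 2 * u ^+ 2) = 2 * B * (3 * (1 + m) ^+ 2 * u ^+ 2) by ring.
  rewrite ler_wpM2l ?mulr_ge0 // ler_wpM2r //.
  by have := sqr_ge0 m; lra.
move: T1 T2 T3 T4; move: ((1 + m) ^+ 2 * u ^+ 2) => p.
move: (l ^+ 2 * W - _) (e * _) (e ^+ 2 * _) (E * _) => x y z t; clear.
rewrite !ler_norml => /andP[? ?] /andP[? ?] /andP[? ?] /andP[? ?].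
by apply/andP; split; lra.
Qed.

(** The [k] with [n %/ k = v] fill the interval from [n / v.+1] to [n / v], so their sum is about
    [n^2 / 2] times this gap. *)
Definition inv_sqr_gap v : R := (v%:R ^+ 2)^-1 - (v.+1%:R ^+ 2)^-1.

Definition square_sum X : R :=
  \sum_(1 <= v < X) (divisor_sum v)%:R ^+ 2 * inv_sqr_gap v.

Lemma inv_sqr_gap_bounds (x h : R) : 1 <= x -> (x + 1)^-1 <= h <= x^-1 ->
  let W := x ^+ 2 * ((x ^+ 2)^-1 - ((x + 1) ^+ 2)^-1) in
  [/\ 0 <= W <= 2 * x^-1, `|W - 2 * h| <= 3 * x^-1 ^+ 2 & `|W - 2 * x^-1| <= 5 * x^-1 ^+ 2].
Proof.
move=> x1 /andP[h1 h2] W; have x0 : 0 < x by lra. have y0 : 0 < x + 1 by lra.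
pose u := x^-1; pose v := (x + 1)^-1.
have u0 : 0 < u by rewrite invr_gt0. have v0 : 0 < v by rewrite invr_gt0.
have vu : v <= u by rewrite lef_pV2 ?posrE //; lra.
have WE : W = 2 * v - v ^+ 2.
  by rewrite /W /v; field; rewrite !gt_eqF.
have uv : u - v = u * v by rewrite /u /v; field; rewrite !gt_eqF.
have v1 : v <= 1 by rewrite invf_le1 //; lra.
have vv : v ^+ 2 <= u ^+ 2 by rewrite lerXn2r ?nnegrE // ltW.
have uv2 : u * v <= u ^+ 2 by rewrite expr2 ler_pM2l.
have v2 : 0 <= v ^+ 2 by rewrite sqr_ge0.
have vv1 : v ^+ 2 <= v * 1 by rewrite expr2 ler_pM2l.
rewrite WE -/u; rewrite -/u in h2; rewrite -/v in h1.
move: (v ^+ 2) (u ^+ 2) (u * v) vv uv2 v2 vv1 uv => p q r *.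
by rewrite !ler_norml; split; apply/andP; split; lra.
Qed.

(** With [D(v) = v * l + e] the summand is nearly [2 * l^2 / v + 4 * l * e / v^2]. The first part
    integrates to [2 / 3 * l^3]. The second, bounded pointwise, would only give a rate near
    [X^(-1/2)]; it is summed by parts through [divisor_error_sum], which restores a rate near
    [X^(-1)]. *)
Lemma square_sum_rate d : 0 < d -> 3 * d < 1 -> exists j, exists2 C : R, 0 < C &
  forall X, (0 < X)%N ->
  `|square_sum X - 2 / 3 * (ln X%:R + c) ^+ 3 - j| <= C * X%:R `^ (- (1 - 3 * d)).
Proof.
move=> d0 d1.
have [C1 C10 hC1] := divisor_error_sqr R.
have [C2 C20 hC2] := divisor_error_sum d0.
have [C3 C30 hC3] := ln_le_powR d0.
pose l X : R := ln X%:R + c.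
pose K := C3 + `|c| + 1; have K0 : 0 < K by rewrite /K; have := normr_ge0 c; lra.
have lK X : (0 < X)%N -> 1 + `|l X| <= K * X%:R `^ d.
  move=> X0; have X1 : 1 <= X%:R :> R by rewrite ler1n.
  have := ler_normD (ln X%:R) c; rewrite -/(l X) (ger0_norm (ln_ge0 X1)).
  have := hC3 _ X1; have := powR_ge1 X1 (ltW d0); rewrite /K.
  move: (X%:R `^ d) => p p1 h1 h2.
  have : `|c| * 1 <= `|c| * p by rewrite ler_wpM2l.
  lra.
pose E X := \sum_(1 <= v < X) divisor_error R v 1.
(* [2 * g X] is to leading order the coefficient of the divisor error in the increment of
   [square_sum], so [2 * (g X * E X)] is its boundary term in the summation by parts. *)
pose g X : R := 2 * l X * X%:R^-1 ^+ 2.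
pose s X := square_sum X - 2 / 3 * l X ^+ 3 - 2 * (g X * E X).
pose B0 := C2 * 2 `^ (1 + d).
have B00 : 0 < B0 by rewrite mulr_gt0 ?powR_gt0.
have step X : (0 < X)%N -> `|s X.+1 - s X| <=
    ((16 + 12 * C1 + 12 * B0) * K ^+ 2) * X%:R `^ (- (1 + (1 - 3 * d))).
  move=> X0; have X1 : 1 <= X%:R :> R by rewrite ler1n.
  have X0' : 0 < X%:R :> R by rewrite ltr0n.
  set x : R := X%:R in X0' X1 *; pose u := x^-1.
  have u0 : 0 < u by rewrite invr_gt0.
  have u1 : u <= 1 by rewrite invf_le1.
  pose h := ln (x + 1) - ln x.
  have hb : (x + 1)^-1 <= h <= x^-1.
    by have := ln_succ_bounds R X0; rewrite -natr1.
  have := inv_sqr_gap_bounds X1 hb.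
  set W := x ^+ 2 * _ => -[Wb Wh Wu].
  have hu : 0 <= h <= u.
    by case/andP: hb => h1 h2; rewrite h2 andbT (le_trans _ h1) // invr_ge0; lra.
  have p1 := powR_ge1 X1 (ltW d0).
  have eC : divisor_error R X 1 ^+ 2 <= C1 / u.
    by have := hC1 X 1%N; rewrite X0 divr1 /u invrK; apply.
  have EB : `|E X.+1| <= (B0 * x `^ d) / u.
    apply: le_trans (hC2 X.+1 _) _ => //; rewrite /u invrK /B0 -!mulrA ler_pM2l //.
    have -> : x `^ d * x = x `^ (1 + d) by rewrite -powR_addE // powRr1 ?(ltW X0') // mulrC.
    rewrite -powRM ?(ltW X0') // ge0_ler_powR ?nnegrE ?mulr_ge0 ?succ_le_double ?(ltW X0') //.
    lra.
  have Bp : 0 <= B0 * x `^ d by rewrite mulr_ge0 ?powR_ge0 // ltW.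
  have := square_sum_increment (l X) u0 u1 hu Wb Wh Wu (ltW C10) eC Bp EB.
  have -> : s X.+1 - s X = l X ^+ 2 * W - 2 / 3 * ((l X + h) ^+ 3 - l X ^+ 3) +
      2 * (divisor_error R X 1 * (l X * (W * u - 2 * u ^+ 2))) +
      divisor_error R X 1 ^+ 2 * (u ^+ 2 * W) +
      2 * (E X.+1 * (2 * l X * u ^+ 2 - 2 * (l X + h) * (u ^+ 2 - u ^+ 2 * W))).
    have lS : l X.+1 = l X + h by rewrite /l /h -[X.+1%:R]natr1 -/x; ring.
    have ES : E X.+1 = E X + divisor_error R X 1 by rewrite /E big_nat_recr.
    have DE : (divisor_sum X)%:R = x * l X + divisor_error R X 1.
      by rewrite /divisor_error divn1 divr1 -/x /l; ring.
    rewrite /s /square_sum big_nat_recr //= DE /inv_sqr_gap -[X.+1%:R]natr1 -/x lS.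
    have -> : E X = E X.+1 - divisor_error R X 1 by rewrite ES addrK.
    have uW : u ^+ 2 * W = (x ^+ 2)^-1 - ((x + 1) ^+ 2)^-1.
      by rewrite /u /W exprVn mulKf // expf_neq0 ?gt_eqF.
    have gS : g X.+1 = 2 * (l X + h) * (u ^+ 2 - u ^+ 2 * W).
      by rewrite /g lS uW -[X.+1%:R]natr1 -/x /u !exprVn; ring.
    rewrite gS /g -/x -/u -uW.
    move: (\sum_(_ <= _ < _) _) (E X.+1) (divisor_error R X 1) (l X) => S F e y.
    have ux : u * x = 1 by rewrite /u mulVf ?gt_eqF.
    have -> : (x * y + e) ^+ 2 * (u ^+ 2 * W) =
      (u * x) ^+ 2 * y ^+ 2 * W + 2 * ((u * x) * (e * (y * (W * u)))) + e ^+ 2 * (u ^+ 2 * W).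
      by ring.
    by rewrite ux; ring.
  move/le_trans; apply.
  have ->: - (1 + (1 - 3 * d)) = d + (2 * d + - 2) by ring.
  have -> : x `^ (d + (2 * d + - 2)) = x `^ d * ((x `^ d) ^+ 2 * u ^+ 2).
    rewrite -!powR_addE // (mulrC 2 d) (powRrM x d 2) powR_mulrn ?powR_ge0 //.
    by rewrite powR_invn ?(ltW X0') // exprVn.
  move: (x `^ d) p1 (lK X X0) => p p1; rewrite -/x => m1.
  have m2 : (1 + `|l X|) ^+ 2 <= K ^+ 2 * p ^+ 2.
    rewrite -exprMn lerXn2r ?nnegrE ?addr_ge0 // mulr_ge0 // ?(ltW K0) //; lra.
  have -> : (16 + 12 * C1 + 12 * B0) * K ^+ 2 * (p * (p ^+ 2 * u ^+ 2)) =
     ((16 + 12 * C1 + 12 * B0) * p) * (K ^+ 2 * p ^+ 2 * u ^+ 2) by ring.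
  have c1 : 0 <= (p - 1) * (16 + 12 * C1) by rewrite mulr_ge0 ?subr_ge0 ?addr_ge0 ?mulr_ge0 // ltW.
  have b1 : 0 <= B0 * p by rewrite mulr_ge0 ?(ltW B00) //; lra.
  apply: ler_pM.
  - by move: b1 (ltW C10); clear; lra.
  - by rewrite mulr_ge0 ?sqr_ge0.
  - by move: c1; clear; lra.
  - by rewrite ler_wpM2r ?sqr_ge0.
have d1' : 0 < 1 - 3 * d by lra.
have [j [C C0 hC]] := rate_limit d1' step.
exists j, (C + 4 * (K * B0)) => [|X X0]; first by rewrite addr_gt0 // !mulr_gt0.
have X1 : 1 <= X%:R :> R by rewrite ler1n.
have X0' : 0 < X%:R :> R by rewrite ltr0n.
have -> : square_sum X - 2 / 3 * (ln X%:R + c) ^+ 3 - j = (s X - j) + 2 * (g X * E X).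
  by rewrite /s -/(l X); ring.
apply: le_trans (ler_normD _ _) _; rewrite [leRHS]mulrDl lerD ?hC //.
rewrite normrM ger0_norm //.
have -> : 4 * (K * B0) * X%:R `^ (- (1 - 3 * d)) =
  2 * (2 * (K * B0 * X%:R `^ (- (1 - 3 * d)))) by ring.
rewrite ler_pM2l //.
have l1 : `|l X| <= K * X%:R `^ d by have := lK X X0; lra.
have un : `|X%:R^-1 ^+ 2| <= X%:R^-1 ^+ 2 :> R by rewrite ger0_norm // exprn_ge0 ?invr_ge0.
have hE : `|E X| <= B0 * X%:R `^ (1 + d).
  apply: le_trans (hC2 X X0) _; rewrite ler_wpM2r ?powR_ge0 // /B0 ler_peMr ?(ltW C20) //.
  by rewrite powR_ge1 ?ler1n //; lra.
have -> : g X * E X = 2 * (l X * X%:R^-1 ^+ 2 * E X) by rewrite /g; ring.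
rewrite normrM ger0_norm // ler_pM2l //.
apply: le_trans (normM_le (normM_le l1 un) hE) _.
have -> : K * X%:R `^ d * X%:R^-1 ^+ 2 * (B0 * X%:R `^ (1 + d)) =
  K * B0 * (X%:R `^ d * X%:R^-1 ^+ 2 * X%:R `^ (1 + d)) by ring.
rewrite ler_pM2l ?mulr_gt0 //.
have -> : X%:R^-1 ^+ 2 = X%:R `^ (- 2%:R) :> R by rewrite powR_invn ?ler0n // exprVn.
by rewrite !powR_addE // ler_powR //; lra.
Qed.

End SquareSum.

(** * The cross term *)

Section WeightedError.
Variable R : realType.
Implicit Types (n a q N v X k : nat) (w d : R).

Local Notation c := (2 * stieltjes R 0 - 1).
Local Notation third := (1 / 3 : R).

(** Summation by parts: the induction carries the sum minus [g j.-1 * S j], which grows by at most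
    [M] times each drop of [g]. *)
Lemma abel_monotone (f g : nat -> R) (M : R) p q : (p < q)%N ->
  (forall k, (p <= k < q)%N -> 0 <= g k) ->
  (forall k, (p <= k)%N -> (k.+1 < q)%N -> g k.+1 <= g k) ->
  (forall j, (p <= j <= q)%N -> `|\sum_(p <= k < j) f k| <= M) ->
  `|\sum_(p <= k < q) g k * f k| <= g p * M.
Proof.
move=> pq g0 gd fM.
have M0 : 0 <= M by apply: le_trans (fM p _); rewrite ?leqnn ?(ltnW pq).
pose S j := \sum_(p <= k < j) f k.
suff H j : (p < j <= q)%N ->
    `|\sum_(p <= k < j) g k * f k - g j.-1 * S j| <= (g p - g j.-1) * M.
  have := H q; rewrite pq leqnn => /(_ isT) h.
  have q0 : (0 < q)%N := leq_ltn_trans (leq0n p) pq.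
  have gq : 0 <= g q.-1 by apply: g0; rewrite ltn_predL q0 andbT -ltnS prednK.
  have -> : \sum_(p <= k < q) g k * f k =
     (\sum_(p <= k < q) g k * f k - g q.-1 * S q) + g q.-1 * S q by rewrite subrK.
  apply: le_trans (ler_normD _ _) _.
  have -> : g p * M = (g p - g q.-1) * M + g q.-1 * M by ring.
  apply: lerD => //; rewrite normrM (ger0_norm gq) ler_wpM2l //.
  by apply: fM; rewrite leqnn ltnW.
elim: j => // j IH /andP[pj jq]; rewrite /= /S.
have [pj'|pj'] := ltnP p j; last first.
  have -> : j = p by apply/eqP; rewrite eqn_leq pj' -ltnS.
  by rewrite !big_nat1 !subrr normr0 mul0r.
have {}IH := IH (introT andP (conj pj' (ltnW jq))).
rewrite (big_nat_recr j) ?(ltnW pj') //= (big_nat_recr j p (fun k => f k)) ?(ltnW pj') //=.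
have jE : j = j.-1.+1 by rewrite prednK // (leq_ltn_trans _ pj').
have gj : g j <= g j.-1.
  by rewrite {1}jE; apply: gd; rewrite -?jE // -ltnS -jE.
have -> : \sum_(p <= k < j) g k * f k + g j * f j - g j * (\sum_(p <= k < j) f k + f j) =
   (\sum_(p <= k < j) g k * f k - g j.-1 * S j) + (g j.-1 - g j) * S j by rewrite /S; ring.
apply: le_trans (ler_normD _ _) _.
have -> : (g p - g j) * M = (g p - g j.-1) * M + (g j.-1 - g j) * M by ring.
apply: lerD => //; rewrite normrM ger0_norm ?subr_ge0 // ler_wpM2l ?subr_ge0 //.
by apply: fM; rewrite (ltnW pj') (ltnW jq).
Qed.

Lemma powR_div (x y e : R) : 0 < x -> 0 < y -> (x / y) `^ e = x `^ e * y `^ (- e).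
Proof.
move=> x0 y0; rewrite powRM ?invr_ge0 ?(ltW x0) ?(ltW y0) //; congr (_ * _).
by rewrite -(powR_inv1 (ltW y0)) -powRrM mulN1r.
Qed.

Lemma cube_root_cube (x : R) : 0 <= x -> (x `^ third) ^+ 3 = x.
Proof.
by move=> x0; rewrite -powR_mulrn ?powR_ge0 // -powRrM -mulrA mulVf ?mulr1 ?powRr1.
Qed.

Lemma sum_cube_root : exists2 C : R, 0 < C & forall n N, (0 < n)%N ->
  \sum_(1 <= k < N) (n%:R / k%:R) `^ third <= C * (n%:R `^ third * N%:R `^ (2 / 3)).
Proof.
have d0 : 0 < 2 / 3 :> R by rewrite divr_gt0.
have [C C0 hC] := sum_powR_le d0; exists C => // n N n0.
have n0' : 0 < n%:R :> R by rewrite ltr0n.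
rewrite mulrCA; apply: le_trans (_ : n%:R `^ third * \sum_(1 <= k < N) k%:R `^ (2 / 3 - 1) <= _).
  rewrite mulr_sumr !big_seq; apply: ler_sum => k; rewrite mem_index_iota => /andP[k0 _].
  have -> : 2 / 3 - 1 = - third by field.
  by rewrite powR_div ?ltr0n.
by rewrite ler_pM2l ?powR_gt0.
Qed.

Lemma log_weight_le d : 0 < d -> exists2 K : R, 0 < K & forall n k, (0 < k <= n)%N ->
  [/\ 0 <= ln (n%:R / k%:R : R), ln (n%:R / k%:R) <= K * n%:R `^ d
    & `|ln (n%:R / k%:R) + c| <= K * n%:R `^ d].
Proof.
move=> d0; have [C C0 hC] := ln_le_powR d0.
exists (C + `|c|) => [|n k /andP[k0 kn]]; first by have := normr_ge0 c; lra.
have k0' : 0 < k%:R :> R by rewrite ltr0n.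
have n0 : (0 < n)%N := leq_trans k0 kn.
have n1 : 1 <= n%:R :> R by rewrite ler1n.
have h1 : 1 <= n%:R / k%:R :> R by rewrite ler_pdivlMr // mul1r ler_nat.
have l0 := ln_ge0 h1.
have h2 : ln (n%:R / k%:R) <= C * n%:R `^ d.
  apply: le_trans (hC _ n1); rewrite ler_ln ?posrE ?divr_gt0 ?ltr0n //.
  by rewrite ler_pdivrMr // ler_peMr // ler1n.
have p1 := powR_ge1 n1 (ltW d0).
have c1 : `|c| * 1 <= `|c| * n%:R `^ d by rewrite ler_wpM2l.
split=> //; rewrite [leRHS](mulrDl C); first by have := normr_ge0 c; lra.
apply: le_trans (ler_normD _ _) _; rewrite (ger0_norm l0); apply: lerD => //.
by rewrite -[leLHS]mulr1.
Qed.

Section Fixed.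
Variables (d K C1 C2 : R) (n z : nat).
Hypotheses (d0 : 0 < d) (n0 : (0 < n)%N) (K0 : 0 < K) (C10 : 0 < C1) (C20 : 0 < C2).
Let y : R := n%:R.
Hypothesis hz : 64 * z.+1%:R <= y `^ (4 / 9).
Hypothesis hK : forall k, (0 < k <= n)%N ->
  [/\ 0 <= ln (y / k%:R), ln (y / k%:R) <= K * y `^ d & `|ln (y / k%:R) + c| <= K * y `^ d].
Hypothesis hC1 : forall a N w, (0 < n)%N -> (0 < a)%N -> 1 <= w -> w ^+ 3 = y / a%:R ->
  N%:R * N%:R <= 4 * w ^+ 3 ->
  `|\sum_(1 <= k < N) sawtooth R n (a * k)| <= C1 * w * N%:R `^ d.
Hypothesis hC2 : forall a N w, (0 < n)%N -> (0 < a)%N -> 1 <= w -> w ^+ 3 = y / a%:R ->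
  32 * N%:R <= w ^+ 2 ->
  `|\sum_(1 <= k < N) sawtooth R n (a * k)| <= C2 * w * N%:R `^ d.

Let y1 : 1 <= y. Proof. by rewrite ler1n. Qed.
Let y0 : 0 < y. Proof. by rewrite ltr0n. Qed.
Let yd1 : 1 <= y `^ d. Proof. exact: powR_ge1 y1 (ltW d0). Qed.

Let root_ge1 k : (0 < k <= n)%N -> 1 <= (y / k%:R) `^ third.
Proof.
move=> /andP[k0 kn]; apply: powR_ge1; last by rewrite divr_ge0.
by rewrite ler_pdivlMr ?ltr0n // mul1r ler_nat.
Qed.

Let root_cube k : ((y / k%:R) `^ third) ^+ 3 = y / k%:R.
Proof. by rewrite cube_root_cube // divr_ge0 // ltW. Qed.

Let zn : (z.+1 <= n)%N.
Proof.
rewrite -(ler_nat R); have : y `^ (4 / 9) <= y `^ 1 by rewrite ler_powR //; lra.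
rewrite powRr1 ?(ltW y0) // -/y => h; have : 0 <= z.+1%:R :> R by [].
by move: hz h; lra.
Qed.

(** For fixed [k] the variable [a] runs up to about [(y / k)^(1/2)], the range allowed by the
    square-root form of the sawtooth bound. *)
Lemma sawtooth_short_rows k : (0 < k <= n)%N ->
  `|\sum_(1 <= a < n.+1 | (a * a * k <= n)%N) sawtooth R n (k * a)|
    <= C1 * 2 `^ d * y `^ d * (y / k%:R) `^ third.
Proof.
move=> kn; have /andP[k0 kn'] := kn; have [u hu] := sqrt_exists (n %/ k).
rewrite (big_sqrt_range _ _ k0 hu).
have u0 : (0 < u)%N.
  have : (0 < n %/ k)%N by rewrite divn_gt0.
  by rewrite lt0n; case: (u) hu => // /andP[_]; rewrite muln1 ltnS leqn0 => ->.
have nk : u%:R * u%:R <= y / k%:R.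
  have [h _] := natr_div_bounds R n k0; apply: le_trans h.
  by rewrite -natrM ler_nat; case/andP: hu.
apply: le_trans (hC1 n0 k0 (root_ge1 kn) (root_cube k) _) _.
  rewrite root_cube; apply: le_trans (_ : (2 * u%:R) * (2 * u%:R) <= _).
    by apply: ler_pM => //; exact: succ_le_double.
  by rewrite mulrACA; apply: ler_pM => //; rewrite ?mulr_ge0 // -natrM ler_nat.
have h : u.+1%:R `^ d <= 2 `^ d * y `^ d.
  rewrite -powRM ?(ltW y0) // ge0_ler_powR ?nnegrE ?(ltW d0) ?mulr_ge0 ?(ltW y0) //.
  apply: le_trans (succ_le_double R u0) _; rewrite ler_pM2l // ler_nat.
  by case/andP: hu => hu _; apply: leq_trans (leq_trans hu (leq_div _ _)); rewrite leq_pmulr.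
have -> : C1 * 2 `^ d * y `^ d * (y / k%:R) `^ third =
  C1 * (y / k%:R) `^ third * (2 `^ d * y `^ d) by ring.
by rewrite ler_wpM2l // mulr_ge0 ?powR_ge0 // ltW.
Qed.

(** A row with [a] fixed is non-empty only if [a^2 * p.+1 <= n], which with [p.+1 > y^(1/3)] forces
    [a <= y^(1/3)]. Then [w = (y / a)^(1/3)] satisfies [w^2 >= y^(4/9)], which is where the bound on
    [z] comes from. The logarithm is non-negative and decreasing, so Abel summation removes it; the
    constant is summed apart. *)
Lemma sawtooth_long_rows a p : (0 < a)%N -> (p <= z)%N ->
  ((p < z)%N -> y `^ third < p.+1%:R) ->
  `|\sum_(p.+1 <= k < z.+1 | (a * a * k <= n)%N) (ln (y / k%:R) + c) * sawtooth R n (k * a)|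
    <= if a%:R <= y `^ third then 2 * (K + `|c|) * C2 * (y `^ d) ^+ 2 * (y / a%:R) `^ third else 0.
Proof.
move=> a0 pz pr; have aa0 : (0 < a * a)%N by rewrite muln_gt0 a0.
have a0' : 0 < a%:R :> R by rewrite ltr0n.
pose T := minn z.+1 (n %/ (a * a)).+1.
have -> : \sum_(p.+1 <= k < z.+1 | (a * a * k <= n)%N) (ln (y / k%:R) + c) * sawtooth R n (k * a)
  = \sum_(p.+1 <= k < T) (ln (y / k%:R) * sawtooth R n (a * k) + c * sawtooth R n (a * k)).
  rewrite [RHS](big_nat_widen _ _ z.+1) ?geq_minl //.
  rewrite [LHS]big_nat_cond [RHS]big_nat_cond; apply: eq_big => [k|k _]; last by rewrite mulrDl mulnC.
  rewrite /=; apply: andb_id2l => /andP[_ kz].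
  by rewrite leq_min kz ltnS leq_divRL // mulnC.
have [Tp|pT] := leqP T p.+1.
  rewrite big_geq // normr0; case: ifP => // _.
  by rewrite !mulr_ge0 ?addr_ge0 ?exprn_ge0 ?powR_ge0 // ltW.
have pz' : (p < z)%N by move: pT; rewrite leq_min ltnS => /andP[].
have pr' := pr pz'.
have ap : (a * a * p.+1 <= n)%N.
  by move: pT; rewrite leq_min !ltnS => /andP[_]; rewrite leq_divRL // mulnC.
set r := y `^ third in pr' *.
have r3 : r ^+ 3 = y by rewrite cube_root_cube // ltW.
have r1 : 1 <= r by apply: powR_ge1 => //; lra.
have r0 : 0 < r by lra.
have ar : a%:R <= r.
  have h : (a%:R * a%:R) * r <= r ^+ 3.
    rewrite r3; apply: le_trans (_ : (a%:R * a%:R) * p.+1%:R <= _).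
      by rewrite ler_wpM2l ?mulr_ge0 // ltW.
    by rewrite -!natrM ler_nat.
  by move: h; rewrite exprSr ler_pM2r // -expr2 ler_pXn2r ?nnegrE // ltW.
rewrite ar.
have an : (0 < a <= n)%N.
  rewrite a0 -(ler_nat R); apply: le_trans ar _.
  by rewrite -[leRHS]powRr1 ?(ltW y0) // ler_powR //; lra.
set w := (y / a%:R) `^ third.
have w1 : 1 <= w := root_ge1 an.
have w3 : w ^+ 3 = y / a%:R := root_cube a.
have w0 : 0 < w by lra.
have wr : y `^ (4 / 9) <= w ^+ 2.
  have h : y `^ (2 / 3) <= y / a%:R.
    rewrite ler_pdivlMr // -[leRHS](powRr1 (ltW y0)).
    have -> : y `^ 1 = y `^ (2 / 3) * y `^ third by rewrite powR_addE //; congr (_ `^ _); field.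
    by rewrite ler_pM2l ?powR_gt0.
  have -> : w ^+ 2 = (y / a%:R) `^ (2 / 3).
    by rewrite -powR_mulrn ?powR_ge0 // -powRrM; congr (_ `^ _); field.
  have -> : 4 / 9 = 2 / 3 * (2 / 3) :> R by field.
  by rewrite powRrM ge0_ler_powR ?nnegrE ?powR_ge0 ?divr_ge0 // ltW.
pose M := C2 * w * y `^ d.
have M0 : 0 <= M by rewrite !mulr_ge0 ?powR_ge0 // ltW.
have SM j : (j <= z.+1)%N -> `|\sum_(1 <= k < j) sawtooth R n (a * k)| <= M.
  move=> jz; apply: le_trans (hC2 n0 a0 w1 w3 _) _.
    have h1 : j%:R <= z.+1%:R :> R by rewrite ler_nat.
    have h2 : 0 <= z.+1%:R :> R by [].
    by move: hz wr h1 h2; lra.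
  rewrite /M ler_wpM2l ?mulr_ge0 ?(ltW w0) ?(ltW C20) //.
  by rewrite ge0_ler_powR ?nnegrE ?(ltW d0) ?(ltW y0) // ler_nat (leq_trans jz).
have PM j : (p.+1 <= j <= T)%N -> `|\sum_(p.+1 <= k < j) sawtooth R n (a * k)| <= 2 * M.
  move=> /andP[pj jT].
  have -> : \sum_(p.+1 <= k < j) sawtooth R n (a * k) =
    \sum_(1 <= k < j) sawtooth R n (a * k) - \sum_(1 <= k < p.+1) sawtooth R n (a * k).
    by rewrite [X in _ = X - _](@big_cat_nat _ _ _ p.+1) //= addrC addrK.
  apply: le_trans (ler_normB _ _) _.
  have jz : (j <= z.+1)%N by apply: leq_trans jT (geq_minl _ _).
  by have := SM j jz; have := SM p.+1 (leq_trans pj jz); lra.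
have kn k : (p.+1 <= k < T)%N -> (0 < k <= n)%N.
  move=> /andP[pk kT]; rewrite (leq_trans _ pk) //=.
  by apply: leq_trans zn; apply: ltnW; apply: leq_trans kT (geq_minl _ _).
rewrite big_split /= -mulr_sumr; apply: le_trans (ler_normD _ _) _.
have A1 : `|\sum_(p.+1 <= k < T) ln (y / k%:R) * sawtooth R n (a * k)| <=
    K * y `^ d * (2 * M).
  apply: le_trans (abel_monotone (g := fun k => ln (y / k%:R)) pT _ _ PM) _.
  - by move=> k /kn/hK[].
  - move=> k pk kT.
    have k0 : (0 < k)%N by apply: leq_trans pk.
    rewrite ler_ln ?posrE ?divr_gt0 ?ltr0n // ler_pM2l // lef_pV2 ?posrE ?ltr0n //.
    by rewrite ler_nat.
  - have [_ h _] := hK (kn p.+1 (introT andP (conj (leqnn _) pT))).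
    by rewrite ler_wpM2r // mulr_ge0.
have A2 : `|c * \sum_(p.+1 <= k < T) sawtooth R n (a * k)| <= `|c| * (2 * M) * y `^ d.
  rewrite normrM -[leLHS]mulr1; apply: ler_pM => //.
  by rewrite ler_wpM2l // PM // leqnn ltnW.
apply: le_trans (lerD A1 A2) _; rewrite /M -/w le_eqVlt; apply/orP; left; apply/eqP.
by ring.
Qed.

End Fixed.

Lemma sum_cube_root_short : exists2 C : R, 0 < C & forall n N, (0 < n)%N ->
  N%:R <= 2 * n%:R `^ third -> \sum_(1 <= k < N) (n%:R / k%:R) `^ third <= C * n%:R `^ (5 / 9).
Proof.
have [C C0 hC] := sum_cube_root; exists (C * 2 `^ (2 / 3)) => [|n N n0 hN].
  by rewrite mulr_gt0 ?powR_gt0.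
have n0' : 0 < n%:R :> R by rewrite ltr0n.
apply: le_trans (hC n N n0) _; rewrite -mulrA ler_pM2l //.
have -> : 5 / 9 = third + third * (2 / 3) :> R by field.
rewrite -powR_addE // powRrM [leRHS]mulrCA ler_pM2l ?powR_gt0 //.
rewrite -powRM ?powR_ge0 // ge0_ler_powR ?nnegrE ?mulr_ge0 ?powR_ge0 ?divr_ge0 //.
Qed.

(** The inner sum is over [a] for [k <= n^(1/3)] and over [k] beyond. Either way there are at most
    about [n^(1/3)] rows, the [i]-th worth about [(n / i)^(1/3)]: in total
    [n^(1/3 + 2/9) = n^(5/9)]. *)
Lemma weighted_error_sum d : 0 < d -> exists2 C : R, 0 < C & forall n z, (0 < n)%N ->
  64 * z.+1%:R <= n%:R `^ (4 / 9 : R) ->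
  `|\sum_(1 <= k < z.+1) (ln (n%:R / k%:R : R) + c) * divisor_error R n k|
    <= C * n%:R `^ (5 / 9 + 2 * d).
Proof.
move=> d0.
have [K K0 hK] := log_weight_le d0.
have [C1 C10 hC1] := sawtooth_sum_sqrt d0.
have [C2 C20 hC2] := sawtooth_sum d0.
have [C3 C30 hC3] := sum_cube_root_short.
have [C4 C40 hC4] := divisor_sum_sawtooth R.
have [V V0 VE] : exists2 V, 0 < V & V = 2 * (K + `|c|) * C2.
  by exists (2 * (K + `|c|) * C2); rewrite // !mulr_gt0 // ltr_wpDr.
exists (K * C4 + 2 * (K * (C1 * 2 `^ d) * C3) + 2 * (V * C3)) => [|n z n0 hz].
  by rewrite !addr_gt0 // !mulr_gt0 ?powR_gt0.
set y : R := n%:R in hz *.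
have y1 : 1 <= y by rewrite ler1n.
have y0 : 0 < y by rewrite ltr0n.
have y49 : y `^ (4 / 9) <= y by rewrite -[leRHS]powRr1 ?(ltW y0) // ler_powR //; lra.
have zy : z%:R <= y `^ (5 / 9).
  apply: le_trans (_ : y `^ (4 / 9) <= _); last by rewrite ler_powR //; lra.
  by apply: le_trans hz; rewrite -natr1; have : 0 <= z%:R :> R by []; lra.
have zn k : (0 < k < z.+1)%N -> (0 < k <= n)%N.
  move=> /andP[k0 kz]; rewrite k0 -(ler_nat R) -/y; apply: le_trans y49.
  apply: le_trans hz; apply: le_trans (_ : z.+1%:R <= _); first by rewrite ler_nat ltnW.
  by rewrite ler_peMl //; lra.
have yd1 := powR_ge1 y1 (ltW d0).
have Ey : y `^ (5 / 9 + 2 * d) = (y `^ d) ^+ 2 * y `^ (5 / 9).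
  by rewrite -powR_addE // mulrC; congr (_ * _); rewrite mulrC powRrM powR_mulrn ?powR_ge0.
pose S k := \sum_(1 <= a < n.+1 | (a * a * k <= n)%N) sawtooth R n (k * a).
pose W k := ln (y / k%:R) + c.
have -> : \sum_(1 <= k < z.+1) W k * divisor_error R n k =
  \sum_(1 <= k < z.+1) W k * (divisor_error R n k + 2 * S k) - 2 * \sum_(1 <= k < z.+1) W k * S k.
  by rewrite mulr_sumr -sumrB; apply: eq_bigr => k _; ring.
have B1 : `|\sum_(1 <= k < z.+1) W k * (divisor_error R n k + 2 * S k)| <=
    K * C4 * y `^ (5 / 9 + 2 * d).
  apply: le_trans (ler_norm_sum _ _ _) _.
  apply: le_trans (_ : \sum_(1 <= k < z.+1) K * y `^ d * C4 <= _).
    rewrite !big_seq; apply: ler_sum => k; rewrite mem_index_iota => /zn kn.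
    by apply: normM_le; [have [] := hK n k kn | exact: hC4].
  rewrite sumr_const_nat subn1 -[leLHS]mulr_natr Ey /=.
  have -> : K * y `^ d * C4 * z%:R = K * C4 * (y `^ d * z%:R) by ring.
  rewrite ler_pM2l ?mulr_gt0 //; apply: ler_pM => //; first exact: powR_ge0.
  by rewrite expr2 ler_peMr // powR_ge0.
pose r := y `^ third; have r1 : 1 <= r by apply: powR_ge1 => //; lra.
have r0 : 0 <= r by lra.
pose t := Num.truncn r; have /andP[t1 t2] := truncn_itv r0; rewrite -/t in t1 t2.
have t3 : t.+1%:R <= 2 * r by rewrite -natr1; lra.
(* If [z] lies below [n^(1/3)], all rows are short. *)
pose p := minn z t.
have p3 : p.+1%:R <= 2 * r by apply: le_trans t3; rewrite ler_nat ltnS geq_minr.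
have pz : (p <= z)%N by exact: geq_minl.
have B2 : `|\sum_(1 <= k < p.+1) W k * S k| <= K * (C1 * 2 `^ d) * C3 * y `^ (5 / 9 + 2 * d).
  apply: le_trans (ler_norm_sum _ _ _) _.
  apply: le_trans (_ : \sum_(1 <= k < p.+1)
     K * y `^ d * (C1 * 2 `^ d * y `^ d * (y / k%:R) `^ third) <= _).
    rewrite !big_seq; apply: ler_sum => k; rewrite mem_index_iota => /andP[k0 kp].
    have kn : (0 < k <= n)%N by apply: zn; rewrite k0 (leq_trans kp).
    apply: normM_le; first by have [] := hK n k kn.
    by apply: sawtooth_short_rows kn => // *; apply: hC1.
  rewrite -mulr_sumr -mulr_sumr Ey.
  have -> : K * (C1 * 2 `^ d) * C3 * ((y `^ d) ^+ 2 * y `^ (5 / 9)) =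
     K * y `^ d * (C1 * 2 `^ d * y `^ d * (C3 * y `^ (5 / 9))) by ring.
  by do 2!(rewrite ler_pM2l ?mulr_gt0 ?powR_gt0 //); exact: hC3.
have B3 : `|\sum_(p.+1 <= k < z.+1) W k * S k| <= V * C3 * y `^ (5 / 9 + 2 * d).
  have -> : \sum_(p.+1 <= k < z.+1) W k * S k =
     \sum_(1 <= a < n.+1) \sum_(p.+1 <= k < z.+1 | (a * a * k <= n)%N)
        (ln (y / k%:R) + c) * sawtooth R n (k * a).
    rewrite (exchange_big_dep xpredT) //=; apply: eq_bigr => k _.
    by rewrite /S mulr_sumr.
  apply: le_trans (ler_norm_sum _ _ _) _.
  apply: le_trans (_ : \sum_(1 <= a < n.+1)
     (if a%:R <= r then V * (y `^ d) ^+ 2 * (y / a%:R) `^ third else 0) <= _).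
    rewrite !big_seq; apply: ler_sum => a; rewrite mem_index_iota => /andP[a0 _].
    rewrite VE; apply: (sawtooth_long_rows d0 n0 K0 C20 hz) => //.
    - by move=> k; exact: hK.
    - by move=> *; apply: hC2.
    move=> pz'; apply: lt_le_trans t2 _; rewrite ler_nat ltnS /p leq_min leqnn andbT.
    by move: pz'; rewrite /p gtn_min ltnn /= => /ltnW.
  rewrite -big_mkcond /=.
  have -> : \sum_(1 <= a < n.+1 | a%:R <= r) V * (y `^ d) ^+ 2 * (y / a%:R) `^ third =
     V * (y `^ d) ^+ 2 * \sum_(1 <= a < t.+1) (y / a%:R) `^ third.
    have tn : (t < n.+1)%N.
      rewrite ltnS -(ler_nat R); apply: le_trans t1 _.
      by rewrite -[leRHS]powRr1 ?(ltW y0) // ler_powR //; lra.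
    rewrite mulr_sumr [RHS](big_nat_widen _ _ _ _ _ tn); apply: eq_bigl => a /=.
    by rewrite ltnS truncn_ge_nat.
  rewrite Ey.
  have -> : V * C3 * ((y `^ d) ^+ 2 * y `^ (5 / 9)) = V * (y `^ d) ^+ 2 * (C3 * y `^ (5 / 9)) by ring.
  by rewrite ler_pM2l ?mulr_gt0 ?exprn_gt0 ?powR_gt0 //; exact: hC3.
apply: le_trans (ler_normB _ _) _; rewrite normrM ger0_norm //.
rewrite [X in 2 * `|X|](@big_cat_nat _ _ _ p.+1) //=.
have H (x1 x2 x3 x4 a b e : R) : x4 <= a -> x3 <= b -> x2 <= e -> x1 <= x3 + x2 ->
  x4 + 2 * x1 <= a + 2 * b + 2 * e by clear => *; lra.
apply: le_trans (H _ _ _ _ _ _ _ B1 B2 B3 (ler_normD _ _)) _.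
by rewrite le_eqVlt; apply/orP; left; apply/eqP; ring.
Qed.

End WeightedError.

(** * The terms with large d, grouped by quotient *)

Section Tail.
Variable R : realType.
Implicit Types (n a q N v X k : nat) (w d : R).

Definition triangular k : R := k%:R * (k%:R + 1) / 2.

Lemma sum_triangular a b : (a <= b)%N ->
  \sum_(a.+1 <= k < b.+1) k%:R = triangular b - triangular a.
Proof.
elim: b => [|b IH]; first by rewrite leqn0 => /eqP ->; rewrite big_geq ?subrr.
rewrite leq_eqVlt => /predU1P[->|]; first by rewrite big_geq ?subrr.
rewrite ltnS => ab; rewrite big_nat_recr ?ltnS //= IH // /triangular -[b.+1%:R]natr1.
by field.
Qed.

Lemma sum_by_quotient n X (f : nat -> R) : (0 < X)%N ->
  \sum_((n %/ X).+1 <= k < n.+1) k%:R * f (n %/ k)%N =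
  \sum_(1 <= v < X) f v * (triangular (n %/ v) - triangular (n %/ v.+1)).
Proof.
elim: X => // X IH _; have [->|X0] := posnP X.
  by rewrite divn1 !big_geq.
rewrite [RHS]big_nat_recr //= -IH //.
have h : (n %/ X.+1 <= n %/ X)%N by rewrite leq_div2l.
rewrite (@big_cat_nat _ _ _ (n %/ X).+1) ?ltnS ?leq_div //= addrC; congr (_ + _).
rewrite -sum_triangular // mulr_sumr; apply: eq_big_nat => k /andP[k1 k2].
have k0 : (0 < k)%N by apply: leq_trans k1.
rewrite mulrC; congr (f _ * _); apply/eqP; rewrite eqn_leq; apply/andP; split.
  by rewrite -ltnS ltn_divLR // mulnC -ltn_divLR.
by rewrite leq_divRL // mulnC -leq_divRL // -ltnS.
Qed.

Lemma triangular_approx n v : (0 < v)%N ->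
  `|triangular (n %/ v) - (n%:R / v%:R) ^+ 2 / 2| <= n%:R / v%:R / 2.
Proof.
move=> v0; have [h1 h2] := natr_div_bounds R n v0; rewrite -natr1 in h2.
have h3 : 0 <= n%:R / v%:R :> R by rewrite divr_ge0.
have h4 : 0 <= (n %/ v)%:R :> R by [].
rewrite /triangular; move: h1 h2 h3 h4; move: ((n %/ v)%:R : R) (n%:R / v%:R : R) => k x.
clear => h1 h2 h3 h4.
have a1 : k * k <= x * x by apply: ler_pM.
have a2 : 0 <= (x - k) * (1 - (x - k)) by rewrite mulr_ge0; lra.
have a3 : 0 <= k * (1 - (x - k)) by rewrite mulr_ge0; lra.
rewrite ler_norml expr2; apply/andP; split; lra.
Qed.

(** Summation by parts moves the differences onto [f], where they are non-negative; the right side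
    is the left one with [rho v] replaced by [y / v]. *)
Lemma abel_triangular (f rho : nat -> R) (y : R) X : 0 <= y ->
  (forall v, 0 <= f v) -> (forall v, f v <= f v.+1) -> f 0%N = 0 ->
  (forall v, (0 < v)%N -> `|rho v| <= y / v%:R) -> (0 < X)%N ->
  `|\sum_(1 <= v < X) f v * (rho v - rho v.+1) + f X.-1 * rho X| <=
    y * (\sum_(1 <= v < X) f v * (v%:R^-1 - v.+1%:R^-1) + f X.-1 / X%:R).
Proof.
move=> y0 f0 fm f00 hr; elim: X => // X IH _.
have [->|X0] := posnP X.
  by rewrite !big_geq //= f00 !mul0r !add0r mulr0 normr0.
rewrite big_nat_recr // [in leRHS]big_nat_recr //=.
have hX : `|(f X - f X.-1) * rho X| <= (f X - f X.-1) * (y / X%:R).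
  rewrite normrM ger0_norm ?ler_wpM2l ?hr // subr_ge0.
    by rewrite -{2}(prednK X0).
  by rewrite -{2}(prednK X0).
have -> : \sum_(1 <= i < X) f i * (rho i - rho i.+1) + f X * (rho X - rho X.+1) + f X * rho X.+1
  = (\sum_(1 <= i < X) f i * (rho i - rho i.+1) + f X.-1 * rho X) + (f X - f X.-1) * rho X.
  by ring.
apply: le_trans (ler_normD _ _) _; apply: le_trans (lerD (IH X0) hX) _.
by rewrite le_eqVlt; apply/orP; left; apply/eqP; ring.
Qed.

Lemma divisor_sum_mono k : (divisor_sum k <= divisor_sum k.+1)%N.
Proof.
rewrite /divisor_sum [leqRHS]big_nat_recr //=; apply: leq_trans (leq_addr _ _).
by rewrite !big_seq; apply: leq_sum => a _; apply: leq_div2r.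
Qed.

Lemma divisor_sum_le d : 0 < d -> exists2 C : R, 0 < C & forall v, (0 < v)%N ->
  (divisor_sum v)%:R <= C * v%:R `^ (1 + d).
Proof.
move=> d0; have [K K0 hK] := log_weight_le d0.
have [C C0 hC] := divisor_error_sqr R.
exists (K + (C + 1)) => [|v v0]; first by lra.
have v1 : 1 <= v%:R :> R by rewrite ler1n.
have v0' : 0 < v%:R :> R by rewrite ltr0n.
have -> : (divisor_sum v)%:R = v%:R * (ln (v%:R / 1%:R) + (2 * stieltjes R 0 - 1)) + divisor_error R v 1.
  by rewrite /divisor_error divn1 !divr1; ring.
apply: le_trans (ler_norm _) _; apply: le_trans (ler_normD _ _) _; rewrite [leRHS]mulrDl.
rewrite -powR_addE // powRr1 ?(ltW v0') //; apply: lerD.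
  rewrite normrM (gtr0_norm v0') mulrCA ler_pM2l //.
  by have [] := hK v 1%N; rewrite ?v0.
have e1 : `|divisor_error R v 1| <= 1 + divisor_error R v 1 ^+ 2.
  rewrite -(real_normK (num_real (divisor_error R v 1))).
  by move: (`|_|) => x; have := sqr_ge0 (x - 2^-1); lra.
apply: le_trans e1 _; have := hC v 1%N; rewrite v0 divr1 => /(_ isT) h.
have p1 := powR_ge1 v1 (ltW d0).
apply: le_trans (_ : (C + 1) * v%:R <= _); first by lra.
by rewrite ler_pM2l ?ler_peMr ?(ltW v0') //; lra.
Qed.

(** Bounding each difference of the errors [rho] by their size would give about [n * X^2]; summation
    by parts against the increasing squares of [divisor_sum] saves a factor [X]. *)
Lemma tail_sum_approx d : 0 < d -> exists2 C : R, 0 < C & forall n X, (0 < X)%N ->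
  `|\sum_((n %/ X).+1 <= k < n.+1) k%:R * (divisor_sum (n %/ k))%:R ^+ 2
     - n%:R ^+ 2 / 2 * square_sum R X| <= C * (n%:R * X%:R `^ (1 + 2 * d)).
Proof.
move=> d0; have [C C0 hC] := divisor_sum_le d0.
exists (2 * C ^+ 2) => [|n X X0]; first by rewrite mulr_gt0 ?exprn_gt0.
pose f v : R := (divisor_sum v)%:R ^+ 2.
pose rho v : R := triangular (n %/ v) - (n%:R / v%:R) ^+ 2 / 2.
have X0' : 0 < X%:R :> R by rewrite ltr0n.
rewrite (sum_by_quotient n (fun v => (divisor_sum v)%:R ^+ 2) X0).
have -> : \sum_(1 <= v < X) (divisor_sum v)%:R ^+ 2 * (triangular (n %/ v) - triangular (n %/ v.+1))
    - n%:R ^+ 2 / 2 * square_sum R X = \sum_(1 <= v < X) f v * (rho v - rho v.+1).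
  rewrite /square_sum mulr_sumr -sumrB; apply: eq_bigr => v _.
  by rewrite /f /rho /inv_sqr_gap !expr_div_n; ring.
have f0 v : 0 <= f v by exact: sqr_ge0.
have fm v : f v <= f v.+1 by rewrite lerXn2r ?nnegrE // ler_nat divisor_sum_mono.
have f00 : f 0%N = 0 by rewrite /f /divisor_sum big_geq // expr0n.
have y0 : 0 <= n%:R / 2 :> R by rewrite divr_ge0.
have hr v : (0 < v)%N -> `|rho v| <= n%:R / 2 / v%:R.
  by move=> v0; apply: le_trans (triangular_approx n v0) _; rewrite mulrAC.
have hf v : f v <= C ^+ 2 * v%:R `^ (2 + 2 * d).
  have [->|v0] := posnP v; first by rewrite f00 mulr_ge0 ?sqr_ge0 ?powR_ge0.
  have -> : 2 + 2 * d = (1 + d) * 2%:R by ring.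
  rewrite powRrM powR_mulrn ?powR_ge0 // -exprMn lerXn2r ?nnegrE ?hC //.
  by rewrite mulr_ge0 ?powR_ge0 // ltW.
have P : X%:R `^ (2 + 2 * d) / X%:R = X%:R `^ (1 + 2 * d) :> R.
  have -> : 2 + 2 * d = (1 + 2 * d) + 1 by ring.
  by rewrite -powR_addE // powRr1 ?(ltW X0') // mulfK ?gt_eqF.
have fX : f X.-1 / X%:R <= C ^+ 2 * X%:R `^ (1 + 2 * d).
  rewrite -P mulrA ler_pM2r ?invr_gt0 //.
  by apply: le_trans (hf X); rewrite -{2}(prednK X0).
have fS : \sum_(1 <= v < X) f v * (v%:R^-1 - v.+1%:R^-1) <= C ^+ 2 * X%:R `^ (1 + 2 * d).
  apply: le_trans (_ : \sum_(1 <= v < X) C ^+ 2 * X%:R `^ (2 * d) <= _).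
    rewrite !big_seq; apply: ler_sum => v; rewrite mem_index_iota => /andP[v0 vX].
    have v0' : 0 < v%:R :> R by rewrite ltr0n.
    have v1 : 0 < v.+1%:R :> R by rewrite ltr0n.
    have g : v%:R^-1 - v.+1%:R^-1 <= v%:R^-1 ^+ 2 :> R.
      have -> : v%:R^-1 - v.+1%:R^-1 = v%:R^-1 * v.+1%:R^-1 :> R.
        by rewrite -[v.+1%:R]natr1; field; rewrite natr1 !gt_eqF.
      by rewrite expr2 ler_pM2l ?invr_gt0 // lef_pV2 ?posrE // ler_nat.
    apply: le_trans (_ : C ^+ 2 * v%:R `^ (2 + 2 * d) * v%:R^-1 ^+ 2 <= _).
      by apply: ler_pM => //; rewrite subr_ge0 lef_pV2 ?posrE // ler_nat.
    rewrite -mulrA ler_pM2l ?exprn_gt0 //.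
    have -> : v%:R^-1 ^+ 2 = v%:R `^ (- 2%:R) :> R by rewrite powR_invn ?ler0n // exprVn.
    rewrite powR_addE //; have -> : 2 + 2 * d - 2%:R = 2 * d by ring.
    by rewrite ge0_ler_powR ?nnegrE ?mulr_ge0 ?(ltW d0) // ler_nat ltnW.
  rewrite sumr_const_nat -[leLHS]mulr_natr -mulrA ler_pM2l ?exprn_gt0 // mulrC.
  rewrite -powR_addE // powRr1 ?(ltW X0') // ler_wpM2r ?powR_ge0 // ler_nat leq_subr //.
have := abel_triangular y0 f0 fm f00 hr X0.
set S := \sum_(_ <= _ < _) f _ * (rho _ - _) => h.
have -> : S = (S + f X.-1 * rho X) - f X.-1 * rho X by rewrite addrK.
apply: le_trans (ler_normB _ _) _; apply: le_trans (lerD h (lexx _)) _.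
have h2 : `|f X.-1 * rho X| <= n%:R / 2 * (f X.-1 / X%:R).
  rewrite normrM (ger0_norm (f0 _)) mulrC.
  have -> : n%:R / 2 * (f X.-1 / X%:R) = n%:R / 2 / X%:R * f X.-1 by ring.
  by rewrite ler_wpM2r // hr.
apply: le_trans (lerD (lexx _) h2) _; rewrite -mulrDr.
have -> : 2 * C ^+ 2 * (n%:R * X%:R `^ (1 + 2 * d)) =
  n%:R / 2 * (4 * (C ^+ 2 * X%:R `^ (1 + 2 * d))) by field.
rewrite ler_wpM2l //.
have H (x1 x2 x3 : R) : x1 <= x3 -> x2 <= x3 -> 0 <= x3 -> x2 + x1 + x1 <= 4 * x3.
  by clear => *; lra.
by apply: H => //; rewrite mulr_ge0 ?sqr_ge0 ?powR_ge0.
Qed.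

End Tail.

(** * Head and tail combined *)

Section Asymptotic.
Variable R : realType.
Implicit Types (n a q N v X k : nat) (w d : R).

Local Notation g0 := (stieltjes R 0).
Local Notation g1 := (stieltjes R 1).
Local Notation g2 := (stieltjes R 2).
Local Notation c := (2 * g0 - 1).

Lemma eventually_bound (F : nat -> R) (C e M : R) : 0 <= e ->
  (forall n, (0 < n)%N -> M <= n%:R -> `|F n| <= C * n%:R `^ e) ->
  exists2 C', 0 < C' & forall n, (0 < n)%N -> `|F n| <= C' * n%:R `^ e.
Proof.
move=> e0 h; pose m := (Num.truncn M).+1; pose S := \sum_(0 <= k < m) `|F k|.
have S0 : 0 <= S by apply: sumr_ge0.
exists (`|C| + S + 1) => [|n n0]; first by have := normr_ge0 C; lra.
have p1 : 1 <= n%:R `^ e by apply: powR_ge1 => //; rewrite ler1n.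
have [Mn|nM] := leP M n%:R.
  apply: le_trans (h n n0 Mn) _; rewrite ler_wpM2r ?powR_ge0 //.
  by have := ler_norm C; lra.
have nm : (n < m)%N.
  rewrite -(ler_nat R) -natr1; have := truncnS_gt M; rewrite -/m => h2.
  rewrite natr1 ler_nat -(ltr_nat R); exact: lt_trans nM h2.
have FS : `|F n| <= S.
  rewrite /S (bigD1_seq n) ?iota_uniq ?mem_index_iota ?nm //= lerDl; exact: sumr_ge0.
apply: le_trans FS _; apply: le_trans (_ : (`|C| + S + 1) * 1 <= _).
  by have := normr_ge0 C; lra.
by rewrite ler_wpM2l //; have := normr_ge0 C; lra.
Qed.

Definition log_power_sum j n : R := \sum_(1 <= k < n.+1) ln k%:R ^+ j / k%:R.

Lemma log_power_sum_rate j d : 0 < d -> d < 1 -> exists2 C : R, 0 < C & forall n X,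
  (0 < X <= n)%N -> `|log_power_sum j (n %/ X) - ln (n%:R / X%:R) ^+ j.+1 / j.+1%:R
     - stieltjes R j| <= C * (n%:R / X%:R) `^ (d - 1).
Proof.
move=> d0 d1; have [C C0 hC] := stieltjes_rate j d0 d1; exists C => // n X /andP[X0 Xn].
have h1 : 1 <= n%:R / X%:R :> R by rewrite ler_pdivlMr ?ltr0n // mul1r ler_nat.
have := hC _ h1; rewrite /log_sum (_ : Num.truncn _ = n %/ X)%N //.
by apply: truncn_def; have [-> ->] := natr_div_bounds R n X0.
Qed.

Lemma head_sum_expand n z : (z <= n)%N ->
  \sum_(1 <= k < z.+1) k%:R * (divisor_sum (n %/ k))%:R ^+ 2 =
  n%:R ^+ 2 * ((ln n%:R + c) ^+ 2 * log_power_sum 0 z - 2 * (ln n%:R + c) * log_power_sum 1 z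
     + log_power_sum 2 z)
  + 2 * n%:R * (\sum_(1 <= k < z.+1) (ln (n%:R / k%:R : R) + c) * divisor_error R n k)
  + \sum_(1 <= k < z.+1) k%:R * divisor_error R n k ^+ 2.
Proof.
move=> zn; rewrite /log_power_sum !mulr_sumr -sumrB -big_split /= !mulr_sumr -!big_split /=.
apply: eq_big_nat => k /andP[k0 kz].
have k0' : 0 < k%:R :> R by rewrite ltr0n.
have n0' : 0 < n%:R :> R by rewrite ltr0n (leq_trans k0) // (leq_trans _ zn).
have -> : (divisor_sum (n %/ k))%:R = n%:R / k%:R * (ln (n%:R / k%:R) + c) + divisor_error R n k.
  by rewrite /divisor_error addrC subrK.
rewrite ln_div ?posrE // expr0 expr1.
by field; rewrite gt_eqF.
Qed.

Lemma square_error_sum : exists2 C : R, 0 < C & forall n z, (z <= n)%N ->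
  `|\sum_(1 <= k < z.+1) k%:R * divisor_error R n k ^+ 2| <= C * (n%:R * z%:R).
Proof.
have [C C0 hC] := divisor_error_sqr R; exists C => // n z zn.
apply: le_trans (ler_norm_sum _ _ _) _.
apply: le_trans (_ : \sum_(1 <= k < z.+1) C * n%:R <= _); last first.
  by rewrite sumr_const_nat subn1 -[leLHS]mulr_natr /= mulrA.
rewrite !big_seq; apply: ler_sum => k; rewrite mem_index_iota => /andP[k0 kz].
have k0' : 0 < k%:R :> R by rewrite ltr0n.
rewrite (ger0_norm (mulr_ge0 (ltW k0') (sqr_ge0 _))).
have -> : C * n%:R = k%:R * (C * (n%:R / k%:R)) by field; rewrite gt_eqF.
by rewrite ler_pM2l // hC // k0 (leq_trans (kz : (k <= z)%N) zn).
Qed.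

Lemma weighted_square_sum_split n X : (0 < X)%N -> (weighted_square_sum n)%:R =
  \sum_(1 <= k < (n %/ X).+1) k%:R * (divisor_sum (n %/ k))%:R ^+ 2 +
  \sum_((n %/ X).+1 <= k < n.+1) k%:R * (divisor_sum (n %/ k))%:R ^+ 2 :> R.
Proof.
move=> X0; rewrite /weighted_square_sum natr_sum (@big_cat_nat _ _ _ (n %/ X).+1) ?ltnS ?leq_div //=.
by congr (_ + _); apply: eq_bigr => k _; rewrite natrM natrX.
Qed.

Lemma cut_powR_le (y x d : R) : 1 <= y -> 0 < d -> d < 1 -> y `^ (5 / 12) / 2 <= x ->
  x `^ (d - 1) <= 2 * (y `^ (- (5 / 12)) * y `^ d).
Proof.
move=> y1 d0 d1 hx; have y0 : 0 < y by lra.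
have w0 : 0 < y `^ (5 / 12) by apply: powR_gt0.
apply: le_trans (_ : (y `^ (5 / 12) / 2) `^ (d - 1) <= _).
  have -> : d - 1 = - (1 - d) by ring.
  rewrite !powRN lef_pV2 ?posrE ?powR_gt0 ?divr_gt0 //; last by lra.
  by rewrite ge0_ler_powR ?nnegrE; lra.
rewrite powR_div // mulrC; apply: ler_pM; rewrite ?powR_ge0 //.
  by rewrite -[leRHS]powRr1 // ler_powR //; lra.
rewrite powR_addE // -powRrM ler_powR //; lra.
Qed.

(** [L] records the position of the cut. It drops out: the head gives [l^2 * L - l * L^2 + L^3 / 3],
    the tail [(l - L)^3 / 3], and together they make [l^3 / 3]. *)
Lemma main_term_algebra (y l L j e0 e1 e2 eJ V S3 T H0 H1 H2 J : R) :
  H0 = L + g0 + e0 -> H1 = L ^+ 2 / 2 + g1 + e1 -> H2 = L ^+ 3 / 3 + g2 + e2 ->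
  J = 2 / 3 * (l - L) ^+ 3 + j + eJ ->
  y ^+ 2 * (l ^+ 2 * H0 - 2 * l * H1 + H2) + 2 * y * V + S3 + (y ^+ 2 / 2 * J + T)
   - y ^+ 2 * (l ^+ 3 / 3 + g0 * l ^+ 2 - 2 * g1 * l + (g2 + j / 2)) =
  y ^+ 2 * (l ^+ 2 * e0) - 2 * (y ^+ 2 * (l * e1)) + y ^+ 2 * e2 + 2 * (y * V) + S3
    + (y ^+ 2 * eJ / 2 + T).
Proof. by move=> -> -> -> ->; field. Qed.

(** Up to small powers, the truncated logarithmic sums and the tail each leave [n^(19/12)], the
    squared errors and the limit of [square_sum] leave [n^(17/12)], and the cross term
    [n^(14/9)]. *)
Lemma weighted_square_sum_asymptotic d : 0 < d -> 3 * d < 1 ->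
  exists p, exists2 C : R, 0 < C & forall n, (0 < n)%N ->
  `|(weighted_square_sum n)%:R - n%:R ^+ 2 * ((ln n%:R + c) ^+ 3 / 3 + g0 * (ln n%:R + c) ^+ 2
     - 2 * g1 * (ln n%:R + c) + p)| <= C * n%:R `^ (19 / 12 + 3 * d).
Proof.
move=> d0 d3; have d1 : d < 1 by lra.
have [j [CJ CJ0 hJ]] := square_sum_rate d0 d3.
have [Ca Ca0 ha] := log_power_sum_rate 0 d0 d1.
have [Cb Cb0 hb] := log_power_sum_rate 1 d0 d1.
have [Cc Cc0 hc] := log_power_sum_rate 2 d0 d1.
have [CV CV0 hV] := weighted_error_sum d0.
have [CS CS0 hS] := square_error_sum.
have [CT CT0 hT] := tail_sum_approx d0.
have [K K0 hK] := log_weight_le d0.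
(* Since [1/36 = 4/9 - 5/12], beyond [M] one has [128 * n^(5/12) <= n^(4/9)], which yields the
   condition on [z] for the cross term; smaller [n] only affect the constant. *)
have d36 : 0 < 36^-1 :> R by rewrite invr_gt0.
have e128 : 0 < 128^-1 :> R by rewrite invr_gt0.
have [M M1 hM] := powR_opp_small d36 e128.
exists (g2 + j / 2).
pose C := 2 * K ^+ 2 * Ca + 2 * (2 * K * Cb) + 2 * Cc + 2 * CV + CS + CJ + CT * 2 `^ (1 + 2 * d).
have e0 : 0 <= 19 / 12 + 3 * d by lra.
apply: (@eventually_bound _ C _ M e0) => n n0 Mn.
set y : R := n%:R in Mn *.
have y1 : 1 <= y by rewrite ler1n.
have y0 : 0 < y by rewrite ltr0n.
have y128 : 128 * y `^ (5 / 12) <= y `^ (4 / 9).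
  have := hM _ Mn; rewrite powRN lef_pV2 ?posrE ?powR_gt0 // => h.
  have -> : 4 / 9 = 36^-1 + 5 / 12 :> R by field.
  by rewrite -powR_addE // ler_pM2r ?powR_gt0.
have y512 : 2 <= y `^ (5 / 12).
  apply: le_trans (_ : y `^ 36^-1 <= _); last by rewrite ler_powR //; clear; lra.
  have := hM _ Mn; rewrite powRN lef_pV2 ?posrE ?powR_gt0 //; clear; lra.
(* Quotients below [X], about [n^(7/12)], are those of the [k] above [n %/ X], about [n^(5/12)]. *)
pose X := (Num.truncn (y `^ (7 / 12))).+1.
have X0 : (0 < X)%N by [].
have [X1 X2] : y `^ (7 / 12) <= X%:R /\ X%:R <= 2 * y `^ (7 / 12).
  have h : 1 <= y `^ (7 / 12) by apply: powR_ge1 => //; clear; lra.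
  have /andP[h1 h2] := truncn_itv (le_trans ler01 h).
  by rewrite ltW //= /X -natr1; split => //; move: h h1; clear; lra.
have X0' : 0 < X%:R :> R by rewrite ltr0n.
have yE : y = y `^ (5 / 12) * y `^ (7 / 12).
  by rewrite powR_addE // -[LHS]powRr1 ?(ltW y0) //; congr (_ `^ _); field.
pose x := y / X%:R.
have x2 : x <= y `^ (5 / 12).
  by rewrite ler_pdivrMr // {1}yE ler_pM2l ?powR_gt0.
have x1 : y `^ (5 / 12) / 2 <= x.
  rewrite ler_pdivlMr // {2}yE mulrAC ler_pdivrMr // -mulrA ler_pM2l ?powR_gt0 //.
  by rewrite mulrC.
have Xn : (0 < X <= n)%N.
  rewrite X0 -(ler_nat R) -/y.
  have : 1 <= x by apply: le_trans x1; move: y512; clear; lra.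
  by rewrite ler_pdivlMr // mul1r.
pose z := (n %/ X)%N.
have [zx _] : z%:R <= x /\ _ := natr_div_bounds R n X0.
have zn : (z <= n)%N by exact: leq_div.
have hz : 64 * z.+1%:R <= y `^ (4 / 9).
  apply: le_trans y128; rewrite -natr1.
  by move: (le_trans zx x2) y512; clear; lra.
pose B := y `^ (19 / 12 + 3 * d).
pose p := y `^ d; have p1 : 1 <= p := powR_ge1 y1 (ltW d0).
have l1 : `|ln y + c| <= K * p.
  by have := hK n 1%N; rewrite n0 divr1 => /(_ isT) [].
have xe : x `^ (d - 1) <= 2 * (y `^ (- (5 / 12)) * p).
  exact: cut_powR_le.
pose e_ i := log_power_sum i z - ln x ^+ i.+1 / i.+1%:R - stieltjes R i.
pose eJ := square_sum R X - 2 / 3 * (ln X%:R + c) ^+ 3 - j.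
pose V := \sum_(1 <= k < z.+1) (ln (y / k%:R) + c) * divisor_error R n k.
pose S3 := \sum_(1 <= k < z.+1) k%:R * divisor_error R n k ^+ 2.
pose T := \sum_(z.+1 <= k < n.+1) k%:R * (divisor_sum (n %/ k))%:R ^+ 2 - y ^+ 2 / 2 * square_sum R X.
have lX : ln X%:R + c = (ln y + c) - ln x.
  by rewrite /x ln_div ?posrE //; ring.
rewrite (weighted_square_sum_split n X0) (head_sum_expand zn) -/y -/V -/S3.
have -> : \sum_(z.+1 <= k < n.+1) k%:R * (divisor_sum (n %/ k))%:R ^+ 2 =
  y ^+ 2 / 2 * square_sum R X + T by rewrite /T addrC subrK.
rewrite (@main_term_algebra _ _ (ln x) j (e_ 0%N) (e_ 1%N) (e_ 2%N) eJ); first last.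
- by rewrite /eJ -lX; ring.
- by rewrite /e_; ring.
- by rewrite /e_; ring.
- by rewrite /e_ expr1 divr1; ring.
have y2 : y ^+ 2 = y `^ 2 by rewrite powR_mulrn ?(ltW y0).
have B1 : y ^+ 2 * (p ^+ 2 * (y `^ (- (5 / 12)) * p)) = B.
  have -> : p ^+ 2 * (y `^ (- (5 / 12)) * p) = y `^ (- (5 / 12)) * p ^+ 3 by ring.
  have -> : p ^+ 3 = y `^ (3 * d) by rewrite mulrC powRrM powR_mulrn ?powR_ge0.
  by rewrite y2 !powR_addE //; congr (_ `^ _); field.
have By (a : R) : a <= 19 / 12 + 3 * d -> y `^ a <= B by move=> h; rewrite ler_powR.
have BB0 : 0 <= B := powR_ge0 _ _.
have q0 : 0 <= y `^ (- (5 / 12)) * p by rewrite mulr_ge0 ?powR_ge0.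
have p0 : 0 <= p := powR_ge0 _ _.
have y20 : 0 <= y ^+ 2 := sqr_ge0 y.
have E0 : `|y ^+ 2 * ((ln y + c) ^+ 2 * e_ 0%N)| <= 2 * K ^+ 2 * Ca * B.
  have -> : 2 * K ^+ 2 * Ca * B = y ^+ 2 * ((K * p) * (K * p) * (Ca * (2 * (y `^ (- (5 / 12)) * p)))).
    by rewrite -B1; ring.
  rewrite normrM (ger0_norm y20) ler_wpM2l // expr2; apply: normM_le (normM_le l1 l1) _.
  by apply: le_trans (ha n X Xn) _; rewrite ler_pM2l.
have E1 : `|y ^+ 2 * ((ln y + c) * e_ 1%N)| <= 2 * K * Cb * B.
  apply: le_trans (_ : y ^+ 2 * ((K * p) * (Cb * (2 * (y `^ (- (5 / 12)) * p)))) <= _).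
    rewrite normrM (ger0_norm y20) ler_wpM2l //; apply: normM_le l1 _.
    by apply: le_trans (hb n X Xn) _; rewrite ler_pM2l.
  have -> : y ^+ 2 * (K * p * (Cb * (2 * (y `^ (- (5 / 12)) * p)))) =
    2 * K * Cb * (y ^+ 2 * (p * (y `^ (- (5 / 12)) * p))) by ring.
  rewrite ler_pM2l ?mulr_gt0 // -B1 ler_wpM2l // ler_wpM2r // expr2 ler_peMl //.
have E2 : `|y ^+ 2 * e_ 2%N| <= 2 * Cc * B.
  apply: le_trans (_ : y ^+ 2 * (Cc * (2 * (y `^ (- (5 / 12)) * p))) <= _).
    rewrite normrM (ger0_norm y20) ler_wpM2l //.
    by apply: le_trans (hc n X Xn) _; rewrite ler_pM2l.
  have -> : y ^+ 2 * (Cc * (2 * (y `^ (- (5 / 12)) * p))) =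
    2 * Cc * (y ^+ 2 * (1 * (y `^ (- (5 / 12)) * p))) by ring.
  rewrite ler_pM2l ?mulr_gt0 // -B1 ler_wpM2l // ler_wpM2r //.
  by rewrite exprn_ege1.
have EV : `|y * V| <= CV * B.
  rewrite normrM (gtr0_norm y0); apply: le_trans (ler_wpM2l (ltW y0) (hV n z n0 hz)) _.
  rewrite mulrCA ler_pM2l // -{1}[y]powRr1 ?(ltW y0) // powR_addE //; apply: By; move: d0 d3; clear; lra.
have ES : `|S3| <= CS * B.
  apply: le_trans (hS n z zn) _; rewrite ler_pM2l //.
  apply: le_trans (_ : y * y `^ (5 / 12) <= _).
    by rewrite ler_pM2l // (le_trans zx).
  by rewrite -{1}[y]powRr1 ?(ltW y0) // powR_addE //; apply: By; move: d0 d3; clear; lra.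
have EJ : `|y ^+ 2 * eJ| <= CJ * B.
  rewrite normrM (ger0_norm y20); apply: le_trans (ler_wpM2l y20 (hJ X X0)) _.
  rewrite mulrCA ler_pM2l //.
  apply: le_trans (_ : y ^+ 2 * y `^ (- (7 / 12 * (1 - 3 * d))) <= _).
    rewrite ler_wpM2l // !powRN lef_pV2 ?posrE ?powR_gt0 // powRrM.
    by rewrite ge0_ler_powR ?nnegrE ?powR_ge0 //; move: d0 d3; clear; lra.
  by rewrite y2 powR_addE //; apply: By; move: d0 d3; clear; lra.
have ET : `|T| <= CT * 2 `^ (1 + 2 * d) * B.
  apply: le_trans (hT n X X0) _; rewrite -mulrA ler_pM2l // -/y.
  apply: le_trans (_ : y * (2 * y `^ (7 / 12)) `^ (1 + 2 * d) <= _).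
    by rewrite ler_pM2l // ge0_ler_powR ?nnegrE ?mulr_ge0 ?powR_ge0 //; move: d0 d3; clear; lra.
  rewrite powRM ?powR_ge0 // mulrCA ler_pM2l ?powR_gt0 //.
  by rewrite -powRrM -{1}[y]powRr1 ?(ltW y0) // powR_addE //; apply: By; move: d0 d3; clear; lra.
rewrite -/B /C.
have H (a0 a1 a2 a3 a4 a5 a6 b0 b1 b2 b3 b4 b5 b6 : R) :
  `|a0| <= b0 -> `|a1| <= b1 -> `|a2| <= b2 -> `|a3| <= b3 -> `|a4| <= b4 -> `|a5| <= b5 ->
  `|a6| <= b6 -> `|a0 - 2 * a1 + a2 + 2 * a3 + a4 + (a5 / 2 + a6)| <=
    b0 + 2 * b1 + b2 + 2 * b3 + b4 + b5 + b6.
  clear; rewrite !ler_norml => /andP[? ?] /andP[? ?] /andP[? ?] /andP[? ?] /andP[? ?].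
  by move=> /andP[? ?] /andP[? ?]; apply/andP; split; lra.
apply: le_trans (H _ _ _ _ _ _ _ _ _ _ _ _ _ _ E0 E1 E2 EV ES EJ ET) _.
by rewrite le_eqVlt; apply/orP; left; apply/eqP; ring.
Qed.

End Asymptotic.

(** * Summation against the Moebius function *)

Section Transform.
Variable R : realType.
Implicit Types (n N k j r : nat) (e d : R).

Local Notation mu k := ((moebius k)%:~R : R).

Lemma normr_moebius k : `|mu k| <= 1.
Proof. by rewrite -intr_norm (ler_int R _ 1) norm_moebius. Qed.

Local Open Scope classical_set_scope.

Lemma rate_cvg (u : nat -> R) l C d : 0 < d ->
  (forall n, (0 < n)%N -> `|u n - l| <= C * n%:R `^ (- d)) -> u @ \oo --> l.
Proof.
move=> d0 hu; apply/cvgrPdist_le => e e0.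
have K0 : 0 < `|C| + 1 by rewrite ltr_wpDl.
have [M M1 hM] := powR_opp_small d0 (divr_gt0 e0 K0).
near=> n; have n0 : (0 < n)%N by near: n; exact: nbhs_infty_gt.
have Mn : M <= n%:R by near: n; exact: nbhs_infty_ger.
rewrite distrC; apply: le_trans (hu n n0) _; have := hM _ Mn.
rewrite ler_pdivlMr //; apply: le_trans.
rewrite mulrC ler_wpM2l ?powR_ge0 //.
by apply: le_trans (ler_norm C) _; rewrite lerDl.
Unshelve. all: by end_near. Qed.

Definition moebius_log_sum j n : R := \sum_(1 <= k < n.+1) mu k * (ln k%:R ^+ j / k%:R ^+ 2).

Lemma log_pow_inv_sqr_le j d : 0 < d -> exists2 K : R, 0 < K & forall k, (0 < k)%N ->
  `|ln k%:R ^+ j / k%:R ^+ 2| <= K * k%:R `^ (- (1 + (1 - d))).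
Proof.
move=> d0; have [K K0 hK] := log_pow_le j d0; exists K => // k k0.
have k1 : 1 <= k%:R :> R by rewrite ler1n.
have k0' : 0 < k%:R :> R by rewrite ltr0n.
have l0 := ln_ge0 k1.
rewrite ger0_norm ?divr_ge0 ?exprn_ge0 //.
have -> : - (1 + (1 - d)) = d + - 2%:R by ring.
rewrite -powR_addE // powR_invn ?ler0n // mulrA ler_pM2r ?invr_gt0 ?exprn_gt0 //.
by apply: le_trans (hK _ k1); rewrite lerXn2r ?nnegrE ?addr_ge0 // lerDr.
Qed.

Definition moebius_log_series j : R := limn (moebius_log_sum j).

Lemma moebius_log_sum_rate j d : 0 < d -> d < 1 -> exists2 C : R, 0 < C &
  forall n, (0 < n)%N ->
    `|moebius_log_sum j n - moebius_log_series j| <= C * n%:R `^ (- (1 - d)).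
Proof.
move=> d0 d1; have d1' : 0 < 1 - d by lra.
have [K K0 hK] := log_pow_inv_sqr_le j d0.
have [l [C C0 hl]] : exists l, exists2 C : R, 0 < C & forall n, (0 < n)%N ->
    `|moebius_log_sum j n - l| <= C * n%:R `^ (- (1 - d)).
  apply: (@rate_limit _ _ _ K) => // n n0.
  rewrite /moebius_log_sum [X in X - _]big_nat_recr //= [X in X - _]addrC addrK normrM.
  apply: le_trans (_ : 1 * (K * n.+1%:R `^ (- (1 + (1 - d)))) <= _).
    by apply: ler_pM => //; [exact: normr_moebius | exact: hK].
  rewrite mul1r ler_pM2l // !powRN lef_pV2 ?posrE ?powR_gt0 ?ltr0n //.
  by rewrite ge0_ler_powR ?nnegrE ?ler_nat //; lra.
exists C => // n n0; suff -> : moebius_log_series j = l by exact: hl.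
by apply: cvg_lim => //; exact: rate_cvg hl.
Qed.

Lemma sum_powR_opp_le d : 0 < d -> exists2 C : R, 0 < C & forall n,
  \sum_(1 <= k < n.+1) k%:R `^ (- (1 + d)) <= C.
Proof.
move=> d0; have [C C0 hC] := powR_opp_telescope d0; exists C => // n.
apply: le_trans (_ : C * (1 - n.+1%:R `^ (- d)) <= _); last first.
  by rewrite ger_pMr // gerBl powR_ge0.
elim: n => [|n IH]; first by rewrite big_geq // powR1 subrr mulr0.
rewrite big_nat_recr //=; apply: le_trans (lerD IH (hC n.+1 _)) _ => //.
by rewrite le_eqVlt; apply/orP; left; apply/eqP; ring.
Qed.

Lemma sum_div_powR_le e : 1 < e -> exists2 C : R, 0 < C & forall n, (0 < n)%N ->
  \sum_(1 <= k < n.+1) (n%:R / k%:R) `^ e <= C * n%:R `^ e.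
Proof.
move=> e1; have e0 : 0 < e - 1 by lra.
have [C C0 hC] := sum_powR_opp_le e0.
exists C => // n n0; apply: le_trans (_ : n%:R `^ e * \sum_(1 <= k < n.+1) k%:R `^ (- (1 + (e - 1))) <= _).
  rewrite mulr_sumr !big_seq; apply: ler_sum => k; rewrite mem_index_iota => /andP[k0 _].
  by rewrite powR_div ?ltr0n // (_ : 1 + (e - 1) = e) //; ring.
by rewrite mulrC ler_wpM2r ?powR_ge0.
Qed.

Lemma sqr_log_pow_floor r e : 1 < e -> exists2 C : R, 0 < C & forall m x,
  1 <= m -> m <= x -> x < m + 1 ->
  `|m ^+ 2 * ln m ^+ r - x ^+ 2 * ln x ^+ r| <= C * x `^ e.
Proof.
move=> e1; have e0 : 0 < e - 1 by lra.
have [C C0 hC] := log_pow_le r e0.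
exists (2 * (1 + r%:R) * C) => [|m x m1 mx xm].
  by rewrite !mulr_gt0 // ltr_pwDl.
have x1 : 1 <= x by lra. have x0 : 0 < x by lra. have m0 : 0 < m by lra.
have l0 := ln_ge0 m1.
have lL : ln m <= ln x by rewrite ler_ln ?posrE.
have L1 := hC x x1.
have dl : ln x - ln m <= 2 / x.
  rewrite -ln_div ?posrE //; have -> : x / m = 1 + (x - m) / m by field; lra.
  apply: le_trans (le_ln1Dx _) _.
    by apply: lt_le_trans (_ : 0 <= _); [lra | rewrite divr_ge0; lra].
  rewrite ler_pdivlMr // mulrAC ler_pdivrMr //.
  have : (x - m) * x <= 1 * x by rewrite ler_pM2r //; lra.
  lra.
move: lL l0 L1 dl; move: (ln x) (ln m) => L l lL l0 L1 dl.
have Lr : L ^+ r <= (1 + L) ^+ r by rewrite lerXn2r ?nnegrE; lra.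
have Lr0 : 0 <= L ^+ r by rewrite exprn_ge0; lra.
have lr0 : l ^+ r <= L ^+ r by rewrite lerXn2r ?nnegrE; lra.
have B0 : 0 <= (1 + L) ^+ r by lra.
have D : L ^+ r - l ^+ r <= r%:R * ((1 + L) ^+ r * (2 / x)).
  case: r Lr Lr0 lr0 B0 {hC L1} => [|s] Lr Lr0 lr0 B0; first by rewrite !expr0 subrr mul0r.
  have /andP[_ H] := exprS_sub_bounds s l0 lL; apply: le_trans H _.
  rewrite ler_wpM2l //; apply: ler_pM => //; [by apply: exprn_ge0; lra | lra |].
  apply: le_trans (_ : (1 + L) ^+ s <= _); first by rewrite lerXn2r ?nnegrE; lra.
  by rewrite exprS ler_peMl ?exprn_ge0; lra.
have main : `|m ^+ 2 * l ^+ r - x ^+ 2 * L ^+ r| <= 2 * (1 + r%:R) * ((1 + L) ^+ r * x).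
  rewrite distrC.
  have -> : x ^+ 2 * L ^+ r - m ^+ 2 * l ^+ r =
     (x - m) * (x + m) * L ^+ r + m ^+ 2 * (L ^+ r - l ^+ r) by ring.
  have a1 : 0 <= (x - m) * (x + m) * L ^+ r by rewrite !mulr_ge0 //; lra.
  have a2 : 0 <= m ^+ 2 * (L ^+ r - l ^+ r) by rewrite mulr_ge0 ?sqr_ge0 // subr_ge0.
  rewrite ger0_norm ?addr_ge0 //.
  have a3 : (x - m) * (x + m) * L ^+ r <= (2 * x) * (1 + L) ^+ r.
    apply: ler_pM => //; first by rewrite mulr_ge0; lra.
    by rewrite -[leRHS]mul1r; apply: ler_pM; lra.
  have a4 : m ^+ 2 * (L ^+ r - l ^+ r) <= x ^+ 2 * (r%:R * ((1 + L) ^+ r * (2 / x))).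
    apply: ler_pM => //; rewrite ?sqr_ge0 ?subr_ge0 // lerXn2r ?nnegrE; lra.
  have a5 : x ^+ 2 * (r%:R * ((1 + L) ^+ r * (2 / x))) = 2 * r%:R * ((1 + L) ^+ r * x).
    by field; lra.
  by lra.
apply: le_trans main _; rewrite -[leRHS]mulrA ler_pM2l; last by rewrite mulr_gt0 // ltr_pwDl.
have -> : x `^ e = x `^ (e - 1) * x.
  by rewrite -[X in _ = _ * X]powRr1 ?(ltW x0) // powR_addE //; congr (_ `^ _); ring.
by rewrite mulrA ler_pM2r.
Qed.

Definition log_poly (a : nat -> R) (x : R) : R := \sum_(0 <= r < 4) a r * ln x ^+ r.

Lemma log_polyE a x : log_poly a x = a 0%N + a 1%N * ln x + a 2%N * ln x ^+ 2 + a 3%N * ln x ^+ 3.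
Proof.
by rewrite /log_poly !big_nat_recr //= big_geq // add0r expr0 mulr1 expr1.
Qed.

Lemma log_poly_floor a e : 1 < e -> exists2 C : R, 0 < C & forall m x,
  1 <= m -> m <= x -> x < m + 1 ->
  `|m ^+ 2 * log_poly a m - x ^+ 2 * log_poly a x| <= C * x `^ e.
Proof.
move=> e1.
have [c0 c00 h0] := sqr_log_pow_floor 0 e1.
have [c1 c10 h1] := sqr_log_pow_floor 1 e1.
have [c2 c20 h2] := sqr_log_pow_floor 2 e1.
have [c3 c30 h3] := sqr_log_pow_floor 3 e1.
exists (`|a 0%N| * c0 + `|a 1%N| * c1 + `|a 2%N| * c2 + `|a 3%N| * c3 + 1).
  by rewrite ltr_wpDl // !addr_ge0 // mulr_ge0 // ltW.
move=> m x m1 mx xm.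
have := h0 m x m1 mx xm; have := h1 m x m1 mx xm; have := h2 m x m1 mx xm; have := h3 m x m1 mx xm.
rewrite !log_polyE !expr0 !expr1 => g3 g2 g1 g0.
have -> : m ^+ 2 * (a 0%N + a 1%N * ln m + a 2%N * ln m ^+ 2 + a 3%N * ln m ^+ 3) -
   x ^+ 2 * (a 0%N + a 1%N * ln x + a 2%N * ln x ^+ 2 + a 3%N * ln x ^+ 3) =
   a 0%N * (m ^+ 2 * 1 - x ^+ 2 * 1) + a 1%N * (m ^+ 2 * ln m - x ^+ 2 * ln x)
   + a 2%N * (m ^+ 2 * ln m ^+ 2 - x ^+ 2 * ln x ^+ 2)
   + a 3%N * (m ^+ 2 * ln m ^+ 3 - x ^+ 2 * ln x ^+ 3) by ring.
rewrite mulrDl mul1r; apply: ler_wpDr (powR_ge0 _ _) _.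
have -> : (`|a 0%N| * c0 + `|a 1%N| * c1 + `|a 2%N| * c2 + `|a 3%N| * c3) * x `^ e =
    `|a 0%N| * (c0 * x `^ e) + `|a 1%N| * (c1 * x `^ e) + `|a 2%N| * (c2 * x `^ e)
    + `|a 3%N| * (c3 * x `^ e) by ring.
apply: le_trans (ler_normD _ _) _; apply: lerD; last exact: normM_le (lexx _) g3.
apply: le_trans (ler_normD _ _) _; apply: lerD; last exact: normM_le (lexx _) g2.
by apply: le_trans (ler_normD _ _) _; apply: lerD; [exact: normM_le (lexx _) g0|exact: normM_le (lexx _) g1].
Qed.

(* The coefficients in l of [\sum_k mu k / k^2 * P(l - ln k)] for P = \sum_r a r l^r,
   where M j = \sum_k mu k * ln k ^ j / k^2. *)
Definition transform_coeff (a M : nat -> R) (r : nat) : R :=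
  match r with
  | 0 => a 0%N * M 0%N - a 1%N * M 1%N + a 2%N * M 2%N - a 3%N * M 3%N
  | 1 => a 1%N * M 0%N - 2 * a 2%N * M 1%N + 3 * a 3%N * M 2%N
  | 2 => a 2%N * M 0%N - 3 * a 3%N * M 1%N
  | _ => a 3%N * M 0%N
  end.

Lemma transform_algebra (a m M : nat -> R) (l : R) :
  a 0%N * m 0%N + a 1%N * (l * m 0%N - m 1%N) + a 2%N * (l ^+ 2 * m 0%N - 2 * l * m 1%N + m 2%N)
  + a 3%N * (l ^+ 3 * m 0%N - 3 * l ^+ 2 * m 1%N + 3 * l * m 2%N - m 3%N)
  - (transform_coeff a M 0 + transform_coeff a M 1 * l + transform_coeff a M 2 * l ^+ 2
     + transform_coeff a M 3 * l ^+ 3) =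
  (a 0%N + a 1%N * l + a 2%N * l ^+ 2 + a 3%N * l ^+ 3) * (m 0%N - M 0%N)
  - (a 1%N + 2 * a 2%N * l + 3 * a 3%N * l ^+ 2) * (m 1%N - M 1%N)
  + (a 2%N + 3 * a 3%N * l) * (m 2%N - M 2%N) - a 3%N * (m 3%N - M 3%N).
Proof. by rewrite /=; ring. Qed.

Lemma cubic_le (a b c d' l : R) : 0 <= l ->
  `|a + b * l + c * l ^+ 2 + d' * l ^+ 3| <= (`|a| + `|b| + `|c| + `|d'|) * (1 + l) ^+ 3.
Proof.
move=> l0; have h i : (i <= 3)%N -> l ^+ i <= (1 + l) ^+ 3.
  move=> i3; apply: le_trans (_ : (1 + l) ^+ i <= _); first by rewrite lerXn2r ?nnegrE; lra.
  by rewrite ler_weXn2l //; lra.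
have g x i : (i <= 3)%N -> `|x * l ^+ i| <= `|x| * (1 + l) ^+ 3.
  by move=> i3; rewrite normrM (ger0_norm (exprn_ge0 _ l0)) ler_wpM2l // h.
have := g a 0%N isT; have := g b 1%N isT; have := g c 2%N isT; have := g d' 3%N isT.
rewrite expr0 mulr1 expr1 !mulrDl => h3 h2 h1 h0.
apply: le_trans (ler_normD _ _) _; apply: lerD h3.
apply: le_trans (ler_normD _ _) _; apply: lerD h2.
by apply: le_trans (ler_normD _ _) _; apply: lerD h1.
Qed.

Lemma four_errors_le (n2 K nd q ne L N0 N1 N2 N3 m0 m1 m2 m3 x0 x1 x2 x3 : R) :
  0 <= n2 -> 0 <= q -> L <= K * nd -> n2 * nd * q = ne ->
  0 <= N0 * m0 + N1 * m1 + N2 * m2 + N3 * m3 ->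
  `|x0| <= N0 * L * (m0 * q) -> `|x1| <= N1 * L * (m1 * q) ->
  `|x2| <= N2 * L * (m2 * q) -> `|x3| <= N3 * L * (m3 * q) ->
  n2 * `|x0 - x1 + x2 - x3| <= K * (N0 * m0 + N1 * m1 + N2 * m2 + N3 * m3) * ne.
Proof.
move=> n20 q0 LK <- S0 h0 h1 h2 h3.
apply: le_trans (_ : n2 * (N0 * L * (m0 * q) + N1 * L * (m1 * q) + N2 * L * (m2 * q)
  + N3 * L * (m3 * q)) <= _).
  apply: ler_wpM2l => //.
  apply: le_trans (ler_normB _ _) _; apply: lerD h3.
  apply: le_trans (ler_normD _ _) _; apply: lerD h2.
  by apply: le_trans (ler_normB _ _) _; apply: lerD h1.
have -> : n2 * (N0 * L * (m0 * q) + N1 * L * (m1 * q) + N2 * L * (m2 * q) + N3 * L * (m3 * q))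
  = L * ((N0 * m0 + N1 * m1 + N2 * m2 + N3 * m3) * (n2 * q)) by ring.
have -> : K * (N0 * m0 + N1 * m1 + N2 * m2 + N3 * m3) * (n2 * nd * q)
  = (K * nd) * ((N0 * m0 + N1 * m1 + N2 * m2 + N3 * m3) * (n2 * q)) by ring.
by rewrite ler_wpM2r // !mulr_ge0.
Qed.

(** As [e > 1], the sum of [(n / k)^e] over [k] is [O(n^e)], so the errors at the quotients keep
    their order. The main terms are polynomials in [ln n - ln k] summed against [mu k / k^2], that
    is, combinations of the truncated series [moebius_log_sum]. *)
Lemma moebius_transform e (F : nat -> R) (a : nat -> R) : 1 < e -> e < 3 ->
  (exists2 C, 0 < C & forall n, (0 < n)%N ->
     `|F n - n%:R ^+ 2 * log_poly a n%:R| <= C * n%:R `^ e) ->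
  exists2 C, 0 < C & forall n, (0 < n)%N ->
     `|\sum_(1 <= k < n.+1) mu k * F (n %/ k)%N
        - n%:R ^+ 2 * log_poly (transform_coeff a moebius_log_series) n%:R| <= C * n%:R `^ e.
Proof.
set M := moebius_log_series.
move=> e1 e3 [CF CF0 hF]; have e0 : 0 <= e by lra.
have [CS CS0 hS] := sum_div_powR_le e1.
pose d := (e - 1) / 2; have d0 : 0 < d by rewrite divr_gt0 //; lra.
have [K K0 hK] := log_pow_le 3 d0.
have [A A0 hA] := log_poly_floor a e1.
pose Q (x : R) := x ^+ 2 * log_poly a x.
have hQ n k : (0 < k <= n)%N -> `|Q (n %/ k)%:R - Q (n%:R / k%:R)| <= A * (n%:R / k%:R) `^ e.
  move=> /andP[k0 kn]; have [h1 h2] := natr_div_bounds R n k0.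
  by apply: hA; rewrite ?natr1 // ler1n divn_gt0.
have d1 : d < 1 by rewrite /d; lra.
have hM j := moebius_log_sum_rate j d0 d1.
have [m0 m00 H0] := hM 0%N; have [m1 m10 H1] := hM 1%N.
have [m2 m20 H2] := hM 2%N; have [m3 m30 H3] := hM 3%N.
pose N0 := (`|a 0%N| + `|a 1%N| + `|a 2%N| + `|a 3%N|).
pose N1 := (`|a 1%N| + `|2 * a 2%N| + `|3 * a 3%N| + `|0 : R|).
pose N2 := (`|a 2%N| + `|3 * a 3%N| + `|0 : R| + `|0 : R|).
pose N3 := (`|a 3%N| + `|0 : R| + `|0 : R| + `|0 : R|).
exists ((CF + A) * CS + K * (N0 * m0 + N1 * m1 + N2 * m2 + N3 * m3)).
  rewrite ltr_pwDl // ?mulr_gt0 ?addr_gt0 //.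
  by rewrite mulr_ge0 ?(ltW K0) // !addr_ge0 // mulr_ge0 ?(ltW m00, ltW m10, ltW m20, ltW m30) // !addr_ge0.
move=> n n0.
have n1 : 1 <= n%:R :> R by rewrite ler1n.
have n0' : 0 < n%:R :> R by rewrite ltr0n.
pose l : R := ln n%:R; have l0 : 0 <= l by exact: ln_ge0.
have -> : \sum_(1 <= k < n.+1) mu k * F (n %/ k)%N - n%:R ^+ 2 * log_poly (transform_coeff a M) n%:R =
   \sum_(1 <= k < n.+1) mu k * (F (n %/ k)%N - Q (n%:R / k%:R)) +
   (\sum_(1 <= k < n.+1) mu k * Q (n%:R / k%:R) - n%:R ^+ 2 * log_poly (transform_coeff a M) n%:R).
  rewrite addrA -big_split /=; congr (_ - _); apply: eq_bigr => k _; ring.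
apply: le_trans (ler_normD _ _) _; rewrite [leRHS]mulrDl; apply: lerD.
  apply: le_trans (ler_norm_sum _ _ _) _.
  apply: le_trans (_ : \sum_(1 <= k < n.+1) (CF + A) * (n%:R / k%:R) `^ e <= _); last first.
    by rewrite -mulr_sumr -mulrA ler_wpM2l ?hS // addr_ge0 // ltW.
  rewrite !big_seq; apply: ler_sum => k; rewrite mem_index_iota => /andP[k0 kn].
  have kn' : (0 < k <= n)%N by rewrite k0.
  rewrite -[leRHS]mul1r; apply: normM_le (normr_moebius k) _.
  have -> : F (n %/ k)%N - Q (n%:R / k%:R) = (F (n %/ k)%N - Q (n %/ k)%:R) +
    (Q (n %/ k)%:R - Q (n%:R / k%:R)) by ring.
  apply: le_trans (ler_normD _ _) _; rewrite mulrDl; apply: lerD; last exact: hQ.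
  have nk0 : (0 < n %/ k)%N by rewrite divn_gt0.
  apply: le_trans (hF _ nk0) _; rewrite ler_pM2l // ge0_ler_powR ?nnegrE ?divr_ge0 //.
  by have [] := natr_div_bounds R n k0.
pose m j := moebius_log_sum j n.
have -> : \sum_(1 <= k < n.+1) mu k * Q (n%:R / k%:R) = n%:R ^+ 2 *
  (a 0%N * m 0%N + a 1%N * (l * m 0%N - m 1%N) + a 2%N * (l ^+ 2 * m 0%N - 2 * l * m 1%N + m 2%N)
  + a 3%N * (l ^+ 3 * m 0%N - 3 * l ^+ 2 * m 1%N + 3 * l * m 2%N - m 3%N)).
  have -> : a 0%N * m 0%N + a 1%N * (l * m 0%N - m 1%N)
   + a 2%N * (l ^+ 2 * m 0%N - 2 * l * m 1%N + m 2%N)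
   + a 3%N * (l ^+ 3 * m 0%N - 3 * l ^+ 2 * m 1%N + 3 * l * m 2%N - m 3%N) =
   (a 0%N + a 1%N * l + a 2%N * l ^+ 2 + a 3%N * l ^+ 3) * m 0%N
   - (a 1%N + 2 * a 2%N * l + 3 * a 3%N * l ^+ 2) * m 1%N
   + (a 2%N + 3 * a 3%N * l) * m 2%N - a 3%N * m 3%N by ring.
  rewrite /m /moebius_log_sum !mulr_sumr -sumrB -big_split /= -sumrB mulr_sumr.
  apply: eq_big_nat => k /andP[k0 _]; have k0' : 0 < k%:R :> R by rewrite ltr0n.
  rewrite /Q log_polyE ln_div ?posrE // -/l expr0 expr1.
  by field; rewrite gt_eqF.
rewrite -mulrBr [log_poly _ _]log_polyE -/l transform_algebra.
rewrite normrM (ger0_norm (sqr_ge0 _)).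
have K1 := hK _ n1; rewrite -/l in K1.
pose q : R := n%:R `^ (- (1 - d)).

have E0 := normM_le (cubic_le (a 0%N) (a 1%N) (a 2%N) (a 3%N) l0) (H0 n n0).
have E1 := normM_le (cubic_le (a 1%N) (2 * a 2%N) (3 * a 3%N) 0 l0) (H1 n n0).
have E2 := normM_le (cubic_le (a 2%N) (3 * a 3%N) 0 0 l0) (H2 n n0).
have E3 := normM_le (cubic_le (a 3%N) 0 0 0 l0) (H3 n n0).
rewrite !mul0r !addr0 in E1 E2 E3.
rewrite -/N0 -/q in E0; rewrite -/q in E1 E2 E3.
apply: four_errors_le E0 E1 E2 E3; rewrite ?sqr_ge0 ?powR_ge0 //.
- exact: K1.
- rewrite -[n%:R ^+ 2]powR_mulrn ?ler0n // !powR_addE //; congr (_ `^ _).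
  by rewrite /d; field.
- by rewrite !addr_ge0 // mulr_ge0 ?(ltW m00, ltW m10, ltW m20, ltW m30) // !addr_ge0.
Qed.

End Transform.

(** * The values of zeta and its derivatives at 2 *)

Section ZetaDerivatives.
Variable R : realType.
Implicit Types (n N k j : nat) (s d h : R).
Local Open Scope classical_set_scope.

Lemma derive1_of_quadratic_bound (f : R -> R) a df C d : 0 < d ->
  (forall h, `|h| <= d -> `|f (a + h) - f a - df * h| <= C * h ^+ 2) -> f^`() a = df.
Proof.
move=> d0 hf; rewrite /derive1; apply: cvg_lim => //.
apply/cvgrPdist_le => e e0.
have K0 : 0 < `|C| + 1 by rewrite ltr_wpDl.
near=> h.
have h0 : h != 0 by near: h; exact: nbhs_dnbhs_neq.
have hd : `|h| <= d by near: h; apply: dnbhs0_le.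
have he : `|h| <= e / (`|C| + 1) by near: h; apply: dnbhs0_le; rewrite divr_gt0.
rewrite distrC [h + a]addrC.
have -> : h^-1 *: (f (a + h) - f a) - df = h^-1 * (f (a + h) - f a - df * h).
  by rewrite /GRing.scale /=; field.
have := hf h hd; move: (f (a + h) - f a - df * h) => x hx.
rewrite normrM normfV mulrC ler_pdivrMr ?normr_gt0 //; apply: le_trans hx _.
rewrite -[h ^+ 2]real_normK ?num_real // expr2 mulrA ler_wpM2r //.
apply: le_trans (_ : (`|C| + 1) * `|h| <= _).
  by rewrite ler_wpM2r //; apply: le_trans (ler_norm C) _; rewrite lerDl.
by rewrite mulrC -ler_pdivlMr.
Unshelve. all: by end_near. Qed.

Lemma expR_taylor1 (u : R) : `|expR u - 1 - u| <= u ^+ 2 * expR `|u|.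
Proof.
have h1 := expR_ge1Dx u; have h2 := expR_ge1Dx (- u).
have E0 := expR_gt0 u.
have h3 : expR u - 1 <= u * expR u.
  have : expR u * (1 + - u) <= expR u * expR (- u) by rewrite ler_pM2l.
  by rewrite expRxMexpNx_1; lra.
rewrite ger0_norm; last by lra.
case: (lerP 0 u) => u0.
  rewrite ger0_norm //.
  have : u * (expR u - 1) <= u * (u * expR u) by rewrite ler_wpM2l.
  by rewrite expr2; lra.
apply: le_trans (_ : u ^+ 2 * 1 <= _).
  have : u * (expR u - 1) <= u * u by rewrite ler_nM2l //; lra.
  by rewrite expr2; lra.
by rewrite ler_wpM2l ?sqr_ge0 // -expR0 ler_expR.
Qed.

Definition log_dirichlet j s n : R := \sum_(1 <= k < n.+1) ln k%:R ^+ j * k%:R `^ (- s).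

(** For [s > 1] this is the [j]-th derivative of zeta up to the sign [(-1)^j]; the family is closed
    under differentiation. *)
Definition log_zeta j s : R := limn (log_dirichlet j s).

Lemma zetaE : @zeta R = log_zeta 0.
Proof.
apply/funext => s; rewrite /zeta /log_zeta; congr (lim (_ @ \oo)).
apply/funext => n; rewrite /log_dirichlet big_add1 /=.
by rewrite /series /=; apply: eq_bigr => k _; rewrite expr0 mul1r.
Qed.

Lemma log_pow_powR_le j s : 1 < s -> exists2 K : R, 0 < K & forall k, (0 < k)%N ->
  ln k%:R ^+ j * k%:R `^ (- s) <= K * k%:R `^ (- (1 + (s - 1) / 2)).
Proof.
move=> s1; have d0 : 0 < (s - 1) / 2 by lra.
have [K K0 hK] := log_pow_le j d0; exists K => // k k0.
have k1 : 1 <= k%:R :> R by rewrite ler1n.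
have k0' : 0 < k%:R :> R by rewrite ltr0n.
have l0 := ln_ge0 k1.
have -> : - (1 + (s - 1) / 2) = (s - 1) / 2 + - s by field.
rewrite -powR_addE // mulrA ler_pM2r ?powR_gt0 //.
by apply: le_trans (hK _ k1); rewrite lerXn2r ?nnegrE ?addr_ge0 // lerDr.
Qed.

Lemma log_zeta_rate j s : 1 < s -> exists2 C : R, 0 < C & forall n, (0 < n)%N ->
  `|log_dirichlet j s n - log_zeta j s| <= C * n%:R `^ (- ((s - 1) / 2)).
Proof.
move=> s1; have d0 : 0 < (s - 1) / 2 by lra.
have [K K0 hK] := log_pow_powR_le j s1.
have [l [C C0 hl]] : exists l, exists2 C : R, 0 < C & forall n, (0 < n)%N ->
    `|log_dirichlet j s n - l| <= C * n%:R `^ (- ((s - 1) / 2)).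
  apply: (@rate_limit _ _ _ K) => // n n0.
  rewrite /log_dirichlet [X in X - _]big_nat_recr //= [X in X - _]addrC addrK ger0_norm; last first.
    by rewrite mulr_ge0 ?powR_ge0 // exprn_ge0 // ln_ge0 // ler1n.
  apply: le_trans (hK _ _) _ => //; rewrite ler_pM2l // !powRN lef_pV2 ?posrE ?powR_gt0 ?ltr0n //.
  by rewrite ge0_ler_powR ?nnegrE ?ler_nat //; lra.
exists C => // n n0; suff -> : log_zeta j s = l by exact: hl.
by apply: cvg_lim => //; exact: rate_cvg hl.
Qed.

Lemma log_zeta_cvg j s : 1 < s -> log_dirichlet j s @ \oo --> log_zeta j s.
Proof.
move=> s1; have [C C0 hC] := log_zeta_rate j s1.
by apply: rate_cvg hC; lra.
Qed.

(** Each term is a multiple of [exp (- h * ln k)], whose quadratic remainder is bounded by a term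
    with two more logarithms and exponent [s - d]. The bound passes to the limit in [n] and so
    differentiates the series. *)
Lemma log_dirichlet_taylor j s d h n : `|h| <= d ->
  `|log_dirichlet j (s + h) n - log_dirichlet j s n - - log_dirichlet j.+1 s n * h|
    <= log_dirichlet j.+2 (s - d) n * h ^+ 2.
Proof.
move=> hd; rewrite mulNr opprK /log_dirichlet [X in _ + X]mulr_suml -sumrB. rewrite -big_split /= mulr_suml.
apply: le_trans (ler_norm_sum _ _ _) _; rewrite !big_seq; apply: ler_sum => k.
rewrite mem_index_iota => /andP[k0 _].
have k1 : 1 <= k%:R :> R by rewrite ler1n.
have k0' : 0 < k%:R :> R by rewrite ltr0n.
have L0 := ln_ge0 k1.
have pE x : k%:R `^ x = expR (x * ln k%:R) :> R by rewrite /powR gt_eqF.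
have -> : k%:R `^ (- (s + h)) = k%:R `^ (- s) * k%:R `^ (- h) :> R.
  by rewrite powR_addE //; congr (_ `^ _); ring.
have -> : k%:R `^ (- (s - d)) = k%:R `^ (- s) * k%:R `^ d :> R.
  by rewrite powR_addE //; congr (_ `^ _); ring.
rewrite (pE (- h)) (pE d); move: L0 (powR_gt0 (- s) k0'); move: (ln _) (_ `^ _) => L p L0 p0.
have -> : L ^+ j * (p * expR (- h * L)) - L ^+ j * p + L ^+ j.+1 * p * h =
   L ^+ j * p * (expR (- h * L) - 1 - - h * L) by rewrite exprS; ring.
have -> : L ^+ j.+2 * (p * expR (d * L)) * h ^+ 2 = L ^+ j * p * ((- h * L) ^+ 2 * expR (d * L)).
  by rewrite !exprS; ring.
rewrite normrM [X in X * _]ger0_norm ?mulr_ge0 ?exprn_ge0 // ?(ltW p0) //.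
apply: ler_wpM2l; first by rewrite mulr_ge0 ?exprn_ge0 // ltW.
apply: le_trans (expR_taylor1 _) _; apply: ler_wpM2l; first exact: sqr_ge0.
by rewrite ler_expR normrM normrN (ger0_norm L0) ler_wpM2r.
Qed.

Lemma cvg_taylor_remainder (u v w : nat -> R) lu lv lw h :
  u @ \oo --> lu -> v @ \oo --> lv -> w @ \oo --> lw ->
  (fun n => `|u n - v n - - w n * h|) @ \oo --> `|lu - lv - - lw * h|.
Proof.
move=> cu cv cw; apply: cvg_norm; apply: cvgB; first exact: cvgB.
by apply: cvgM; [exact: cvgN | exact: cvg_cst].
Qed.

Lemma log_zeta_taylor j s h : 1 < s -> `|h| <= (s - 1) / 2 ->
  `|log_zeta j (s + h) - log_zeta j s - - log_zeta j.+1 s * h|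
    <= log_zeta j.+2 (s - (s - 1) / 2) * h ^+ 2.
Proof.
move=> s1 hd; have /andP[hd1 hd2] : - ((s - 1) / 2) <= h <= (s - 1) / 2 by rewrite -ler_norml.
have c1 : log_dirichlet j (s + h) @ \oo --> log_zeta j (s + h) by apply: log_zeta_cvg; lra.
have c2 := @log_zeta_cvg j _ s1; have c3 := @log_zeta_cvg j.+1 _ s1.
have c4 : log_dirichlet j.+2 (s - (s - 1) / 2) @ \oo --> log_zeta j.+2 (s - (s - 1) / 2).
  by apply: log_zeta_cvg; lra.
apply: (ler_cvg_to (a := \oo)
  (f := fun n => `|log_dirichlet j (s + h) n - log_dirichlet j s n - - log_dirichlet j.+1 s n * h|)
  (g := fun n => log_dirichlet j.+2 (s - (s - 1) / 2) n * h ^+ 2)).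
- exact: cvg_taylor_remainder c1 c2 c3.
- by apply: cvgM => //; exact: cvg_cst.
by apply: nearW => n; exact: log_dirichlet_taylor.
Qed.

Lemma derive1_log_zeta j s : 1 < s -> (log_zeta j)^`() s = - log_zeta j.+1 s.
Proof.
move=> s1; apply: (@derive1_of_quadratic_bound _ _ _ (log_zeta j.+2 (s - (s - 1) / 2)) ((s - 1) / 2)).
  by lra.
by move=> h hd; exact: log_zeta_taylor.
Qed.

Lemma derive1_zeta s : 1 < s -> (@zeta R)^`() s = - log_zeta 1 s.
Proof. by rewrite zetaE; exact: derive1_log_zeta. Qed.

(** The first derivative is known only to the right of 1, which contains [s + h] for
    [|h| <= (s - 1) / 2]. *)
Lemma derive2_zeta s : 1 < s -> (@zeta R)^`(2) s = log_zeta 2 s.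
Proof.
move=> s1; rewrite derive1nS derive1n1.
have d0 : 0 < (s - 1) / 2 by lra.
apply: (derive1_of_quadratic_bound (C := log_zeta 3 (s - (s - 1) / 2)) d0) => h hd.
have /andP[hd1 hd2] : - ((s - 1) / 2) <= h <= (s - 1) / 2 by rewrite -ler_norml.
have sh1 : 1 < s + h by lra.
rewrite !derive1_zeta // -normrN.
have := log_zeta_taylor 1 s1 hd; congr (`| _ | <= _); ring.
Qed.

End ZetaDerivatives.

(** * Relations between the Moebius series and the derivatives of zeta at 2 *)

Section MoebiusRelations.
Variable R : realType.
Implicit Types (n N k j : nat) (s d h : R).

Local Notation mu k := ((moebius k)%:~R : R).
Local Notation M := (@moebius_log_series R).
Local Notation Z j := (@log_zeta R j 2).

(** The product of two series truncated to the pairs with [d * m <= n]: with this truncation, unlike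
    a product of partial sums, the divisor sums of [moebius] apply exactly. *)
Definition log_convolution i j n : R :=
  \sum_(1 <= d < n.+1) mu d * (ln d%:R ^+ i / d%:R ^+ 2) * log_dirichlet j 2 (n %/ d).

Lemma floor_powR_opp_le b n k : 0 <= b -> (0 < k <= n)%N ->
  (n %/ k)%:R `^ (- b) <= 2 `^ b * (k%:R `^ b * n%:R `^ (- b)) :> R.
Proof.
move=> b0 /andP[k0 kn]; have k0' : 0 < k%:R :> R by rewrite ltr0n.
have n0' : 0 < n%:R :> R by rewrite ltr0n (leq_trans k0).
have q0 : 0 < (n %/ k)%:R :> R by rewrite ltr0n divn_gt0.
have q1 : 1 <= (n %/ k)%:R :> R by rewrite ler1n divn_gt0.
have [_ h2] := natr_div_bounds R n k0; rewrite -[X in _ < X]natr1 in h2.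
rewrite !powRN mulrA ler_pdivlMr ?powR_gt0 // mulrC ler_pdivrMr ?powR_gt0 //.
rewrite -!powRM ?mulr_ge0 ?ler0n //.
rewrite ge0_ler_powR ?nnegrE ?mulr_ge0 ?ler0n //.
apply: le_trans (_ : ((n %/ k)%:R + 1) * k%:R <= _); first by rewrite -ler_pdivrMr // ltW.
by rewrite mulrAC ler_wpM2r // ?ler0n //; lra.
Qed.

Lemma log_convolution_rate i j : exists2 C : R, 0 < C & forall n, (0 < n)%N ->
  `|log_convolution i j n - M i * Z j| <= C * n%:R `^ (- (1 / 2)).
Proof.
have h4 : 0 < 1 / 4 :> R by lra.
have h2 : 0 < 1 / 2 :> R by lra. have h21 : 1 / 2 < 1 :> R by lra.
have [K K0 hK] := log_pow_inv_sqr_le i h4.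
have [C C0 hC] := @log_zeta_rate R j 2 (ltr1n R 2).
have [S S0 hS] := sum_powR_opp_le h4.
have [m m0 hm] := moebius_log_sum_rate i h2 h21.
exists (K * C * 2 `^ (1 / 2) * S + m * `|Z j|).
  by rewrite ltr_pwDl ?mulr_gt0 ?powR_gt0 // mulr_ge0 // ltW.
move=> n n0.
have -> : log_convolution i j n - M i * Z j =
  \sum_(1 <= d < n.+1) mu d * (ln d%:R ^+ i / d%:R ^+ 2) * (log_dirichlet j 2 (n %/ d) - Z j)
  + (moebius_log_sum R i n - M i) * Z j.
  rewrite /log_convolution mulrBl /moebius_log_sum mulr_suml addrA -big_split /=.
  by congr (_ - _); apply: eq_bigr => d _; ring.
apply: le_trans (ler_normD _ _) _; rewrite [leRHS]mulrDl; apply: lerD; last first.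
  rewrite normrM mulrAC; apply: ler_wpM2r => //.
  by have := hm n n0; rewrite (_ : 1 - 1 / 2 = 1 / 2) //; lra.
apply: le_trans (ler_norm_sum _ _ _) _.
apply: le_trans (_ : \sum_(1 <= k < n.+1) (K * C * 2 `^ (1 / 2) * n%:R `^ (- (1 / 2)))
   * k%:R `^ (- (1 + 1 / 4)) <= _); last first.
  rewrite -mulr_sumr mulrAC ler_wpM2r ?powR_ge0 //.
  by rewrite ler_wpM2l ?hS // !mulr_ge0 ?powR_ge0 // ltW.
rewrite !big_seq; apply: ler_sum => k; rewrite mem_index_iota => /andP[k0 kn].
have kn' : (0 < k <= n)%N by rewrite k0.
have k0' : 0 < k%:R :> R by rewrite ltr0n.
have q0 : (0 < n %/ k)%N by rewrite divn_gt0.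
have := normM_le (normM_le (normr_moebius R k) (hK k k0)) (hC _ q0).
move/le_trans; apply; rewrite [1 * (_ * _)]mul1r.
have -> : (2 - 1) / 2 = 1 / 2 :> R by lra.
apply: le_trans (_ : K * k%:R `^ (- (1 + (1 - 1 / 4))) *
   (C * (2 `^ (1 / 2) * (k%:R `^ (1 / 2) * n%:R `^ (- (1 / 2))))) <= _).
  rewrite ler_wpM2l ?mulr_ge0 ?powR_ge0 ?(ltW K0) // ler_pM2l //.
  by apply: floor_powR_opp_le => //; lra.
have -> : - (1 + 1 / 4) = - (1 + (1 - 1 / 4)) + 1 / 2 :> R by lra.
by rewrite -powR_addE // le_eqVlt; apply/orP; left; apply/eqP; ring.
Qed.

Lemma sum_moebius_multiples n (F : nat -> R) : (0 < n)%N ->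
  \sum_(1 <= d < n.+1) \sum_(1 <= m < (n %/ d).+1) mu d * F (d * m)%N = F 1%N.
Proof.
move=> n0; rewrite (big_divisors _ n (fun a k => mu a * F k)) big_ltn //=.
rewrite [X in _ + X]big1_seq ?addr0 => [|k].
  by rewrite big_mkcond big_nat1 /= moebius1 mul1r.
rewrite mem_index_iota => /andP[_ /andP[k1 _]].
by rewrite -mulr_suml -rmorph_sum /= sum_moebius // mul0r.
Qed.

(** Apart from [mu d] the summand depends only on [d * m], so only [d * m = 1] survives. Expanding
    the power for [j = 0, 1, 2] gives the Leibniz relations for the product of zeta and its
    inverse. *)
Lemma sum_moebius_log n j : (0 < n)%N ->
  \sum_(1 <= d < n.+1) \sum_(1 <= m < (n %/ d).+1)
    mu d * ((ln d%:R + ln m%:R) ^+ j * (d%:R ^- 2 * m%:R `^ (- 2))) = (j == 0)%:R.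
Proof.
move=> n0; have := sum_moebius_multiples (fun k => ln k%:R ^+ j * k%:R ^- 2) n0.
rewrite ln1 expr1n invr1 mulr1 expr0n => <-.
apply: eq_big_nat => d /andP[d0 _]; apply: eq_big_nat => m /andP[m0 _].
have d0' : 0 < d%:R :> R by rewrite ltr0n. have m0' : 0 < m%:R :> R by rewrite ltr0n.
by rewrite natrM lnM ?posrE // powR_invn ?ler0n // exprMn [in RHS]invfM.
Qed.

Lemma moebius_log_series0 : M 0%N * Z 0%N = 1.
Proof. 
have [C C0 hC] := log_convolution_rate 0 0.
apply: (limit_unique (s := log_convolution 0 0) _ hC (C' := 0)) => [|n n0]; first by lra.
rewrite mul0r normr_le0 subr_eq0; apply/eqP.
rewrite -[RHS](sum_moebius_log 0 n0); apply: eq_bigr => d _.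
by rewrite mulr_sumr; apply: eq_bigr => m _; rewrite !expr0; ring.
Qed.

Lemma moebius_log_series1 : M 1%N * Z 0%N + M 0%N * Z 1%N = 0.
Proof.
have [C C0 hC] := log_convolution_rate 1 0.
have [D D0 hD] := log_convolution_rate 0 1.
apply: (limit_unique (s := fun n => log_convolution 1 0 n + log_convolution 0 1 n)
  (d := 1 / 2) (C := C + D) (C' := 0)) => [|n n0|n n0]; first by lra.
  rewrite opprD addrACA [leRHS]mulrDl; apply: le_trans (ler_normD _ _) _.
  by apply: lerD; [exact: hC | exact: hD].
rewrite mul0r normr_le0 subr_eq0; apply/eqP.
rewrite -[RHS](sum_moebius_log 1 n0) -big_split; apply: eq_bigr => d _ /=.
by rewrite !mulr_sumr -big_split; apply: eq_bigr => m _; rewrite !expr0 !expr1 /=; ring.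
Qed.

Lemma moebius_log_series2 : M 2%N * Z 0%N + 2 * (M 1%N * Z 1%N) + M 0%N * Z 2%N = 0.
Proof.
have [C C0 hC] := log_convolution_rate 2 0.
have [D D0 hD] := log_convolution_rate 1 1.
have [E E0 hE] := log_convolution_rate 0 2.
apply: (limit_unique (s := fun n => log_convolution 2 0 n + 2 * log_convolution 1 1 n
    + log_convolution 0 2 n)
  (d := 1 / 2) (C := C + 2 * D + E) (C' := 0)) => [|n n0|n n0]; first by lra.
  rewrite opprD addrACA [leRHS]mulrDl; apply: le_trans (ler_normD _ _) _.
  apply: lerD; last exact: hE.
  rewrite opprD addrACA [leRHS]mulrDl; apply: le_trans (ler_normD _ _) _.
  apply: lerD; first exact: hC.
  by rewrite -mulrBr normrM ger0_norm // -mulrA ler_pM2l // hD.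
rewrite mul0r normr_le0 subr_eq0; apply/eqP.
rewrite -[RHS](sum_moebius_log 2 n0) mulr_sumr -!big_split; apply: eq_bigr => d _ /=.
by rewrite !mulr_sumr -!big_split; apply: eq_bigr => m _; rewrite !expr0 !expr1 /=; ring.
Qed.

End MoebiusRelations.

(** * The value of zeta at 2 *)

Section Basel.
Variable R : realType.
Implicit Types (n N k : nat) (x y : R).

Lemma inv_sin2_add_inv_cos2 y : 0 < y < pi / 2 ->
  (sin y ^+ 2)^-1 + (cos y ^+ 2)^-1 = 4 * (sin (y *+ 2) ^+ 2)^-1.
Proof.
move=> yp; have s0 := sin_gt0_pihalf yp.
have c0 : 0 < cos y by apply: cos_gt0_pihalf; lra.
have E := cos2Dsin2 y; rewrite sin_mulr2n.
move: (sin y) (cos y) s0 c0 E => s c s0 c0 E.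
have -> : (c * s *+ 2) ^+ 2 = 4 * (s ^+ 2 * c ^+ 2) by ring.
have -> : (s ^+ 2)^-1 + (c ^+ 2)^-1 = (c ^+ 2 + s ^+ 2) / (s ^+ 2 * c ^+ 2).
  by field; rewrite !gt_eqF.
by rewrite E; field; rewrite !gt_eqF.
Qed.

(** The bounds are [sin x <= x] and [cot x <= 1 / x], as the inverse squared sine is [1 + cot^2]. *)
Lemma inv_sin2_bounds x : 0 < x < pi / 2 ->
  (x ^+ 2)^-1 <= (sin x ^+ 2)^-1 <= (x ^+ 2)^-1 + 1.
Proof.
move=> xp; have x0 : 0 < x by lra.
have s0 := sin_gt0_pihalf xp.
have c0 : 0 < cos x by apply: cos_gt0_pihalf; lra.
have sx : sin x <= x.
  have [c _] := mean_value (ltW x0) (fun z _ => is_derive_sin z).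
  by rewrite sin0 !subr0 => ->; rewrite -[leRHS]mul1r ler_wpM2r ?cos_le1 // ltW.
have tx : x * cos x <= sin x.
  have [|c /andP[c1 c2]] := @mean_value _ (fun z => sin z - z * cos z) (fun z => z * sin z) 0 x (ltW x0).
    move=> z _; apply: is_derive_eq.
    by rewrite /GRing.scale /=; ring.
  rewrite sin0 mul0r !subr0 => E; rewrite -subr_ge0 E.
  rewrite !mulr_ge0 ?(ltW x0) //.
  move: c1; rewrite le_eqVlt => /orP[/eqP<-|c1]; first by rewrite sin0.
  by apply/ltW/sin_gt0_pihalf; lra.
have E := cos2Dsin2 x.
apply/andP; split.
  by rewrite lef_pV2 ?posrE ?exprn_gt0 // lerXn2r ?nnegrE ?(ltW x0) ?(ltW s0).
have -> : (sin x ^+ 2)^-1 = (cos x / sin x) ^+ 2 + 1.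
  move: (sin x) (cos x) s0 E {sx tx c0} => s c s0 E.
  have -> : (s ^+ 2)^-1 = (c ^+ 2 + s ^+ 2) / s ^+ 2 by rewrite E div1r.
  by field; rewrite !gt_eqF.
rewrite lerD2r -exprVn lerXn2r ?nnegrE ?invr_ge0 ?divr_ge0 ?(ltW x0) ?(ltW s0) ?(ltW c0) //.
by rewrite ler_pdivrMr // mulrC ler_pdivlMr // mulrC.
Qed.

Definition odd_angle N k : R := (2 * k + 1)%:R * pi / (4 * N%:R).

Lemma odd_angle_itv N k : (k < N)%N -> 0 < odd_angle N k < pi / 2.
Proof.
move=> kN; have N0 : 0 < N%:R :> R by rewrite ltr0n (leq_trans _ kN).
rewrite /odd_angle; apply/andP; split.
  by rewrite divr_gt0 ?mulr_gt0 ?pi_gt0 // ltr0n addn1.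
rewrite ltr_pdivrMr ?mulr_gt0 //.
have -> : pi / 2 * (4 * N%:R) = (2 * N)%:R * pi :> R by rewrite natrM; field.
by rewrite ltr_pM2r ?pi_gt0 // ltr_nat; move: kN; clear; lia.
Qed.

(** Among [2 * N] odd angles the [k]-th and its mirror image add up to [pi / 2]. Their two terms
    combine into four times the term at the doubled angle, which is the [k]-th odd angle for [N]. *)
Lemma sum_inv_sin2 n :
  \sum_(0 <= k < 2 ^ n) (sin (odd_angle (2 ^ n) k) ^+ 2)^-1 = 2 * ((2 ^ n)%:R) ^+ 2.
Proof.
have cosE y : cos y = sin (- y + pi / 2) by rewrite sinDpihalf cosN.
elim: n => [|n IH].
  rewrite expn0 big_nat1 expr1n mulr1; have := inv_sin2_add_inv_cos2 (odd_angle_itv (ltn0Sn 0)).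
  have aE : - odd_angle 1 0 + pi / 2 = odd_angle 1 0 by rewrite /odd_angle; field.
  have a2 : odd_angle 1 0 *+ 2 = pi / 2 by rewrite /odd_angle -mulr_natr; field.
  rewrite cosE aE a2 sin_pihalf expr1n invr1 mulr1; move: (_^-1) => u; lra.
rewrite expnS; move: (2 ^ n)%N (expn_gt0 2 n) IH => N /= N0 IH.
have N0' : 0 < N%:R :> R by rewrite ltr0n.
have -> : (2 * N = N + N)%N by lia.
rewrite (@big_cat_nat _ _ _ N) //=; last exact: leq_addr.
rewrite [X in _ + X]big_nat_rev /= -[index_iota N _]/(index_iota (0 + N) (N + N)) big_addn addnK.
transitivity (\sum_(0 <= k < N) 4 * (sin (odd_angle N k) ^+ 2)^-1); last first.
  by rewrite -mulr_sumr IH natrD; ring.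
rewrite -big_split; apply: eq_big_nat => k /andP[_ kN] /=.
rewrite -(_ : odd_angle (N + N) k *+ 2 = odd_angle N k).
  rewrite -inv_sin2_add_inv_cos2; last by apply: odd_angle_itv; exact: leq_trans kN (leq_addr _ _).
  congr (_ + (_ ^+ 2)^-1); rewrite cosE; congr sin.
  have -> : (N + (N + N) - (k + N).+1 = N + N - k.+1)%N by lia.
  rewrite /odd_angle; have -> : (2 * (N + N - k.+1) + 1 = 4 * N - (2 * k + 1))%N by lia.
  rewrite natrB; last by lia.
  by rewrite !natrM !natrD; field; rewrite gt_eqF ?addr_gt0.
by rewrite /odd_angle natrD -mulr_natr; field; rewrite !gt_eqF ?addr_gt0.
Qed.

Lemma odd_sum_rescale (p m S : R) : 0 < p -> 0 < m ->
  16 * m ^+ 2 / p ^+ 2 * S <= 2 * m ^+ 2 -> 2 * m ^+ 2 <= 16 * m ^+ 2 / p ^+ 2 * S + m ->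
  `|S - p ^+ 2 / 8| <= p ^+ 2 / 16 * m^-1.
Proof.
move=> p0 m0 h1 h2; pose c := p ^+ 2 / (16 * m ^+ 2).
have c0 : 0 <= c by apply: ltW; rewrite divr_gt0 ?exprn_gt0 ?mulr_gt0 ?exprn_gt0.
have E1 : c * (16 * m ^+ 2 / p ^+ 2 * S) = S by rewrite /c; field; rewrite !gt_eqF.
have E2 : c * (2 * m ^+ 2) = p ^+ 2 / 8 by rewrite /c; field; rewrite gt_eqF.
have E3 : c * m = p ^+ 2 / 16 * m^-1 by rewrite /c; field; rewrite gt_eqF.
have := ler_wpM2l c0 h2; have := ler_wpM2l c0 h1; rewrite mulrDr E1 E2 E3.
have := mulr_ge0 c0 (ltW m0); rewrite E3; move: (p ^+ 2 / 16 * m^-1) (p ^+ 2 / 8) => u v.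
by clear => *; rewrite ler0_norm; lra.
Qed.

(** Each of the [N] inverse squared sines exceeds the inverse squared angle by at most 1, and their
    total is [2 * N^2], so the relative error is [O(1 / N)]. *)
Lemma sum_odd_inv_sqr_bounds n :
  `|\sum_(0 <= k < 2 ^ n) ((2 * k + 1)%:R ^+ 2)^-1 - pi ^+ 2 / 8|
    <= pi ^+ 2 / 16 * (2 ^ n)%:R^-1 :> R.
Proof.
set N := (2 ^ n)%N; have N0 : 0 < N%:R :> R by rewrite ltr0n expn_gt0.
have p0 := pi_gt0 R.
pose S : R := \sum_(0 <= k < N) ((2 * k + 1)%:R ^+ 2)^-1.
have E : \sum_(0 <= k < N) (odd_angle N k ^+ 2)^-1 = 16 * N%:R ^+ 2 / pi ^+ 2 * S.
  rewrite mulr_sumr; apply: eq_bigr => k _.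
  have k0 : 0 < (2 * k + 1)%:R :> R by rewrite ltr0n addn1.
  rewrite /odd_angle; move: ((2 * k + 1)%:R : R) (N%:R : R) (pi : R) k0 N0 p0 => u v p u0 v0 p0.
  by field; rewrite !gt_eqF.
have h1 : \sum_(0 <= k < N) (odd_angle N k ^+ 2)^-1 <= 2 * N%:R ^+ 2.
  rewrite -sum_inv_sin2; rewrite !big_seq; apply: ler_sum => k; rewrite mem_index_iota => /andP[_ kN].
  by have /andP[] := inv_sin2_bounds (odd_angle_itv kN).
have h2 : 2 * N%:R ^+ 2 <= \sum_(0 <= k < N) (odd_angle N k ^+ 2)^-1 + N%:R.
  have Nsum : N%:R = \sum_(0 <= k < N) 1 :> R by rewrite big_const_nat subn0 iter_addr addr0.
  rewrite [X in _ <= _ + X]Nsum -big_split -sum_inv_sin2 !big_seq; apply: ler_sum => k.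
  rewrite mem_index_iota => /andP[_ kN] /=.
  by have /andP[] := inv_sin2_bounds (odd_angle_itv kN).
rewrite E in h1 h2; exact: odd_sum_rescale.
Qed.

Lemma log_dirichlet_even_odd N :
  log_dirichlet 0 2 (2 * N) = \sum_(0 <= k < N) ((2 * k + 1)%:R ^+ 2)^-1
    + log_dirichlet 0 2 N / 4 :> R.
Proof.
have E n : log_dirichlet 0 2 n = \sum_(1 <= k < n.+1) (k%:R ^+ 2)^-1 :> R.
  apply: eq_bigr => k _; rewrite expr0 mul1r powR_invn ?ler0n //.
rewrite !E; elim: N => [|N IH]; first by rewrite muln0 !big_geq // mul0r addr0.
have -> : (2 * N.+1 = (2 * N).+2)%N by lia.
rewrite big_nat_recr //= big_nat_recr //= IH [in RHS]big_nat_recr //= [in RHS]big_nat_recr //=.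
rewrite addn1; have -> : (2 * N).+2%:R = 2 * N.+1%:R :> R by rewrite -natrM; congr (_%:R); lia.
have -> : (2 * N.+1%:R) ^- 2 = N.+1%:R ^- 2 / 4 :> R.
  by rewrite exprMn invfM mulrC; congr (_ * _); rewrite -natrX.
by rewrite mulrDl; ring.

Qed.

Lemma basel : zeta 2 = pi ^+ 2 / 6 :> R.
Proof.
rewrite zetaE; have [C C0 hC] := @log_zeta_rate R 0 2 (ltr1n R 2).
set Z := log_zeta 0 2 in hC *.
(* The even terms make up a quarter of zeta(2); what remains is the sum over odd squares. *)
suff : 3 / 4 * Z = pi ^+ 2 / 8 by lra.
have h12 : 0 < 1 / 2 :> R by lra.
apply: (limit_unique (s := fun _ => 3 / 4 * Z) (C := 0)
  (C' := C + C / 4 + pi ^+ 2 / 16) h12) => n n0; first by rewrite subrr normr0 mul0r.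
(* The sums are controlled along powers of two only; [n <= 2 ^ n] turns this into a rate in [n]. *)
pose N := (2 ^ n)%N; have nN : (n <= N)%N by apply: ltnW; exact: ltn_expl.
have N0 : (0 < N)%N by rewrite expn_gt0.
have n1 : 0 < n%:R :> R by rewrite ltr0n.
have mono m : (n <= m)%N -> m%:R `^ (- (1 / 2)) <= n%:R `^ (- (1 / 2)) :> R.
  move=> nm; rewrite !powRN lef_pV2 ?posrE ?powR_gt0 ?ltr0n ?(leq_trans n0) //.
  by rewrite ge0_ler_powR ?nnegrE ?ler_nat ?ler0n //; lra.
have h1 := sum_odd_inv_sqr_bounds n; rewrite -/N in h1.
have h2 := hC _ N0.
have h3 : `|log_dirichlet 0 2 (2 * N) - Z| <= C * (2 * N)%:R `^ (- ((2 - 1) / 2)).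
  by apply: hC; rewrite muln_gt0.
rewrite (_ : (2 - 1) / 2 = 1 / 2 :> R) in h2 h3; last by lra.
have h2' : `|log_dirichlet 0 2 N - Z| <= C * n%:R `^ (- (1 / 2)).
  by apply: le_trans h2 _; rewrite ler_pM2l // mono.
have h3' : `|log_dirichlet 0 2 (2 * N) - Z| <= C * n%:R `^ (- (1 / 2)).
  by apply: le_trans h3 _; rewrite ler_pM2l // mono // (leq_trans nN) // leq_pmull.
have h1' : N%:R^-1 <= n%:R `^ (- (1 / 2)) :> R.
  apply: le_trans (_ : N%:R `^ (- (1 / 2)) <= _); last exact: mono.
  rewrite -powR_inv1 ?ler0n // ler_powR ?ler1n //; lra.
rewrite log_dirichlet_even_odd in h3'.
have p2 : 0 <= pi ^+ 2 / 16 :> R by rewrite divr_ge0 ?sqr_ge0.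
have h4 : `|\sum_(0 <= k < N) ((2 * k + 1)%:R ^+ 2)^-1 - pi ^+ 2 / 8|
    <= pi ^+ 2 / 16 * n%:R `^ (- (1 / 2)) :> R.
  by apply: le_trans h1 _; rewrite ler_wpM2l.
move: h2' h3' h4; rewrite !ler_norml; clear.
move: (log_dirichlet _ _ _) (\sum_(_ <= _ < _) _) (pi ^+ 2) (_ `^ _) => z o p u.
by move=> /andP[? ?] /andP[? ?] /andP[? ?]; apply/andP; split; lra.
Qed.

End Basel.

(** * The main theorem *)

Section Counting.
Variable R : realType.
Implicit Types (n N k j : nat) (s d h x : R).

Local Notation mu k := ((moebius k)%:~R : R).
Local Notation M := (@moebius_log_series R).
Local Notation g0 := (@stieltjes R 0).
Local Notation g1 := (@stieltjes R 1).
Local Open Scope classical_set_scope.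

(** The polynomial in [ln n + c] of [weighted_square_sum_asymptotic], re-expanded in powers of
    [ln n]; [p] enters only the constant term. *)
Definition weighted_coeff (p : R) (r : nat) : R :=
  let c := 2 * g0 - 1 in
  match r with
  | 0 => c ^+ 3 / 3 + g0 * c ^+ 2 - 2 * g1 * c + p
  | 1 => c ^+ 2 + 2 * g0 * c - 2 * g1
  | 2 => c + g0
  | _ => 1 / 3
  end.

Lemma weighted_square_sum_log_poly d : 0 < d -> 3 * d < 1 ->
  exists p, exists2 C : R, 0 < C & forall n, (0 < n)%N ->
    `|(weighted_square_sum n)%:R - n%:R ^+ 2 * log_poly (weighted_coeff p) n%:R|
      <= C * n%:R `^ (19 / 12 + 3 * d).
Proof.
move=> d0 d3; have [p [C C0 hC]] := weighted_square_sum_asymptotic d0 d3.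
exists p, C => // n n0; have := hC n n0; congr (`| _ - _ * _ | <= _).
by rewrite log_polyE /weighted_coeff; field.
Qed.

Lemma gcd_sum_idE N : (0 < N)%N -> (gcd_sum id N)%:R =
  \sum_(1 <= k < N.+1) mu k * (weighted_square_sum (N %/ k))%:R :> R.
Proof.
apply: (moebius_inversion (F := fun N => (weighted_square_sum N)%:R) (H := fun N => (gcd_sum id N)%:R)).
by move=> n; rewrite -sum_gcd_sum_id natr_sum.
Qed.

Lemma gcd_sum_totientE N : (0 < N)%N -> (gcd_sum totient N)%:R =
  \sum_(1 <= k < N.+1) mu k * (gcd_sum id (N %/ k))%:R :> R.
Proof.
apply: (moebius_inversion (F := fun N => (gcd_sum id N)%:R) (H := fun N => (gcd_sum totient N)%:R)).
by move=> n; rewrite -sum_gcd_sum_totient natr_sum.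
Qed.

Lemma sum_le2_subgroups x : sum_le2 nb_subgroups x = (gcd_sum id (Num.truncn x))%:R.
Proof.
rewrite -sum2_sum2_divisors natr_sum; apply: eq_big_nat => m /andP[m0 _].
by rewrite natr_sum; apply: eq_big_nat => n /andP[n0 _]; rewrite nb_subgroupsE.
Qed.

Lemma sum_le2_cyclic_subgroups x :
  sum_le2 nb_cyclic_subgroups x = (gcd_sum totient (Num.truncn x))%:R.
Proof.
rewrite -sum2_sum2_divisors natr_sum; apply: eq_big_nat => m /andP[m0 _].
by rewrite natr_sum; apply: eq_big_nat => n /andP[n0 _]; rewrite nb_cyclic_subgroupsE.
Qed.

Lemma floor_asymptotic e e' (F : nat -> nat) (f : R -> R) (a : nat -> R) : 1 < e -> e <= e' ->
  (forall x, f x = (F (Num.truncn x))%:R) ->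
  (exists2 C, 0 < C & forall n, (0 < n)%N ->
     `|(F n)%:R - n%:R ^+ 2 * log_poly a n%:R| <= C * n%:R `^ e) ->
  exists2 C, 0 < C & \forall x \near +oo, `|f x - x ^+ 2 * log_poly a x| <= C * x `^ e'.
Proof.
move=> e1 ee' fE [C C0 hC]; have [K K0 hK] := log_poly_floor a e1.
exists (C + K); first exact: addr_gt0.
near=> x; have x1 : 1 <= x by near: x; apply: nbhs_pinfty_ge; rewrite num_real.
have x0 : 0 <= x by lra.
have /andP[t1 t2] := truncn_itv x0.
set n := Num.truncn x in t1 t2.
have n0 : (0 < n)%N by rewrite truncn_gt0.
have n1 : 1 <= n%:R :> R by rewrite ler1n.
rewrite fE -/n.
have -> : (F n)%:R - x ^+ 2 * log_poly a x = ((F n)%:R - n%:R ^+ 2 * log_poly a n%:R)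
  + (n%:R ^+ 2 * log_poly a n%:R - x ^+ 2 * log_poly a x) by ring.
apply: le_trans (ler_normD _ _) _; apply: le_trans (_ : (C + K) * x `^ e <= _); last first.
  by rewrite ler_pM2l ?addr_gt0 // ler_powR.
rewrite mulrDl; apply: lerD; last by apply: hK => //; rewrite natr1.
apply: le_trans (hC n n0) _; rewrite ler_pM2l // ge0_ler_powR ?nnegrE ?ler0n //; lra.
Unshelve. all: by end_near. Qed.

(** The three relations are solved in turn. The values are those at 2 of [1 / zeta] and of its first
    two derivatives, with the sign [(-1)^j]. *)
Lemma moebius_log_seriesE (z z' z'' : R) : z = zeta 2 -> z' = (@zeta R)^`() 2 ->
  z'' = (@zeta R)^`(2) 2 -> z != 0 ->
  [/\ M 0%N = z^-1, M 1%N = z' / z ^+ 2 & M 2%N = 2 * z' ^+ 2 / z ^+ 3 - z'' / z ^+ 2].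
Proof.
have R12 : 1 < 2 :> R by rewrite ltr1n.
move=> -> -> ->; rewrite derive1_zeta // derive2_zeta // zetaE => z0.
have r0 := moebius_log_series0 R; have r1 := moebius_log_series1 R.
have r2 := moebius_log_series2 R.
move: (M 0%N) (M 1%N) (M 2%N) (log_zeta 0 2) (log_zeta 1 2) (log_zeta 2 2) z0 r0 r1 r2.
move=> M0 M1 M2 Z0 Z1 Z2 z0 r0 r1 r2.
have E0 : M0 = Z0^-1 by rewrite -[LHS](mulfK z0) r0 mul1r.
have E1 : M1 = - Z1 / Z0 ^+ 2.
  have -> : M1 = (M1 * Z0 + M0 * Z1 - M0 * Z1) / Z0 by field.
  by rewrite r1 E0; field.
split=> //.
have -> : M2 = (M2 * Z0 + 2 * (M1 * Z1) + M0 * Z2 - 2 * (M1 * Z1) - M0 * Z2) / Z0 by field.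
by rewrite r2 E0 E1; field.
Qed.

End Counting.

Local Open Scope classical_set_scope.

Theorem theorem2 (R : realType) :
  let z : R := zeta 2 in
  let z' : R := (@zeta R)^`() 2 in
  let z'' : R := (@zeta R)^`(2) 2 in
  let g : R := stieltjes R 0 in
  let g1 : R := stieltjes R 1 in
  exists A B : nat -> R,
    (A 3%N = 1 / (3 * z) /\ A 3%N = 2 / pi ^+ 2) /\
    A 2%N = 1 / z * (3 * g - 1 - z' / z) /\
    A 1%N = 1 / z * (8 * g ^+ 2 - 6 * g - 2 * g1 + 1
                     - 2 * (3 * g - 1) * (z' / z)
                     + 2 * (z' / z) ^+ 2 - z'' / z) /\
    (B 3%N = 1 / (3 * z ^+ 2) /\ B 3%N = 12 / pi ^+ 4) /\
    B 2%N = 1 / z ^+ 2 * (3 * g - 1 - 2 * (z' / z)) /\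
    B 1%N = 1 / z ^+ 2 * (8 * g ^+ 2 - 6 * g - 2 * g1 + 1
                          - 4 * (3 * g - 1) * (z' / z)
                          + 6 * (z' / z) ^+ 2 - 2 * (z'' / z)) /\
    forall eps : R, 0 < eps ->
      (exists2 C : R, 0 < C & \forall x \near +oo_R,
         `|sum_le2 nb_subgroups x
           - x ^+ 2 * \sum_(0 <= r < 4) A r * ln x ^+ r|
         <= C * x `^ (1117 / 701 + eps)) /\
      (exists2 C : R, 0 < C & \forall x \near +oo_R,
         `|sum_le2 nb_cyclic_subgroups x
           - x ^+ 2 * \sum_(0 <= r < 4) B r * ln x ^+ r|
         <= C * x `^ (1117 / 701 + eps)).
Proof.
move=> z z' z'' g g1.
have zE : z = pi ^+ 2 / 6 := basel R.
have p0 : (pi : R) != 0 by rewrite gt_eqF ?pi_gt0.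
have z0 : z != 0 by rewrite zE mulf_neq0 ?expf_neq0 // invr_eq0 pnatr_eq0.
have [M0 M1 M2] := @moebius_log_seriesE R z z' z'' erefl erefl erefl z0.
(* A fixed [d] with [19/12 + 3 * d < 1117/701] serves every [eps], so that [p], and with it [A 0]
   and [B 0], does not depend on [eps]. *)
pose d : R := 1 / 1000.
have d0 : 0 < d by rewrite /d; lra.
have d3 : 3 * d < 1 by rewrite /d; lra.
have e1 : 1 < 19 / 12 + 3 * d :> R by rewrite /d; lra.
have e3 : 19 / 12 + 3 * d < 3 :> R by rewrite /d; lra.
have [p hG] := @weighted_square_sum_log_poly R d d0 d3.
have hA := moebius_transform e1 e3 hG.
set A := transform_coeff _ _ in hA.
have hA' : exists2 C : R, 0 < C & forall n, (0 < n)%N ->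
   `|(gcd_sum id n)%:R - n%:R ^+ 2 * log_poly A n%:R| <= C * n%:R `^ (19 / 12 + 3 * d).
  by have [C C0 hC] := hA; exists C => // n n0; rewrite gcd_sum_idE // hC.
(* The cyclic count is one further Moebius transform of the count of all subgroups, so [B] arises
   from [A] as [A] does from [weighted_coeff p]. *)
have hB := moebius_transform e1 e3 hA'.
set B := transform_coeff _ _ in hB.
have hB' : exists2 C : R, 0 < C & forall n, (0 < n)%N ->
   `|(gcd_sum totient n)%:R - n%:R ^+ 2 * log_poly B n%:R| <= C * n%:R `^ (19 / 12 + 3 * d).
  by have [C C0 hC] := hB; exists C => // n n0; rewrite gcd_sum_totientE // hC.
have A3 : A 3%N = 1 / (3 * z) by rewrite /A /= M0; field.
have A2 : A 2%N = 1 / z * (3 * g - 1 - z' / z).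
  by rewrite /A /= M0 M1 -/g; field.
have A1 : A 1%N = 1 / z * (8 * g ^+ 2 - 6 * g - 2 * g1 + 1
                     - 2 * (3 * g - 1) * (z' / z) + 2 * (z' / z) ^+ 2 - z'' / z).
  by rewrite /A /= M0 M1 M2 -/g -/g1; field.
have BE r : B r = transform_coeff A (@moebius_log_series R) r by [].
exists A, B; split; first by split=> //; rewrite A3 zE; move: (pi : R) p0 => u u0; field.
do 2!split=> //; split.
  have -> : B 3%N = 1 / (3 * z ^+ 2) by rewrite BE /transform_coeff A3 M0; field.
  by split=> //; rewrite zE; move: (pi : R) p0 => u u0; field.
split; first by rewrite BE /transform_coeff A2 A3 M0 M1; field.
split; first by rewrite BE /transform_coeff A1 A2 A3 M0 M1 M2; field.
move=> eps eps0.
have ee : 19 / 12 + 3 * d <= 1117 / 701 + eps by rewrite /d; lra.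
split.
- exact: floor_asymptotic e1 ee (@sum_le2_subgroups R) hA'.
- exact: floor_asymptotic e1 ee (@sum_le2_cyclic_subgroups R) hB'.
Qed.
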